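(* Let $\mathcal{T}_n$ denote the set of topological equivalence classes of generic two-layer 3D mosaic floor plans with $n$ blocks. Then \[ \lim_{n\to\infty} \frac{\log |\mathcal{T}_n|}{n \log n} = \frac{1}{3}. \]
   Context: A 3D mosaic floor plan with $n$ blocks is a partition of an axis-parallel box $H=[0,a]\times[0,b]\times[0,c]$ (the host box) into $n$ axis-parallel boxes (the blocks) with pairwise disjoint interiors. It is two-layer if there is $0<h<c$ such that the $z$-extent of every block is $[0,h]$, $[h,c]$ or $[0,c]$. A corner is a point that is a vertex of at least one block; a corner is generic if the combinatorial shape of the local arrangement of the blocks around it is stable under every sufficiently small perturbation of the blocks adjacent to it (the perturbation is local and need not extend to the whole floor plan); a floor plan is generic if all its corners are generic. Two faces of blocks are attached if their intersection has positive area; a dissection plane is the union of the faces in one class of the equivalence relation generated by attachment. For each coordinate direction, the dissection graph is the directed multigraph whose vertices are the dissection planes orthogonal to that direction, with one edge per block joining the two dissection planes containing the block's two faces orthogonal to that direction, oriented towards the larger coordinate. Two floor plans are topologically equivalent if for each of the three directions their dissection graphs are isomorphic. *)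

(* Defs.v *)
From HB Require Import structures.
From Stdlib Require Import Relations.
From mathcomp Require Import all_boot all_order all_algebra finmap.
From mathcomp Require Import all_classical all_reals all_analysis.

Set Implicit Arguments.
Unset Strict Implicit.
Unset Printing Implicit Defensive.

Import Order.TTheory GRing.Theory Num.Theory numFieldNormedType.Exports.

Local Open Scope classical_set_scope.
Local Open Scope ring_scope.

Section FloorPlans.
Variable R : realType.

Local Notation point := 'rV[R]_3.

Record box := Box {
  lo : point;
  hi : point;
  lo_lt_hi : forall k, lo 0 k < hi 0 k }.

Definition box_set (B : box) : set point :=
  [set p | forall k, lo B 0 k <= p 0 k <= hi B 0 k].

Definition is_vertex (B : box) (p : point) : Prop :=
  forall k, p 0 k = lo B 0 k \/ p 0 k = hi B 0 k.

(* The side [b] is [false] for the face with the smaller [k]-coordinate and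
   [true] for the face with the larger one. *)
Definition face (B : box) (k : 'I_3) (b : bool) : set point :=
  [set p | box_set B p /\ p 0 k = (if b then hi B else lo B) 0 k].

(* Area of a subset of a plane orthogonal to the direction [k], computed in the
   two remaining coordinates. *)
Definition area (k : 'I_3) (A : set point) : \bar R :=
  (@lebesgue_measure R \x @lebesgue_measure R)%E
    [set (p 0 (lift k (0 : 'I_2)), p 0 (lift k (1 : 'I_2))) | p in A].

Record floor_plan (n : nat) := FloorPlan {
  host : box;
  block : 'I_n -> box;
  host_lo : lo host = 0;
  block_cover : \bigcup_i box_set (block i) = box_set host;
  block_disj : forall i j, i != j ->
    (box_set (block i))° `&` (box_set (block j))° = set0 }.

Section Fixed.
Variables (n : nat) (F : floor_plan n).

(* The third coordinate, [ord_max : 'I_3], is [z]. *)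
Definition two_layer : Prop :=
  exists2 h : R, 0 < h < hi (host F) 0 ord_max &
  forall i, let zext := (lo (block F i) 0 ord_max, hi (block F i) 0 ord_max) in
    [\/ zext = (0, h), zext = (h, hi (host F) 0 ord_max)
      | zext = (0, hi (host F) 0 ord_max)].

Definition corner (p : point) : Prop := exists i, is_vertex (block F i) p.

Definition adjacent (p : point) : set 'I_n := [set i | box_set (block F i) p].

End Fixed.

(* [A] contains the germ at [p] of the open octant with signs [s], where
   [s k = false] stands for the positive direction along the axis [k]. *)
Definition fills_octant (A : set point) (p : point) (s : 'I_3 -> bool) : Prop :=
  exists2 d : R, 0 < d &
  forall q : point, (forall k, 0 < (-1) ^+ s k * (q 0 k - p 0 k) < d) -> A q.

Section Genericity.
Variables (n : nat) (F : floor_plan n) (p : point).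

(* [B] moves the blocks adjacent to [p] by less than [e], and the moved blocks
   still dissect the part of the (fixed) host box at distance less than [r] of
   [p].  The values of [B] at the other blocks are irrelevant. *)
Definition local_perturbation (r e : R) (B : 'I_n -> box) : Prop :=
  [/\ forall i, adjacent F p i ->
        ball (lo (block F i)) e (lo (B i)) /\
        ball (hi (block F i)) e (hi (B i)),
      (\bigcup_(i in adjacent F p) box_set (B i)) `&` ball p r
        = box_set (host F) `&` ball p r
    & forall i j, adjacent F p i -> adjacent F p j -> i != j ->
        (box_set (B i))° `&` (box_set (B j))° `&` ball p r = set0].

(* Near a point, the arrangement is described by the block filling each of the
   eight octants. *)
Definition same_local_shape (B : 'I_n -> box) (p' : point) : Prop :=
  forall i s, adjacent F p i ->
    (fills_octant (box_set (block F i)) p s <->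
     fills_octant (box_set (B i)) p' s).

(* The neighbourhood is fixed before the size of the perturbation. For large
   [r] no perturbation of the adjacent blocks covers the neighbourhood, so only
   small [r] matter. *)
Definition generic_at : Prop :=
  forall r : R, 0 < r -> exists2 e : R, 0 < e &
  forall B, local_perturbation r e B ->
  exists2 p', ball p r p' & same_local_shape B p'.

End Genericity.

Definition generic (n : nat) (F : floor_plan n) : Prop :=
  forall p, corner F p -> generic_at F p.

Section Dissection.
Variables (n : nat) (F : floor_plan n) (k : 'I_3).

(* The face [(i, b)] is the face of the block [i] orthogonal to [k], on the side
   [b].  Faces orthogonal to different directions are never attached. *)
Definition face_of (f : 'I_n * bool) : set point := face (block F f.1) k f.2.

Definition attached (f g : 'I_n * bool) : Prop :=
  (0 < area k (face_of f `&` face_of g))%E.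

Definition dissection_plane (f : 'I_n * bool) : set point :=
  \bigcup_(g in clos_refl_sym_trans _ attached f) face_of g.

End Dissection.

End FloorPlans.

Record multigraph (V E : Type) := Multigraph {
  vertices : set V;
  source : E -> V;
  target : E -> V }.

Definition isomorphic (V1 E1 V2 E2 : Type)
    (G1 : multigraph V1 E1) (G2 : multigraph V2 E2) : Prop :=
  exists (f : V1 -> V2) (g : E1 -> E2),
    [/\ set_bij (vertices G1) (vertices G2) f, bijective g,
        forall e, f (source G1 e) = source G2 (g e)
      & forall e, f (target G1 e) = target G2 (g e)].

(* A face contained in the boundary of the host box is attached only to itself,
   so that the boundary planes appear as one source (sink) per block touching
   them.  Merging all sources and merging all sinks is reversible, hence this
   does not affect isomorphism. *)
Definition dissection_graph (R : realType) (n : nat) (F : floor_plan R n)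
    (k : 'I_3) : multigraph (set 'rV[R]_3) 'I_n :=
  {| vertices := range (dissection_plane F k);
     source := fun i => dissection_plane F k (i, false);
     target := fun i => dissection_plane F k (i, true) |}.

Definition topologically_equivalent (R : realType) (n : nat)
    (F G : floor_plan R n) : Prop :=
  forall k, isomorphic (dissection_graph F k) (dissection_graph G k).

Definition generic_two_layer (R : realType) (n : nat) : set (floor_plan R n) :=
  [set F | generic F /\ two_layer F].

(* The set of equivalence classes, each class being a set of floor plans. *)
Definition topological_classes (R : realType) (n : nat) :
    set (set (floor_plan R n)) :=
  [set [set G | generic_two_layer G /\ topologically_equivalent F G]
    | F in @generic_two_layer R n].

Arguments topological_classes : clear implicits.

(* Main.v *)
Require Import Defs.
From Stdlib Require Import Relations.
From mathcomp Require Import all_boot all_order all_algebra all_fingroup finmap.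
From mathcomp Require Import all_classical all_reals all_analysis.
From mathcomp Require Import lra ring zify.

(* A layer of a two-layer plan is a generic dissection of a rectangle, which is
   encoded with a bounded number of bits per rectangle by a pair of binary trees
   ("twin binary trees"): the parent of a block is the block sharing its upper
   left (resp. lower right) corner, and both trees have the same in-order
   sequence. A plan is then determined by the encodings of its layers together
   with the identification of the blocks that meet both layers. Across a common
   vertex this identification propagates, so it is enough to match one block per
   component of vertex-sharing blocks; comparing corners, a layer has at least as
   many blocks of its own, up to one, as there are such components. Hence there
   are at most (n + 2) / 3 components and at most K^n (n/3)^(n/3) plans.

   For the lower bound, the blocks meeting both layers are cells of a grid; one
   layer is cut into columns and the other one into rows. The graph of one
   direction recovers the order of the columns, and which columns are consecutive
   in some row. With long rows and columns almost all of the three blocks per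
   cell are the cell and its successors in its row and its column, and the number
   of choices is n^(n/3 - o(n)). *)


Set Implicit Arguments.
Unset Strict Implicit.
Unset Printing Implicit Defensive.

Import Order.TTheory GRing.Theory Num.Theory numFieldNormedType.Exports.

Local Notation rst := (clos_refl_sym_trans _).
Local Notation kX := (@Ordinal 3 0 isT).
Local Notation kY := (@Ordinal 3 1 isT).
Local Notation kZ := (ord_max : 'I_3).

(** The bound on the components is a double count. The lower left corner of the first block of a
    component in lexicographic order, and the upper right corner of the last one, are corners of the
    host or coincide with the upper left or lower right corner of a block, which cannot be a shared
    one. Without crossings no corner is used twice, so 2c <= 2m + 2 for c components and m own
    blocks of a layer; both layers together give 3c <= n + 2. In the direction z only the faces at
    the inner height carry information, and as each direction may use its own bijection, they cost
    boundedly many bits per block.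

    For the lower bound, the graph shows which columns follow a given column but not in which row.
    The number q of groups of columns is therefore fixed while their width w grows: naming the right
    successor costs one of q + 2 values per cell, which is only exponential in n, against
    w!^(q(q-1)) choices with n about 3wq^2. Genericity of these plans concerns all small real
    perturbations; it is reduced to a combinatorial condition on integer coordinates, [rigid]. *)

Lemma ord3_ind (Q : 'I_3 -> Prop) : Q kX -> Q kY -> Q kZ -> forall k, Q k.
Proof.
move=> p0 p1 p2 [[|[|[|k]]] Hk] //.
- by have -> : Ordinal Hk = kX by apply/val_inj.
- by have -> : Ordinal Hk = kY by apply/val_inj.
- by have -> : Ordinal Hk = kZ by apply/val_inj.
Qed.

(** * Binary trees *)

Inductive btree (A : Type) := Lf | Nd of btree A & A & btree A.
Arguments Lf {A}.

Fixpoint inorder A (t : btree A) : seq A :=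
  if t is Nd l a r then inorder l ++ a :: inorder r else [::].

Fixpoint bmap A B (f : A -> B) (t : btree A) : btree B :=
  if t is Nd l a r then Nd (bmap f l) (f a) (bmap f r) else Lf.

Definition broot A (t : btree A) : option A := if t is Nd _ a _ then Some a else None.

Fixpoint bcode A (t : btree A) : seq (option A) :=
  if t is Nd l a r then Some a :: bcode l ++ bcode r else [:: None].

Inductive subtree A : btree A -> A -> btree A -> btree A -> Prop :=
| SubHere l a r : subtree (Nd l a r) a l r
| SubL l a r b l' r' : subtree l b l' r' -> subtree (Nd l a r) b l' r'
| SubR l a r b l' r' : subtree r b l' r' -> subtree (Nd l a r) b l' r'.

(** The leaves are recorded, so the preorder code is prefix-free; this allows codes to be padded to
    a common length in [btuple]. *)
Lemma bcode_inj A (t t' : btree A) s s' :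
  bcode t ++ s = bcode t' ++ s' -> t = t' /\ s = s'.
Proof.
elim: t t' s s' => [|l IHl a r IHr] [|l' a' r'] s s' //=; first by case.
by case=> <-; rewrite -!catA => /IHl [<-] /IHr [<-] ->.
Qed.

Lemma size_bcode A (t : btree A) : size (bcode t) = (2 * size (inorder t)).+1.
Proof.
by elim: t => //= l IHl a r IHr; rewrite !size_cat /= IHl IHr; lia.
Qed.

Lemma inorder_bmap A B (f : A -> B) t : inorder (bmap f t) = map f (inorder t).
Proof. by elim: t => //= l -> a r ->; rewrite map_cat. Qed.

Lemma broot_bmap A B (f : A -> B) t : broot (bmap f t) = omap f (broot t).
Proof. by case: t. Qed.

Lemma mem_subtree (A : eqType) (t : btree A) a :
  a \in inorder t -> exists l r, subtree t a l r.
Proof.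
elim: t => //= l IHl b r IHr; rewrite mem_cat inE => /or3P[/IHl|/eqP->|/IHr].
- by move=> [l' [r' h]]; exists l', r'; apply: SubL.
- by exists l, r; apply: SubHere.
- by move=> [l' [r' h]]; exists l', r'; apply: SubR.
Qed.

Lemma subtree_bmap A B (f : A -> B) t a l r :
  subtree t a l r -> subtree (bmap f t) (f a) (bmap f l) (bmap f r).
Proof. by elim=> *; [apply: SubHere|apply: SubL|apply: SubR]. Qed.

Lemma bmap_size_inorder A B C (f : A -> C) (g : B -> C) t t' :
  bmap f t = bmap g t' -> size (inorder t) = size (inorder t').
Proof. by move=> /(congr1 (@inorder C))/(congr1 size); rewrite !inorder_bmap !size_map. Qed.

Lemma bmap_eq_in (A : eqType) B (f g : A -> B) t :
  {in inorder t, f =1 g} -> bmap f t = bmap g t.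
Proof.
elim: t => //= l IHl a r IHr fg.
rewrite IHl ?IHr ?fg ?mem_cat ?inE ?eqxx ?orbT // => x hx; apply: fg;
  by rewrite mem_cat inE hx ?orbT.
Qed.

(** Equal relabellings force equal shapes, so matching the nodes by their position in the in-order
    sequences carries one tree to the other. *)
Lemma bmap_nth_index (A B : eqType) C (f : A -> C) (g : B -> C) (d : B) t t' :
  uniq (inorder t) -> bmap f t = bmap g t' ->
  bmap (fun a => nth d (inorder t') (index a (inorder t))) t = t'.
Proof.
elim: t t' => [|l IHl a r IHr] [|l' a' r'] //=.
rewrite cat_uniq => /and3P[ul /hasPn nl /= /andP[anr ur]] [el _ er].
have sl := bmap_size_inorder el.
congr Nd.
- rewrite -[RHS](IHl l') //; apply: bmap_eq_in => x xl.
  by rewrite index_cat xl nth_cat -sl index_mem xl.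
- rewrite index_cat (negbTE (nl _ (mem_head _ _))) /= eqxx addn0 nth_cat.
  by rewrite sl ltnn subnn.
- rewrite -[RHS](IHr r') //; apply: bmap_eq_in => x xr.
  rewrite index_cat (negbTE (nl x _)) ?inE ?xr ?orbT //= nth_cat -sl.
  case: eqP => [ax|_]; first by rewrite ax xr in anr.
  by rewrite ltnNge leq_addr /= addKn.
Qed.

(** * Unfolding a rooted binary structure *)

Section Unfold.
Variables (T : eqType) (lc rc : T -> option T) (mu : T -> nat).
Hypothesis lc_mu : forall i j, lc i = Some j -> mu j < mu i.
Hypothesis rc_mu : forall i j, rc i = Some j -> mu j < mu i.

Definition child i j : Prop := lc i = Some j \/ rc i = Some j.

Lemma child_mu i j : child i j -> mu j < mu i.
Proof. by case=> [/lc_mu|/rc_mu]. Qed.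

(** [f] is fuel: since [mu] drops at each step, any [f] above [mu] of the root unfolds the whole
    tree. *)
Fixpoint unfold (f : nat) (o : option T) : btree T :=
  match f, o with
  | f'.+1, Some i => Nd (unfold f' (lc i)) i (unfold f' (rc i))
  | _, _ => Lf
  end.

Inductive desc (r : T) : T -> Prop :=
| DescRefl : desc r r
| DescStep i j : desc r i -> child i j -> desc r j.

Lemma desc_trans i j k : desc i j -> desc j k -> desc i k.
Proof. by move=> ij; elim=> // a b _ ia ab; apply: DescStep ab. Qed.

Lemma desc_mu i j : desc i j -> mu j <= mu i.
Proof. by elim=> // a b _ le /child_mu; lia. Qed.

Lemma broot_unfold f o : (forall i, o = Some i -> mu i < f) -> broot (unfold f o) = o.
Proof.
case: f => [|f]; case: o => [i|] //= h.
by have := h i erefl.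
Qed.

Lemma unfold_desc f i j : j \in inorder (unfold f (Some i)) -> desc i j.
Proof.
elim: f i => //= f IHf i; rewrite mem_cat inE => /or3P[|/eqP->|]; last 2 first.
- exact: DescRefl.
- case e: (rc i) => [k|]; last by case: (f).
  by move=> /IHf; apply: desc_trans; apply: DescStep (DescRefl _) _; right.
- case e: (lc i) => [k|]; last by case: (f).
  by move=> /IHf; apply: desc_trans; apply: DescStep (DescRefl _) _; left.
Qed.

Lemma desc_unfold i j : desc i j -> forall f, mu i < f -> j \in inorder (unfold f (Some i)).
Proof.
suff h f : forall i j, mu i < f -> desc i j -> j \in inorder (unfold f (Some i)).
  by move=> ij f fi; apply: h.
have desc_inv a b : desc a b -> a = b \/ exists2 c, child a c & desc c b.
  elim=> [|c d _ IH cd]; first by left.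
  right; case: IH => [ec|[e ae ec]].
    by exists d; [rewrite ec|apply: DescRefl].
  by exists e => //; apply: DescStep cd.
elim: f => // f IHf {}i {}j lt_if /desc_inv [<-|[c ic cj]] /=.
  by rewrite mem_cat mem_head orbT.
have lt_cf : mu c < f by have := child_mu ic; lia.
by rewrite mem_cat inE; case: ic => ->; rewrite IHf ?orbT.
Qed.

Lemma subtree_unfold f o a l r :
  (forall i, o = Some i -> mu i < f) -> subtree (unfold f o) a l r ->
  broot l = lc a /\ broot r = rc a.
Proof.
elim: f o => [|f IHf] [i|] /= hf st; try by inversion st.
have fi := hf i erefl.
have hl j : lc i = Some j -> mu j < f by move=> /lc_mu; lia.
have hr j : rc i = Some j -> mu j < f by move=> /rc_mu; lia.
inversion st; subst.
- by rewrite !broot_unfold.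
- by apply: (IHf (lc i)).
- by apply: (IHf (rc i)).
Qed.

Section Uniq.
Hypothesis par_uniq : forall i i' j, child i j -> child i' j -> i = i'.
Hypothesis lc_rc : forall i j, lc i = Some j -> rc i <> Some j.

(** Parents are unique, so the ancestors of [j] form a chain. *)
Lemma desc_comparable a b j : desc a j -> desc b j -> desc a b \/ desc b a.
Proof.
elim=> [|i k ai IH ik]; first by right.
move=> bk; inversion bk as [e|i' k' bi' ik' e]; subst.
  by left; apply: DescStep ik.
by apply: IH; rewrite (par_uniq ik ik').
Qed.

Lemma siblings_desc i a b j :
  lc i = Some a -> rc i = Some b -> desc a j -> desc b j -> False.
Proof.
move=> ia ib aj bj.
have hs c d : child i c -> child i d -> c <> d -> ~ desc c d.
  move=> ic id cd h; inversion h as [e|i' k' ci' i'd e]; subst => //.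
  by have := desc_mu ci'; rewrite -(par_uniq id i'd); have := child_mu ic; lia.
have ab : a <> b by move=> e; apply: (lc_rc ia); rewrite e.
case: (desc_comparable aj bj); apply: hs => //; [by left|by right|by right|by left|].
by move=> e; apply: ab.
Qed.

Lemma uniq_unfold f o : uniq (inorder (unfold f o)).
Proof.
elim: f o => [|f IHf] [i|] //=.
have ni c : child i c -> i \notin inorder (unfold f (Some c)).
  by move=> ic; apply/negP => /unfold_desc/desc_mu; have := child_mu ic; lia.
rewrite cat_uniq; apply/and3P; split; first exact: IHf.
- apply/hasPn => x /=; rewrite inE => /orP[/eqP->|].
    by case e: (lc i) => [c|]; [apply: ni; left|case: (f)].
  case er: (rc i) => [c|]; last by case: (f).
  move=> /unfold_desc cx; apply/negP.
  case el: (lc i) => [d|]; last by case: (f).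
  by move=> /unfold_desc dx; apply: (siblings_desc el er dx cx).
- by rewrite /= IHf andbT; case e: (rc i) => [c|]; [apply: ni; right|case: (f)].
Qed.

End Uniq.

Inductive lmost : T -> T -> Prop :=
| LmostHere i : lc i = None -> lmost i i
| LmostStep i j k : lc i = Some j -> lmost j k -> lmost i k.

Inductive rmost : T -> T -> Prop :=
| RmostHere i : rc i = None -> rmost i i
| RmostStep i j k : rc i = Some j -> rmost j k -> rmost i k.

Lemma unfold_head f i : mu i < f ->
  exists a s, inorder (unfold f (Some i)) = a :: s /\ lmost i a.
Proof.
elim: f i => // f IHf i fi /=; case e: (lc i) => [j|].
  have [|a [s [-> ja]]] := IHf j; first by have := lc_mu e; lia.
  by eexists a, _; split; [reflexivity|apply: LmostStep ja].
have -> : unfold f None = Lf by case: (f).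
by eexists i, _; split; [reflexivity|apply: LmostHere].
Qed.

Lemma unfold_last f i : mu i < f ->
  exists s a, inorder (unfold f (Some i)) = rcons s a /\ rmost i a.
Proof.
elim: f i => // f IHf i fi /=; case e: (rc i) => [j|].
  have [|s [a [-> ja]]] := IHf j; first by have := rc_mu e; lia.
  eexists (_ ++ i :: s), a; split; last by apply: RmostStep ja.
  by rewrite rcons_cat.
have -> : unfold f None = Lf by case: (f).
eexists (_), i; split; last by apply: RmostHere.
by rewrite /= cats1.
Qed.

(** Of two in-order neighbours one is an ancestor of the other: either the later one is the leftmost
    node below the right child of the earlier one, or the earlier one is the rightmost node below
    the left child of the later one. *)
Lemma sorted_unfold (R : rel T) f o :
  (forall i, o = Some i -> mu i < f) ->
  (forall i a j, rc i = Some a -> lmost a j -> R i j) ->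
  (forall i a j, lc j = Some a -> rmost a i -> R i j) ->
  sorted R (inorder (unfold f o)).
Proof.
move=> hf hr hl; elim: f o hf => [|f IHf] [i|] //= hf.
have fi := hf i erefl.
have right_path : path R i (inorder (unfold f (rc i))).
  case e: (rc i) => [b|]; last by case: (f).
  have bf : mu b < f by have := rc_mu e; lia.
  have := IHf (Some b); have [a [s [-> ba]]] := unfold_head bf.
  by rewrite /= (hr i b) //; apply=> ? [<-].
case e: (lc i) => [b|]; last by case: (f) right_path.
have bf : mu b < f by have := lc_mu e; lia.
have := IHf (Some b); have [s [a [-> ba]]] := unfold_last bf.
move=> /(_ _)/= h; have {h} : sorted R (rcons s a) by apply: h => ? [<-].
case: s => [|c s] /=; first by rewrite (hl a b).
rewrite rcons_path => /andP[pcs sa].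
by rewrite cat_path rcons_path pcs sa last_rcons /= (hl a b).
Qed.

End Unfold.

(** Each element determines the next one, so the head and the length fix the sequence. *)
Lemma sorted_functional_eq (T : eqType) (R : rel T) (P : pred T) s s' :
  (forall i j j', P j -> P j' -> R i j -> R i j' -> j = j') ->
  all P s -> all P s' -> size s = size s' -> ohead s = ohead s' ->
  sorted R s -> sorted R s' -> s = s'.
Proof.
move=> fR; case: s s' => [|a s] [|b s'] //= /andP[_ Ps] /andP[_ Ps'] [sz] [<-].
elim: s s' a Ps Ps' sz => [|c s IH] [|d s'] //= a /andP[Pc Ps] /andP[Pd Ps'] [sz].
move=> /andP[ac ps] /andP[ad ps'].
have e : d = c by apply: (fR a).
by rewrite e in ps' *; congr (_ :: _); apply: IH.
Qed.

(** * Rectangular partitions of a grid *)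

(* The rectangles [xl i, xh i] x [yl i, yh i], [L i], partition [0, W] x [0, H];
   a unit cell is named by its lower left corner. The last condition says that
   no four rectangles share a vertex. *)
Record isplan (T : finType) (L : pred T) (xl xh yl yh : T -> nat) (W H : nat) : Prop :=
  IsPlan {
  plan_x : forall i, L i -> xl i < xh i <= W;
  plan_y : forall i, L i -> yl i < yh i <= H;
  plan_cov : forall a b, a < W -> b < H ->
    exists i, [/\ L i, xl i <= a < xh i & yl i <= b < yh i];
  plan_uni : forall a b i j, L i -> L j -> xl i <= a < xh i -> yl i <= b < yh i ->
    xl j <= a < xh j -> yl j <= b < yh j -> i = j;
  plan_T : forall i k, L i -> L k -> xl i = xh k -> yl i = yh k -> False }.

Lemma isplan_tr (T : finType) (L : pred T) xl xh yl yh W H :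
  isplan L xl xh yl yh W H -> isplan L yl yh xl xh H W.
Proof.
case=> hx hy cov uni nt; split=> //.
- by move=> a b aH bW; have [i [? ? ?]] := cov _ _ bW aH; exists i.
- by move=> a b i j Li Lj *; apply: (uni b a).
- by move=> i k Li Lk *; apply: (nt i k).
Qed.

Section Plan.
Variables (T : finType) (L : pred T) (xl xh yl yh : T -> nat) (W H : nat).
Hypothesis P : isplan L xl xh yl yh W H.

Let hx := plan_x P.
Let hy := plan_y P.

Lemma plan_disj i j : L i -> L j -> i <> j ->
  xh i <= xl j \/ xh j <= xl i \/ yh i <= yl j \/ yh j <= yl i.
Proof.
move=> Li Lj nij.
have := plan_uni P (a := maxn (xl i) (xl j)) (b := maxn (yl i) (yl j)) Li Lj.
have := hx Li; have := hx Lj; have := hy Li; have := hy Lj.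
case: (leqP (xh i) (xl j)) => [?|?]; first by left.
case: (leqP (xh j) (xl i)) => [?|?]; first by right; left.
case: (leqP (yh i) (yl j)) => [?|?]; first by do 2 right; left.
case: (leqP (yh j) (yl i)) => [?|?]; first by do 3 right.
by move=> ? ? ? ? h; case: nij; apply: h; lia.
Qed.

(** The rectangles in the other two quadrants are forced to have a corner at this point too, so this
    is the crossing of [plan_T] seen along the other diagonal. *)
Lemma plan_T' i k : L i -> L k -> xl i = xh k -> yh i = yl k -> False.
Proof.
move=> Li Lk ex ey; have := hx Li; have := hx Lk; have := hy Li; have := hy Lk.
move=> ? ? ? ?.
have [||b [Lb b1 b2]] := plan_cov P (a := xl i) (b := yl k); try lia.
have [||c [Lc c1 c2]] := plan_cov P (a := (xl i).-1) (b := (yl k).-1); try lia.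
have /(plan_disj Lb Li) : b <> i by move=> e; subst; lia.
have /(plan_disj Lb Lk) : b <> k by move=> e; subst; lia.
have /(plan_disj Lc Li) : c <> i by move=> e; subst; lia.
have /(plan_disj Lc Lk) : c <> k by move=> e; subst; lia.
by move=> d1 d2 d3 d4; apply: (plan_T P Lb Lc); lia.
Qed.

(** Vertices are T-junctions. If the rectangle above the corner does not start at [xl j], it
    overhangs to the left, and the rectangle on the left ends under it at the same height as [j].
    The rectangle found here is the parent of [j]. *)
Lemma corner_TL j : L j -> ~ (xl j = 0 /\ yh j = H) ->
  (exists i, [/\ L i, xl j = xl i & yh j = yl i]) \/
  (exists i, [/\ L i, xl j = xh i & yh j = yh i]).
Proof.
move=> Lj nc; have := hx Lj; have := hy Lj => ? ?.
case: (leqP H (yh j)) => yH.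
  have [||i [Li i1 i2]] := plan_cov P (a := (xl j).-1) (b := (yh j).-1); try lia.
  have /(plan_disj Lj Li) : j <> i by move=> e; subst; lia.
  by have := hy Li; right; exists i; split=> //; lia.
have [||b [Lb b1 b2]] := plan_cov P (a := xl j) (b := yh j); try lia.
have /(plan_disj Lj Lb) db : j <> b by move=> e; subst; lia.
case: (leqP (xl j) (xl b)) => xb; first by left; exists b; split=> //; lia.
have [||c [Lc c1 c2]] := plan_cov P (a := (xl j).-1) (b := (yh j).-1); try lia.
have /(plan_disj Lj Lc) dc : j <> c by move=> e; subst; lia.
have /(plan_disj Lb Lc) dbc : b <> c by move=> e; subst; lia.
by right; exists c; split=> //; lia.
Qed.

Lemma corner_BL j : L j -> ~ (xl j = 0 /\ yl j = 0) ->
  (exists k, [/\ L k, xl k = xl j & yh k = yl j]) \/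
  (exists k, [/\ L k, xh k = xl j & yl k = yl j]).
Proof.
move=> Lj nc; have := hx Lj; have := hy Lj => ? ?.
case: (posnP (yl j)) => y0.
  have [||i [Li i1 i2]] := plan_cov P (a := (xl j).-1) (b := yl j); try lia.
  have /(plan_disj Lj Li) : j <> i by move=> e; subst; lia.
  by right; exists i; split=> //; lia.
have [||b [Lb b1 b2]] := plan_cov P (a := xl j) (b := (yl j).-1); try lia.
have /(plan_disj Lj Lb) db : j <> b by move=> e; subst; lia.
case: (leqP (xl j) (xl b)) => xb; first by left; exists b; split=> //; lia.
have [||c [Lc c1 c2]] := plan_cov P (a := (xl j).-1) (b := yl j); try lia.
have /(plan_disj Lj Lc) dc : j <> c by move=> e; subst; lia.
have /(plan_disj Lb Lc) dbc : b <> c by move=> e; subst; lia.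
by right; exists c; split=> //; lia.
Qed.

Lemma corner_TR j : L j -> ~ (xh j = W /\ yh j = H) ->
  (exists k, [/\ L k, xl k = xh j & yh k = yh j]) \/
  (exists k, [/\ L k, xh k = xh j & yl k = yh j]).
Proof.
move=> Lj nc; have := hx Lj; have := hy Lj => ? ?.
case: (leqP H (yh j)) => yH.
  have [||i [Li i1 i2]] := plan_cov P (a := xh j) (b := (yh j).-1); try lia.
  have /(plan_disj Lj Li) : j <> i by move=> e; subst; lia.
  by have := hy Li; left; exists i; split=> //; lia.
have [||b [Lb b1 b2]] := plan_cov P (a := (xh j).-1) (b := yh j); try lia.
have /(plan_disj Lj Lb) db : j <> b by move=> e; subst; lia.
case: (leqP (xh b) (xh j)) => xb; first by right; exists b; split=> //; lia.
have := hx Lb => ?.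
have [||c [Lc c1 c2]] := plan_cov P (a := xh j) (b := (yh j).-1); try lia.
have /(plan_disj Lj Lc) dc : j <> c by move=> e; subst; lia.
have /(plan_disj Lb Lc) dbc : b <> c by move=> e; subst; lia.
by left; exists c; split=> //; lia.
Qed.

(** A child has its upper left corner at the lower left ([lch]) or upper right ([rch]) corner of its
    parent. With the coordinates exchanged, the same definitions give the second tree, where the
    child has its lower right corner at one of these two corners. *)
Definition lch i : option T := [pick j | [&& L j, xl j == xl i & yh j == yl i]].
Definition rch i : option T := [pick j | [&& L j, xl j == xh i & yh j == yh i]].

Lemma lchP i j : lch i = Some j -> [/\ L j, xl j = xl i & yh j = yl i].
Proof. by rewrite /lch; case: pickP => // k /and3P[? /eqP ? /eqP ?] [<-]. Qed.

Lemma rchP i j : rch i = Some j -> [/\ L j, xl j = xh i & yh j = yh i].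
Proof. by rewrite /rch; case: pickP => // k /and3P[? /eqP ? /eqP ?] [<-]. Qed.

Lemma eq_TL j k : L j -> L k -> xl j = xl k -> yh j = yh k -> j = k.
Proof.
move=> Lj Lk ex ey; apply/eqP/negP => /negP/eqP/(plan_disj Lj Lk).
by have := hx Lj; have := hx Lk; have := hy Lj; have := hy Lk; lia.
Qed.

Lemma eq_BL j k : L j -> L k -> xl j = xl k -> yl j = yl k -> j = k.
Proof.
move=> Lj Lk ex ey; apply/eqP/negP => /negP/eqP/(plan_disj Lj Lk).
by have := hx Lj; have := hx Lk; have := hy Lj; have := hy Lk; lia.
Qed.

Lemma eq_TR j k : L j -> L k -> xh j = xh k -> yh j = yh k -> j = k.
Proof.
move=> Lj Lk ex ey; apply/eqP/negP => /negP/eqP/(plan_disj Lj Lk).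
by have := hx Lj; have := hx Lk; have := hy Lj; have := hy Lk; lia.
Qed.

Lemma lchE i j : L j -> xl j = xl i -> yh j = yl i -> lch i = Some j.
Proof.
move=> Lj ex ey; rewrite /lch; case: pickP => [k /and3P[Lk /eqP ? /eqP ?]|/(_ j)].
  by congr Some; apply: eq_TL => //; lia.
by rewrite Lj ex ey !eqxx.
Qed.

Lemma rchE i j : L j -> xl j = xh i -> yh j = yh i -> rch i = Some j.
Proof.
move=> Lj ex ey; rewrite /rch; case: pickP => [k /and3P[Lk /eqP ? /eqP ?]|/(_ j)].
  by congr Some; apply: eq_TL => //; lia.
by rewrite Lj ex ey !eqxx.
Qed.

(* The test [L i] keeps the unfolding of the tree inside [L]. *)
Definition lc i := if L i then lch i else None.
Definition rc i := if L i then rch i else None.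

Lemma lcP i j : lc i = Some j -> [/\ L i, L j, xl j = xl i & yh j = yl i].
Proof. by rewrite /lc; case: ifP => // Li /lchP[]. Qed.

Lemma rcP i j : rc i = Some j -> [/\ L i, L j, xl j = xh i & yh j = yh i].
Proof. by rewrite /rc; case: ifP => // Li /rchP[]. Qed.

Lemma lcE i j : L i -> L j -> xl j = xl i -> yh j = yl i -> lc i = Some j.
Proof. by move=> Li; rewrite /lc Li; apply: lchE. Qed.

Lemma rcE i j : L i -> L j -> xl j = xh i -> yh j = yh i -> rc i = Some j.
Proof. by move=> Li; rewrite /rc Li; apply: rchE. Qed.

(** The distance along the axes from the upper left corner of [i] to the lower right corner of the
    host; children lie below or to the right. *)
Definition mu i := W - xl i + yh i.

Lemma lc_mu i j : lc i = Some j -> mu j < mu i.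
Proof. by move=> /lcP[/hy ? ? ? ?]; rewrite /mu; lia. Qed.

Lemma rc_mu i j : rc i = Some j -> mu j < mu i.
Proof. by move=> /rcP[/hx ? /hx ? ? ?]; rewrite /mu; lia. Qed.

(** Parents of different kinds would meet diagonally at the corner of [j], lower left corner to
    upper right corner, which is a crossing. *)
Lemma plan_par_uniq i i' j : child lc rc i j -> child lc rc i' j -> i = i'.
Proof.
case=> [/lcP|/rcP] [Li Lj ? ?] [/lcP|/rcP] [Li' _ ? ?].
- by apply: eq_BL => //; lia.
- by case: (plan_T P Li Li'); lia.
- by case: (plan_T P Li' Li); lia.
- by apply: eq_TR => //; lia.
Qed.

Lemma plan_lc_rc i j : lc i = Some j -> rc i <> Some j.
Proof. by move=> /lcP[/hx ? ? ? ?] /rcP[]; lia. Qed.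

Variable rt : T.
Hypotheses (rt_x : xl rt = 0) (rt_y : yh rt = H).

Definition ptree := unfold lc rc (W + H).+1 (Some rt).
Definition porder := inorder ptree.

Lemma ptree_fuel i : Some rt = Some i -> mu i < (W + H).+1.
Proof. by move=> [<-]; rewrite /mu rt_x rt_y; lia. Qed.

Lemma porder_uniq : uniq porder.
Proof. exact: uniq_unfold lc_mu rc_mu plan_par_uniq plan_lc_rc _ _. Qed.

Lemma mem_porder i : L rt -> (i \in porder) = L i.
Proof.
move=> Lrt; apply/idP/idP => [/unfold_desc|Li].
  by elim=> // ? ? _ _ [/lcP|/rcP] [].
apply: (desc_unfold lc_mu rc_mu) => //; last exact: ptree_fuel.
(* Climb from [i] to its parent: [mu] increases and is at most [W + H], so the climb ends at the
   root. *)
move: {2}(W + H - mu i) (leqnn (W + H - mu i)) => n; elim: n i Li => [|n IH] i Li hn.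
  have -> : i = rt; last exact: DescRefl.
  by move: (hx Li) (hy Li) hn; rewrite /mu => ? ? ?; apply: eq_TL => //; lia.
case: (boolP ((xl i == 0) && (yh i == H))) => [/andP[/eqP ? /eqP ?]|/andP ni].
  have -> : i = rt by apply: eq_TL => //; lia.
  exact: DescRefl.
have muWH j : L j -> mu j <= W + H.
  by move=> Lj; have := hx Lj; have := hy Lj; rewrite /mu; lia.
case: (corner_TL Li) => [|[j [Lj ? ?]]|[j [Lj ? ?]]].
- by case=> /eqP ? /eqP ?; apply: ni.
- have ji : lc j = Some i by apply: lcE.
  apply: DescStep (IH j Lj _) (or_introl ji).
  by have := lc_mu ji; have := muWH j Lj; lia.
- have ji : rc j = Some i by apply: rcE.
  apply: DescStep (IH j Lj _) (or_intror ji).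
  by have := rc_mu ji; have := muWH j Lj; lia.
Qed.

End Plan.

(* A maximal vertical segment has [i] at the top of its left side and [j] at the
   bottom of its right side. *)
Definition segV (T : finType) (L : pred T) (xl xh yl yh : T -> nat) : rel T := fun i j =>
  [&& L i, L j, xh i == xl j, yl j < yh i,
      [exists k, [&& L k, xl k == xh i & yh k == yh i]],
      [exists k, [&& L k, xh k == xl j & yl k == yl j]] &
      [forall k, (L k && (xl k < xh i < xh k)) ==> (yh k <= yl j) || (yh i <= yl k)]].

(** * The common in-order sequence of the two trees *)

Section Successor.
Variables (T : finType) (L : pred T) (xl xh yl yh : T -> nat) (W H : nat).
Hypothesis P : isplan L xl xh yl yh W H.

Let hx := plan_x P.
Let hy := plan_y P.
Local Notation lc := (lc L xl yl yh).
Local Notation rc := (rc L xl xh yh).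
Local Notation SV := (segV L xl xh yl yh).
Local Notation SH := (segV L yl yh xl xh).

(** The leftmost chain from the right child runs down the right side of the maximal vertical segment
    whose top is the upper right corner of [i], and ends with the block at its bottom. *)
Lemma lmost_segV i a j : rc i = Some a -> lmost lc a j -> SV i j.
Proof.
move=> /rcP[Li La ax ay] aj.
suff [Lj jx jy jn jk] : [/\ L j, xl j = xl a, yl j < yh a, lc j = None &
    forall k, L k -> xl k < xl a < xh k -> yh k <= yl j \/ yh a <= yl k].
  apply/and5P; split=> //; [by lia|by lia|apply/and3P; split].
  - by apply/existsP; exists a; rewrite La ax ay !eqxx.
  - case: (corner_BL P Lj) => [|[k [Lk ? ?]]|[k [Lk ? ?]]].
    + by have := hx Li; lia.
    + by suff: lc j = Some k; [rewrite jn|apply: (lcE P); lia].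
    + by apply/existsP; exists k; rewrite Lk; lia.
  - apply/forallP => k; apply/implyP => /andP[Lk kx].
    by have := jk k Lk; lia.
elim: aj La {Li ax ay} => {a j} [a an|a b j ab bj IH] La.
  split=> //; first by have := hy La; lia.
  move=> k Lk kx; have /(plan_disj P La Lk) : a <> k by move=> e; subst; lia.
  by have := hx La; have := hx Lk; have := hy La; have := hy Lk; lia.
have [_ Lb bx by_] := lcP ab; have [Lj jx jy jn jk] := IH Lb.
have := hy La => ?.
split=> //; [by lia|by lia|move=> k Lk kx].
have /(plan_disj P La Lk) : a <> k by move=> e; subst; lia.
by have := jk k Lk; have := hx La; have := hx Lk; have := hy La; have := hy Lk; lia.
Qed.

(** The rightmost chain from the left child runs along the lower side of the maximal horizontal
    segment whose left end is the lower left corner of [j]. *)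
Lemma rmost_segH i a j : lc j = Some a -> rmost rc a i -> SH i j.
Proof.
move=> /lcP[Lj La ax ay] ai.
suff [Li ix iy iN ik] : [/\ L i, yh i = yh a, xl a < xh i, rc i = None &
    forall k, L k -> yl k < yh a < yh k -> xh k <= xl a \/ xh i <= xl k].
  apply/and5P; split=> //; [by lia|by lia|apply/and3P; split].
  - case: (corner_TR P Li) => [|[k [Lk ? ?]]|[k [Lk ? ?]]].
    + by have := hy Lj; lia.
    + by suff: rc i = Some k; [rewrite iN|apply: (rcE P); lia].
    + by apply/existsP; exists k; rewrite Lk; lia.
  - by apply/existsP; exists a; rewrite La ax ay !eqxx.
  - apply/forallP => k; apply/implyP => /andP[Lk kx].
    by have := ik k Lk; lia.
elim: ai La {Lj ax ay} => {a i} [a an|a b i ab bi IH] La.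
  split=> //; first by have := hx La; lia.
  move=> k Lk kx; have /(plan_disj P La Lk) : a <> k by move=> e; subst; lia.
  by have := hx La; have := hx Lk; have := hy La; have := hy Lk; lia.
have [_ Lb bx by_] := rcP ab; have [Li ix iy iN ik] := IH Lb.
have := hx La => ?.
split=> //; [by lia|by lia|move=> k Lk kx].
have /(plan_disj P La Lk) : a <> k by move=> e; subst; lia.
by have := ik k Lk; have := hx La; have := hx Lk; have := hy La; have := hy Lk; lia.
Qed.

(** If two bottoms were possible, take the higher one, at the block [a] of [key]. The rectangle
    below [a] either starts on the segment and forms a crossing with the block [c] on the left, or
    reaches across the segment above the lower bottom. *)
Lemma segV_functional i j j' : SV i j -> SV i j' -> j = j'.
Proof.
move=> /and5P[Li Lj /eqP ex ey /and3P[_ /existsP[k /and3P[Lk /eqP kx /eqP ky]] /forallP h]].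
move=> /and5P[_ Lj' /eqP ex' ey' /and3P[_ /existsP[k' /and3P[Lk' /eqP kx' /eqP ky']] /forallP h']].
have hx1 := hx Li; have hx2 := hx Lj; have hx3 := hx Lj'.
have hy1 := hy Li; have hy2 := hy Lj; have hy3 := hy Lj'.
have key a b c : L a -> L b -> L c -> xh i = xl a -> yl b < yl a -> yl a < yh i ->
   xh c = xl a -> yl c = yl a ->
   (forall k, (L k && (xl k < xh i < xh k)) ==> (yh k <= yl b) || (yh i <= yl k)) -> False.
  move=> La Lb Lc eia ltba ltai ca cy hb.
  have := hx La; have := hx Lc; have := hy La; have := hy Lc => ? ? ? ?.
  have [||d [Ld d1 d2]] := plan_cov P (a := xl a) (b := (yl a).-1); try lia.
  have /(plan_disj P Ld La) : d <> a by move=> e; subst; lia.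
  have /(plan_disj P Ld Lc) : d <> c by move=> e; subst; lia.
  have := hx Ld; have := hy Ld => ? ? ? ?.
  case: (eqVneq (xl d) (xl a)) => xd; first by apply: (plan_T' P Ld Lc); lia.
  by have /implyP := hb d; rewrite Ld /= => hd; have := hd ltac:(lia); lia.
apply: eq_BL P _ _ _ _ _ _ => //; first by lia.
case: (ltngtP (yl j) (yl j')) => // lt.
- by case: (key j' j k') => //; lia.
- by case: (key j j' k) => //; lia.
Qed.

(** The blocks on the right of and above the upper right corner of [i], both aligned with [i], would
    meet diagonally there. *)
Lemma segV_segH_excl i j j' : SV i j -> SH i j' -> False.
Proof.
move=> /and5P[Li Lj _ _ /and3P[/existsP[k /and3P[Lk /eqP kx /eqP ky]] _ _]].
move=> /and5P[_ Lj' _ _ /and3P[/existsP[k' /and3P[Lk' /eqP kx' /eqP ky']] _ _]].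
by apply: (plan_T' P Lk Lk'); lia.
Qed.

End Successor.

(** The leftmost chain from the root runs down the left side of the host to its lower left corner.
    The chain of the second tree ends at the same block. *)
Lemma porder_head (T : finType) (L : pred T) xl xh yl yh W H r :
  isplan L xl xh yl yh W H -> L r -> xl r = 0 -> yh r = H ->
  exists2 i, ohead (porder L xl xh yl yh W H r) = Some i & [/\ L i, xl i = 0 & yl i = 0].
Proof.
move=> P Lr rx ry; have fuel := ptree_fuel W rx ry erefl.
have [i [s [es ri]]] := unfold_head (rc L xl xh yh) (lc_mu P) fuel.
exists i; first by rewrite /porder /ptree es.
elim: ri Lr rx {ry fuel es} => {i} [i iN|i j k /lcP[Li Lj ? ?] jk IH] Li' ix.
  split=> //; case: (posnP (yl i)) => // y0.
  case: (corner_BL P Li') => [|[k [Lk ? ?]]|[k [Lk ? ?]]]; first by lia.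
    by suff: lc L xl yl yh i = Some k; [rewrite iN|apply: (lcE P); lia].
  by have := plan_x P Lk; lia.
by apply: IH => //; lia.
Qed.

Lemma porder_sorted (T : finType) (L : pred T) xl xh yl yh W H r :
  isplan L xl xh yl yh W H -> L r -> xl r = 0 -> yh r = H ->
  sorted (fun i j => segV L xl xh yl yh i j || segV L yl yh xl xh i j)
    (porder L xl xh yl yh W H r).
Proof.
move=> P Lr rx ry; apply: (sorted_unfold (lc_mu P) (rc_mu P)).
- by move=> i; apply: ptree_fuel rx ry i.
- by move=> i a j /(lmost_segV P) h /h ->.
- by move=> i a j /(rmost_segH P) h /h ->; rewrite orbT.
Qed.

(* The two trees of a plan have the same in-order sequence, because consecutive
   elements are matched by the segments in both. *)
Lemma porder_tr (T : finType) (L : pred T) xl xh yl yh W H r1 r2 :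
  isplan L xl xh yl yh W H -> L r1 -> xl r1 = 0 -> yh r1 = H ->
  L r2 -> yl r2 = 0 -> xh r2 = W ->
  porder L yl yh xl xh H W r2 = porder L xl xh yl yh W H r1.
Proof.
move=> P Lr1 r1x r1y Lr2 r2y r2x; have Pt := isplan_tr P.
have s1 := porder_sorted P Lr1 r1x r1y; have s2 := porder_sorted Pt Lr2 r2y r2x.
have m1 := mem_porder P r1x r1y ^~ Lr1; have m2 := mem_porder Pt r2y r2x ^~ Lr2.
apply: sorted_functional_eq s2 _.
- move=> i j j' Lj Lj' /orP[h|h] /orP[h'|h'].
  + exact: segV_functional Pt _ _ _ h h'.
  + by case: (segV_segH_excl Pt h h').
  + by case: (segV_segH_excl P h h').
  + exact: segV_functional P _ _ _ h h'.
- by apply/allP => i; rewrite m2; exact.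
- by apply/allP => i; rewrite m1.
- by apply: perm_size; apply: uniq_perm => [||i]; rewrite ?m1 ?m2 //; apply: porder_uniq;
    [exact: Pt|exact: P].
- have [i -> [Li ix iy]] := porder_head P Lr1 r1x r1y.
  have [j -> [Lj jy jx]] := porder_head Pt Lr2 r2y r2x.
  by congr Some; apply: eq_BL P _ _ _ _ _ _ => //; lia.
- apply: sub_sorted s1 => i j; first by rewrite orbC.
Qed.

(** This does not assume [isplan], whose last condition will be derived from it: genericity excludes
    a point surrounded by exactly these four rectangles, [a] being the upper left and [b] the lower
    right one. *)
Lemma crossing_blocks (T : finType) (L : pred T) (xl xh yl yh : T -> nat) (W H : nat) i k :
  (forall i, xl i < xh i <= W) -> (forall i, yl i < yh i <= H) ->
  (forall a b, a < W -> b < H ->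
    exists i, [/\ L i, xl i <= a < xh i & yl i <= b < yh i]) ->
  (forall a b i j, L i -> L j -> xl i <= a < xh i -> yl i <= b < yh i ->
    xl j <= a < xh j -> yl j <= b < yh j -> i = j) ->
  L i -> L k -> xl i = xh k -> yl i = yh k ->
  exists a b, [/\ L a, L b, xh a = xl i /\ yl a = yl i, xl b = xl i /\ yh b = yl i &
    forall m, L m -> xl m <= xl i <= xh m -> yl m <= yl i <= yh m ->
      [\/ m = i, m = k, m = a | m = b]].
Proof.
move=> hx hy cov uni Li Lk ex ey.
have := hx i; have := hy i; have := hx k; have := hy k => ? ? ? ?.
have [||a [La aX aY]] := cov (xl i).-1 (yl i); try lia.
have [||b [Lb bX bY]] := cov (xl i) (yl i).-1; try lia.
have aX1 : xh a = xl i.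
  case: (leqP (xh a) (xl i)) => ?; first by lia.
  have e : i = a by apply: (uni (xl i) (yl i)) => //; lia.
  by rewrite -e in aX; lia.
have aY1 : yl a = yl i.
  case: (leqP (yl i) (yl a)) => ?; first by lia.
  have e : k = a by apply: (uni (xl i).-1 (yl i).-1) => //; lia.
  by rewrite -e in aY; lia.
have bX1 : xl b = xl i.
  case: (leqP (xl i) (xl b)) => ?; first by lia.
  have e : k = b by apply: (uni (xl i).-1 (yl i).-1) => //; lia.
  by rewrite -e in bX; lia.
have bY1 : yh b = yl i.
  case: (leqP (yh b) (yl i)) => ?; first by lia.
  have e : i = b by apply: (uni (xl i) (yl i)) => //; lia.
  by rewrite -e in bY; lia.
exists a, b; split=> // m Lm mX mY; have := hx m; have := hy m => ? ?.
case: (ltnP (xl i) (xh m)) => cX; case: (ltnP (yl i) (yh m)) => cY.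
- by constructor 1; apply: (uni (xl i) (yl i)) => //; lia.
- by constructor 4; apply: (uni (xl i) (yl i).-1) => //; lia.
- by constructor 3; apply: (uni (xl i).-1 (yl i)) => //; lia.
- by constructor 2; apply: (uni (xl i).-1 (yl i).-1) => //; lia.
Qed.

Lemma rst_sub A B (R : relation A) (R' : relation B) (f : A -> B) :
  (forall x y, R x y -> rst R' (f x) (f y)) -> forall x y, rst R x y -> rst R' (f x) (f y).
Proof.
move=> h x y; elim=> [a b|a|a b _|a b c _ ab _ bc].
- exact: h.
- exact: rst_refl.
- exact: rst_sym.
- exact: rst_trans bc.
Qed.

Lemma rst_iff A B (R : relation A) (R' : relation B) (f : A -> B) (g : B -> A) :
  cancel f g -> cancel g f -> (forall x y, R x y <-> R' (f x) (f y)) ->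
  forall x y, rst R x y <-> rst R' (f x) (f y).
Proof.
move=> fK gK h x y; split=> [|xy].
  by apply: rst_sub => a b /h; apply: rst_step.
rewrite -[x]fK -[y]fK; apply: rst_sub xy => a b ab.
by apply: rst_step; apply/h; rewrite !gK.
Qed.

(** * Plans with equal trees are isomorphic *)

Section PlanIso.
Variables (T T' : finType) (L : pred T) (L' : pred T').
Variables (xl xh yl yh : T -> nat) (xl' xh' yl' yh' : T' -> nat) (W H W' H' : nat).
Hypothesis P : isplan L xl xh yl yh W H.
Hypothesis P' : isplan L' xl' xh' yl' yh' W' H'.
Variables (r1 r2 : T) (r1' r2' : T').
Hypotheses (Lr1 : L r1) (r1x : xl r1 = 0) (r1y : yh r1 = H).
Hypotheses (Lr2 : L r2) (r2y : yl r2 = 0) (r2x : xh r2 = W).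
Hypotheses (Lr1' : L' r1') (r1x' : xl' r1' = 0) (r1y' : yh' r1' = H').
Hypotheses (Lr2' : L' r2') (r2y' : yl' r2' = 0) (r2x' : xh' r2' = W').
Variables (A : Type) (info : T -> A) (info' : T' -> A).

Let Pt := isplan_tr P.
Let Pt' := isplan_tr P'.
Let t1 := ptree L xl xh yl yh W H r1.
Let t2 := ptree L yl yh xl xh H W r2.
Let t1' := ptree L' xl' xh' yl' yh' W' H' r1'.
Let t2' := ptree L' yl' yh' xl' xh' H' W' r2'.
Let s := porder L xl xh yl yh W H r1.
Let s' := porder L' xl' xh' yl' yh' W' H' r1'.

Hypothesis eq1 : bmap info t1 = bmap info' t1'.
Hypothesis eq2 : bmap (fun _ => tt) t2 = bmap (fun _ => tt) t2'.

Definition plan_map (d : T') (i : T) := nth d s' (index i s).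

Let us : uniq s := porder_uniq P _.
Let us' : uniq s' := porder_uniq P' _.
Let ms i : (i \in s) = L i := mem_porder P r1x r1y i Lr1.
Let ms' i : (i \in s') = L' i := mem_porder P' r1x' r1y' i Lr1'.

Variable d : T'.
Let phi := plan_map d.

Let ssz : size s = size s'. Proof. exact: bmap_size_inorder eq1. Qed.

Lemma plan_map_seq : map phi s = s'.
Proof.
apply: (@eq_from_nth _ d) => [|k]; rewrite size_map // => ks.
rewrite (nth_map r1) // /phi /plan_map index_uniq //.
Qed.

Let bm1 : bmap phi t1 = t1'. Proof. exact: bmap_nth_index eq1. Qed.

(** The two trees have the same in-order sequence, so the positions in the first tree also match the
    nodes of the second one. This is why [eq2] compares shapes only. *)
Let bm2 : bmap phi t2 = t2'.
Proof.
have e : inorder t2 = s := porder_tr P Lr1 r1x r1y Lr2 r2y r2x.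
have e' : inorder t2' = s' := porder_tr P' Lr1' r1x' r1y' Lr2' r2y' r2x'.
by rewrite /phi /plan_map -e -e'; apply: bmap_nth_index eq2; rewrite e.
Qed.

Lemma plan_mapL i : L i -> L' (phi i).
Proof. by rewrite -ms -ms' => si; apply: mem_nth; rewrite -ssz index_mem. Qed.

Lemma plan_map_inj i j : L i -> L j -> phi i = phi j -> i = j.
Proof.
rewrite -!ms => si sj /eqP; rewrite nth_uniq // -?ssz ?index_mem // => /eqP e.
by rewrite -(nth_index i si) e nth_index.
Qed.

Lemma plan_map_info i : L i -> info' (phi i) = info i.
Proof.
rewrite -ms => si.
have := congr1 (@inorder _) eq1; rewrite !inorder_bmap -/s -/s' => e.
rewrite -/s /phi /plan_map.
have ks : index i s < size s by rewrite index_mem.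
rewrite -(nth_map d (info i)) -?ssz // -[in LHS]/(inorder t1') -e (nth_map i) //.
by rewrite nth_index.
Qed.

Let kids t t' (lc rc : T -> option T) (lc' rc' : T' -> option T') mu mu' f f' r r' :
  t = unfold lc rc f (Some r) -> t' = unfold lc' rc' f' (Some r') ->
  (forall i j, lc i = Some j -> mu j < mu i) -> (forall i j, rc i = Some j -> mu j < mu i) ->
  (forall i j, lc' i = Some j -> mu' j < mu' i) ->
  (forall i j, rc' i = Some j -> mu' j < mu' i) ->
  (forall i, Some r = Some i -> mu i < f) -> (forall i, Some r' = Some i -> mu' i < f') ->
  bmap phi t = t' -> forall i, i \in inorder t ->
  lc' (phi i) = omap phi (lc i) /\ rc' (phi i) = omap phi (rc i).
Proof.
move=> et et' lmu rmu lmu' rmu' hf hf' bm i /mem_subtree [l [r0 st]].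
have := subtree_bmap phi st; rewrite bm et' => /(subtree_unfold lmu' rmu' hf') [<- <-].
move: st; rewrite et => /(subtree_unfold lmu rmu hf) [<- <-].
by rewrite !broot_bmap.
Qed.

Lemma plan_map_child i : L i ->
  [/\ lc L' xl' yl' yh' (phi i) = omap phi (lc L xl yl yh i),
      rc L' xl' xh' yh' (phi i) = omap phi (rc L xl xh yh i),
      lc L' yl' xl' xh' (phi i) = omap phi (lc L yl xl xh i) &
      rc L' yl' yh' xh' (phi i) = omap phi (rc L yl yh xh i)].
Proof.
move=> Li; have s1 : i \in inorder t1 by rewrite -[inorder t1]/s ms.
have s2 : i \in inorder t2.
  by have -> : inorder t2 = s := porder_tr P Lr1 r1x r1y Lr2 r2y r2x; rewrite ms.
have [-> ->] := kids erefl erefl (lc_mu P) (rc_mu P) (lc_mu P') (rc_mu P')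
  (ptree_fuel W r1x r1y) (ptree_fuel W' r1x' r1y') bm1 s1.
by have [-> ->] := kids erefl erefl (lc_mu Pt) (rc_mu Pt) (lc_mu Pt') (rc_mu Pt')
  (ptree_fuel H r2y r2x) (ptree_fuel H' r2y' r2x') bm2 s2.
Qed.

End PlanIso.

(** * Dissection planes are generated by the corner links *)

(* Faces are pairs (block, side), where the side [true] is the one with the larger
   coordinate. *)
Definition attX (T : finType) (L : pred T) (xl xh yl yh : T -> nat) (f g : T * bool) : Prop :=
  [/\ L f.1, L g.1, (if f.2 then xh f.1 else xl f.1) = (if g.2 then xh g.1 else xl g.1),
      yl f.1 < yh g.1 & yl g.1 < yh f.1].

(** Each case joins two collinear faces at a corner where one block is a child of the other. Faces
    on the boundary of the host are attached to themselves only, hence the extra conditions in the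
    two cases that join faces on the same side. *)
Definition lnkX (T : finType) (L : pred T) (xl xh yl yh : T -> nat) (W : nat)
    (f g : T * bool) : Prop :=
  exists i j,
  [\/ [/\ lc L xl yl yh i = Some j, xl i <> 0, f = (j, false) & g = (i, false)],
      [/\ rc L xl xh yh i = Some j, f = (i, true) & g = (j, false)],
      [/\ lc L yl xl xh i = Some j, f = (j, true) & g = (i, false)] |
      [/\ rc L yl yh xh i = Some j, xh i <> W, f = (j, true) & g = (i, true)]].

Section Generated.
Variables (T : finType) (L : pred T) (xl xh yl yh : T -> nat) (W H : nat).
Hypothesis P : isplan L xl xh yl yh W H.

Let Pt := isplan_tr P.
Let hx := plan_x P.
Let hy := plan_y P.
Local Notation lnk := (lnkX L xl xh yl yh W).
Local Notation att := (attX L xl xh yl yh).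

(** Descend along the segment between the two blocks: the one whose lower end is higher is replaced
    by the block below it on its side, until the lower ends agree, which is a link of the second
    tree. *)
Lemma walk_lnk i j : L i -> L j -> xh i = xl j -> yl i < yh j -> yl j < yh i ->
  rst lnk (i, true) (j, false).
Proof.
move: {2}(yl i + yl j) (leqnn (yl i + yl j)) => m.
elim: m i j => [|m IH] i j le_m Li Lj ex o1 o2;
  have := hx Li; have := hx Lj; have := hy Li; have := hy Lj => ? ? ? ?.
  apply: rst_step; exists j, i; constructor 3; split=> //.
  by apply: (lcE Pt) => //; lia.
case: (ltngtP (yl i) (yl j)) => yij.
- case: (corner_BL P Lj) => [|[k [Lk ? ?]]|[k [Lk ? ?]]]; first by lia.
    have := hy Lk => ?.
    apply: (rst_trans _ _ _ (k, false)); first by apply: IH => //; lia.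
    apply: rst_step; exists j, k; constructor 1; split=> //; last by lia.
    by apply: (lcE P).
  have /(plan_disj P Li Lk) : i <> k by move=> e; subst; lia.
  by have := hx Lk; have := hy Lk; lia.
- case: (corner_TL Pt Li) => [|[k [Lk ? ?]]|[k [Lk ? ?]]]; first by lia.
    have /(plan_disj P Lj Lk) : j <> k by move=> e; subst; lia.
    by have := hx Lk; have := hy Lk; lia.
  have := hy Lk => ?.
  apply: (rst_trans _ _ _ (k, true)); last by apply: IH => //; lia.
  apply: rst_step; exists k, i; constructor 4; split=> //; last by lia.
  by apply: (rcE Pt).
- apply: rst_step; exists j, i; constructor 3; split=> //.
  by apply: (lcE Pt) => //; lia.
Qed.

Lemma att_lnk f g : att f g -> rst lnk f g.
Proof.
case: f g => [i b] [j b'] [/= Li Lj ex o1 o2].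
have := hx Li; have := hx Lj; have := hy Li; have := hy Lj => ? ? ? ?.
have same : b = b' -> i = j.
  move=> e; rewrite e in ex; apply/eqP/negP => /negP/eqP/(plan_disj P Li Lj).
  by case: (b') ex; lia.
case: b b' ex same => [] [] ex same; try by rewrite same //; apply: rst_refl.
  exact: walk_lnk.
by apply: rst_sym; apply: walk_lnk.
Qed.

(** As there is no crossing, a block on the other side of the segment spans the junction of two
    stacked faces, and both are attached to it. *)
Lemma lnk_att f g : lnk f g -> rst att f g.
Proof.
move=> [i [j [[/lcP[Li Lj ex ey] nx -> ->]|[/rcP[Li Lj ex ey] -> ->]
   |[/lcP[Li Lj ey ex] -> ->]|[/rcP[Li Lj ey ex] nx -> ->]]]];
  have := hx Li; have := hx Lj; have := hy Li; have := hy Lj => ? ? ? ?.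
- have [||k [Lk k1 k2]] := plan_cov P (a := (xl i).-1) (b := (yl i).-1); try lia.
  have /(plan_disj P Lj Lk) dj : j <> k by move=> e; subst; lia.
  have := hx Lk; have := hy Lk => ? ?.
  have nT := plan_T P Li Lk.
  case: (eqVneq (yh k) (yl i)) => ky; first by case: nT; lia.
  apply: (rst_trans _ _ _ (k, true)).
    by apply: rst_sym; apply: rst_step; split=> //=; lia.
  by apply: rst_step; split=> //=; lia.
- by apply: rst_step; split=> //=; lia.
- by apply: rst_step; split=> //=; lia.
- have [||k [Lk k1 k2]] := plan_cov P (a := xh i) (b := yh i); try lia.
  have /(plan_disj P Lj Lk) dj : j <> k by move=> e; subst; lia.
  have := hx Lk; have := hy Lk => ? ?.
  have nT := plan_T P Lk Li.
  case: (eqVneq (yl k) (yh i)) => ky; first by case: nT; lia.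
  apply: (rst_trans _ _ _ (k, false)).
    by apply: rst_step; split=> //=; lia.
  by apply: rst_sym; apply: rst_step; split=> //=; lia.
Qed.

End Generated.

(** * Counting the components of shared rectangles *)

Section Components.
Variables (T : finType) (L : pred T) (xl xh yl yh : T -> nat) (W H : nat).
Hypothesis P : isplan L xl xh yl yh W H.
Variable Fu : pred T.
Hypothesis FuL : forall i, Fu i -> L i.

Let hx := plan_x P.
Let hy := plan_y P.

Definition corner_link : rel T := fun i j =>
  [|| (xl j == xl i) && (yh j == yl i), (xl j == xh i) && (yh j == yh i),
      (xh j == xl i) && (yl j == yl i) | (xh j == xh i) && (yl j == yh i)].

Definition share_vertex : rel T := fun i j =>
  [&& Fu i, Fu j & corner_link i j || corner_link j i].

Lemma share_vertex_sym : connect_sym share_vertex.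
Proof.
by apply: sym_connect_sym => i j; rewrite /share_vertex orbC andbCA.
Qed.

Let ext_pred r : pred T := fun i => Fu i && connect share_vertex r i.

(** The weight [H.+1] makes this the lexicographic order on corners, whose second coordinate is at
    most [H]. *)
Definition extreme r b : T :=
  if b then [arg max_(i > r | ext_pred r i) (xh i * H.+1 + yh i)]
  else [arg min_(i < r | ext_pred r i) (xl i * H.+1 + yl i)].

(* The corner BL ([b = false]) or TR of [i] coincides with the corner TL
   ([b' = false]) or BR of [k]. *)
Definition slot (i : T) b (k : T) b' : Prop :=
  (if b' then xh k else xl k) = (if b then xh i else xl i) /\
  (if b' then yl k else yh k) = (if b then yh i else yl i).

Lemma extremeP r b : Fu r -> ext_pred r (extreme r b).
Proof.
move=> Fr; have h : ext_pred r r by rewrite /ext_pred Fr connect0.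
by rewrite /extreme; case: b; [case: arg_maxnP|case: arg_minnP].
Qed.

(** A shared [k] would belong to the same component and have a smaller lower left corner,
    respectively a larger upper right corner, in the lexicographic order. *)
Lemma extreme_slot r b k b' : Fu r -> slot (extreme r b) b k b' -> L k -> ~~ Fu k.
Proof.
move=> Fr sl Lk; apply/negP => Fk.
have h : ext_pred r r by rewrite /ext_pred Fr connect0.
have /andP[Fe re] := extremeP b Fr.
have rk : ext_pred r k.
  rewrite /ext_pred Fk (connect_trans re) // connect1 // /share_vertex Fe Fk.
  by move: sl; rewrite /slot /corner_link; case: (b) (b') => [] [] [-> ->]; rewrite !eqxx ?orbT.
have := hx Lk; have := hy Lk; have := hx (FuL Fe); have := hy (FuL Fe).
move: sl; rewrite /slot /extreme; case: b {re Fe}.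
  case: arg_maxnP => // i _ /(_ k rk) le; case: b' => [] [? ?]; nia.
case: arg_minnP => // i _ /(_ k rk) le; case: b' => [] [? ?]; nia.
Qed.

Definition comp_root : pred T := fun i => Fu i && (fingraph.root share_vertex i == i).

(** The two ends of each component are sent injectively to the upper left and lower right corners of
    the unshared blocks and two corners of the host. Ends of different kinds at the same point would
    form a crossing, and ends of the same kind at the same point belong to the same block. *)
Lemma comp_root_bound :
  #|comp_root| <= #|[pred i | L i && ~~ Fu i]|.+1.
Proof.
pose A := ({i | comp_root i} * bool)%type.
pose B := (({i | L i && ~~ Fu i} * bool) + bool)%type.
suff [g gi] : exists g : A -> B, injective g.
  have := leq_card g gi; rewrite card_sum !card_prod !card_sig !card_bool => h.
  have -> : #|[pred i | L i && ~~ Fu i]| = #|fun i => L i && ~~ Fu i| by apply: eq_card.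
  by have : #|comp_root| * 2 <= #|fun i => L i && ~~ Fu i| * 2 + 2 by []; lia.
pose Q (x : A) (y : B) : Prop := match y with
  | inl (k, b') => slot (extreme (sval x.1) x.2) x.2 (sval k) b'
  | inr b' => b' = x.2 /\ (if b' then xh (extreme (sval x.1) b') = W /\ yh (extreme (sval x.1) b') = H
     else xl (extreme (sval x.1) b') = 0 /\ yl (extreme (sval x.1) b') = 0) end.
have ex x : exists y, Q x y.
  case: x => [[r /= rr] b]; have /andP[Fr _] := rr.
  have /andP[Fe _] := extremeP b Fr; have Le := FuL Fe.
  have nonfull k b' (Lk : L k) (sl : slot (extreme r b) b k b') : L k && ~~ Fu k.
    by rewrite Lk (extreme_slot Fr sl).
  case: b {Fe} Le nonfull => Le nonfull.
    case: (boolP ((xh (extreme r true) == W) && (yh (extreme r true) == H))).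
      by move=> /andP[/eqP ? /eqP ?]; exists (inr true).
    move=> /andP hc.
    case: (corner_TR P Le) => [[/eqP ? /eqP ?]||]; first by case: hc.
      move=> [k [Lk kx ky]]; have sl : slot (extreme r true) true k false by [].
      by exists (inl (exist _ k (nonfull _ _ Lk sl), false)).
    move=> [k [Lk kx ky]]; have sl : slot (extreme r true) true k true by [].
    by exists (inl (exist _ k (nonfull _ _ Lk sl), true)).
  case: (boolP ((xl (extreme r false) == 0) && (yl (extreme r false) == 0))).
    by move=> /andP[/eqP ? /eqP ?]; exists (inr false).
  move=> /andP hc.
  case: (corner_BL P Le) => [[/eqP ? /eqP ?]||]; first by case: hc.
    move=> [k [Lk kx ky]]; have sl : slot (extreme r false) false k false by [].
    by exists (inl (exist _ k (nonfull _ _ Lk sl), false)).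
  move=> [k [Lk kx ky]]; have sl : slot (extreme r false) false k true by [].
  by exists (inl (exist _ k (nonfull _ _ Lk sl), true)).
have [g gP] := fin_all_exists ex; exists g => -[[r rr] b] [[r' rr'] b'] eg.
have := gP (exist _ r rr, b); have := gP (exist _ r' rr', b'); rewrite -eg /=.
have /andP[Fr /eqP er] := rr; have /andP[Fr' /eqP er'] := rr'.
have /andP[Fe re] := extremeP b Fr; have /andP[Fe' re'] := extremeP b' Fr'.
have Le := FuL Fe; have Le' := FuL Fe'.
suff key : forall y, Q (exist _ r' rr', b') y -> Q (exist _ r rr, b) y ->
    b = b' /\ extreme r b = extreme r' b'.
  move=> q' q; have [eb ee] := key _ q' q.
  have e : r = r'.
    rewrite -er -er'; apply/eqP; rewrite root_connect; last exact: share_vertex_sym.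
    apply: connect_trans re _; rewrite ee share_vertex_sym; exact: re'.
  by subst; congr (exist _ _ _, _); apply: bool_irrelevance.
move=> [[k c]|c] /=; rewrite /slot.
  move=> [s1 s2] [s3 s4].
  case: (b) (b') Le Le' s1 s2 s3 s4 => [] [] Le Le' s1 s2 s3 s4.
  - by split=> //; apply: (eq_TR P) => //; lia.
  - by case: (plan_T P Le' Le); lia.
  - by case: (plan_T P Le Le'); lia.
  - by split=> //; apply: (eq_BL P) => //; lia.
move=> [e1 h'] [e2 h]; subst c; subst b'; split=> //.
by case: (b) Le Le' h h' => Le Le' h h'; [apply: (eq_TR P)|apply: (eq_BL P)] => //; lia.
Qed.

End Components.

(** * Encoding a pair of plans with common rectangles *)

Record layers (T : finType) := Layers {
  L1 : pred T;
  L2 : pred T;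
  xl : T -> nat;
  xh : T -> nat;
  yl : T -> nat;
  yh : T -> nat;
  Wd : nat;
  Ht : nat;
  Wd_gt0 : 0 < Wd;
  Ht_gt0 : 0 < Ht;
  L12 : forall i, L1 i || L2 i;
  plan1 : isplan L1 xl xh yl yh Wd Ht;
  plan2 : isplan L2 xl xh yl yh Wd Ht }.

Notation info := (bool * bool * (bool * bool * (bool * bool)))%type (only parsing).

Section Codes.
Variables (T : finType) (D : layers T).

Definition full : pred T := fun i => L1 D i && L2 D i.

Definition is_root : pred T := comp_root (xl D) (xh D) (yl D) (yh D) full.

(** The boundary flags are recorded because the links of [lnkX] depend on them; the other two flags
    locate the blocks to be matched between the layers. *)
Definition block_info (i : T) : info :=
  (full i, is_root i, (xl D i == 0, xh D i == Wd D, (yl D i == 0, yh D i == Ht D))).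

Definition attx (f g : T * bool) : Prop :=
  attX (L1 D) (xl D) (xh D) (yl D) (yh D) f g \/
  attX (L2 D) (xl D) (xh D) (yl D) (yh D) f g.

Definition atty (f g : T * bool) : Prop :=
  attX (L1 D) (yl D) (yh D) (xl D) (xh D) f g \/
  attX (L2 D) (yl D) (yh D) (xl D) (xh D) f g.

Definition lnkx (f g : T * bool) : Prop :=
  lnkX (L1 D) (xl D) (xh D) (yl D) (yh D) (Wd D) f g \/
  lnkX (L2 D) (xl D) (xh D) (yl D) (yh D) (Wd D) f g.

Definition lnky (f g : T * bool) : Prop :=
  lnkX (L1 D) (yl D) (yh D) (xl D) (xh D) (Ht D) f g \/
  lnkX (L2 D) (yl D) (yh D) (xl D) (xh D) (Ht D) f g.

Let rst_id (R R' : relation (T * bool)) :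
  (forall f g, R f g -> rst R' f g) -> forall f g, rst R f g -> rst R' f g.
Proof. exact: (@rst_sub _ _ R R' id). Qed.

Lemma attx_lnkx f g : rst attx f g <-> rst lnkx f g.
Proof.
split; apply: rst_id => {}f {}g [].
- move=> /(att_lnk (plan1 D)); apply: rst_id => ? ? ?; apply: rst_step; by left.
- move=> /(att_lnk (plan2 D)); apply: rst_id => ? ? ?; apply: rst_step; by right.
- move=> /(lnk_att (plan1 D)); apply: rst_id => ? ? ?; apply: rst_step; by left.
- move=> /(lnk_att (plan2 D)); apply: rst_id => ? ? ?; apply: rst_step; by right.
Qed.

Lemma atty_lnky f g : rst atty f g <-> rst lnky f g.
Proof.
have P1 := isplan_tr (plan1 D); have P2 := isplan_tr (plan2 D).
split; apply: rst_id => {}f {}g [].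
- move=> /(att_lnk P1); apply: rst_id => ? ? ?; apply: rst_step; by left.
- move=> /(att_lnk P2); apply: rst_id => ? ? ?; apply: rst_step; by right.
- move=> /(lnk_att P1); apply: rst_id => ? ? ?; apply: rst_step; by left.
- move=> /(lnk_att P2); apply: rst_id => ? ? ?; apply: rst_step; by right.
Qed.

(** With c components there are at least c shared blocks and at least c - 1 unshared ones in each
    layer. *)
Lemma card_roots : 3 * #|is_root| <= #|T| + 2.
Proof.
have f1 i : full i -> L1 D i by case/andP.
have f2 i : full i -> L2 D i by case/andP.
have := comp_root_bound (plan1 D) f1; have := comp_root_bound (plan2 D) f2.
have le : #|is_root| <= #|full|.
  by apply: subset_leq_card; apply/fintype.subsetP => i /andP[].
rewrite -!/is_root.
have <- : #|full| + #|predC full| = #|T| by apply: cardC.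
have : #|[predI predC full & L1 D]| + #|[predD predC full & L1 D]| = #|predC full|.
  exact: cardID.
have -> : #|[predI predC full & L1 D]| = #|[pred i | L1 D i && ~~ full i]|.
  by apply: eq_card => i; rewrite !inE andbC.
have -> : #|[predD predC full & L1 D]| = #|[pred i | L2 D i && ~~ full i]|.
  apply: eq_card => i; rewrite !inE /full; have := L12 D i.
  rewrite -!topredE /=.
  by case: (L1 D i) (L2 D i) => [] [].
lia.
Qed.

Definition TL_root (L : pred T) r := [/\ L r, xl D r = 0 & yh D r = Ht D].
Definition BR_root (L : pred T) r := [/\ L r, yl D r = 0 & xh D r = Wd D].

Definition order1 r := porder (L1 D) (xl D) (xh D) (yl D) (yh D) (Wd D) (Ht D) r.
Definition order2 r := porder (L2 D) (xl D) (xh D) (yl D) (yh D) (Wd D) (Ht D) r.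

Definition code_type (M : nat) : Type :=
  (btree info * btree unit) * (btree info * btree unit) * {ffun 'I_M.+1 -> 'I_M.+1}.

(* The last component matches the component roots, listed in the order of the
   first layer, with their positions in the list in the order of the second. *)
Definition coded (M : nat) (c : code_type M) : Prop :=
  exists r1 r2 r3 r4,
  [/\ TL_root (L1 D) r1, BR_root (L1 D) r2, TL_root (L2 D) r3, BR_root (L2 D) r4 &
   c = ((bmap block_info (ptree (L1 D) (xl D) (xh D) (yl D) (yh D) (Wd D) (Ht D) r1),
         bmap (fun _ => tt) (ptree (L1 D) (yl D) (yh D) (xl D) (xh D) (Ht D) (Wd D) r2)),
        (bmap block_info (ptree (L2 D) (xl D) (xh D) (yl D) (yh D) (Wd D) (Ht D) r3),
         bmap (fun _ => tt) (ptree (L2 D) (yl D) (yh D) (xl D) (xh D) (Ht D) (Wd D) r4)),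
        [ffun k : 'I_M.+1 => inord (index (nth r1 (seq.filter is_root (order1 r1)) k)
                                     (seq.filter is_root (order2 r3)))])].

Lemma coded_ex M : exists c, coded (M := M) c.
Proof.
have gW := Wd_gt0 D; have gH := Ht_gt0 D.
have TL L : isplan L (xl D) (xh D) (yl D) (yh D) (Wd D) (Ht D) -> exists r, TL_root L r.
  move=> P; have [||r [Lr r1 r2]] := plan_cov P (a := 0) (b := (Ht D).-1); try lia.
  by exists r; have := plan_y P Lr; split=> //; lia.
have BR L : isplan L (xl D) (xh D) (yl D) (yh D) (Wd D) (Ht D) -> exists r, BR_root L r.
  move=> P; have [||r [Lr r1 r2]] := plan_cov P (a := (Wd D).-1) (b := 0); try lia.
  by exists r; have := plan_x P Lr; split=> //; lia.
have [r1 h1] := TL _ (plan1 D); have [r2 h2] := BR _ (plan1 D).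
have [r3 h3] := TL _ (plan2 D); have [r4 h4] := BR _ (plan2 D).
by eexists; exists r1, r2, r3, r4; split.
Qed.

Lemma mem_order1 r i : TL_root (L1 D) r -> (i \in order1 r) = L1 D i.
Proof. by case=> Lr rx ry; apply: (mem_porder (plan1 D)). Qed.

Lemma mem_order2 r i : TL_root (L2 D) r -> (i \in order2 r) = L2 D i.
Proof. by case=> Lr rx ry; apply: (mem_porder (plan2 D)). Qed.

Lemma size_roots1 r : TL_root (L1 D) r -> size (seq.filter is_root (order1 r)) = #|is_root|.
Proof.
move=> hr; rewrite -(card_uniqP _); last by rewrite filter_uniq // (porder_uniq (plan1 D)).
apply: eq_card => i; rewrite mem_filter mem_order1 //.
by apply/andb_idr => /andP[/andP[]].
Qed.

Lemma size_roots2 r : TL_root (L2 D) r -> size (seq.filter is_root (order2 r)) = #|is_root|.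
Proof.
move=> hr; rewrite -(card_uniqP _); last by rewrite filter_uniq // (porder_uniq (plan2 D)).
apply: eq_card => i; rewrite mem_filter mem_order2 //.
by apply/andb_idr => /andP[/andP[]].
Qed.

End Codes.

Lemma lnkX_iff (T T' : finType) (L : pred T) (L' : pred T') xl xh yl yh xl' xh' yl' yh' W W'
    (phi : T -> T') :
  injective phi -> (forall i, L' (phi i) = L i) ->
  (forall i, (xl' (phi i) == 0) = (xl i == 0)) ->
  (forall i, (xh' (phi i) == W') = (xh i == W)) ->
  (forall i, L i -> [/\ lc L' xl' yl' yh' (phi i) = omap phi (lc L xl yl yh i),
      rc L' xl' xh' yh' (phi i) = omap phi (rc L xl xh yh i),
      lc L' yl' xl' xh' (phi i) = omap phi (lc L yl xl xh i) &
      rc L' yl' yh' xh' (phi i) = omap phi (rc L yl yh xh i)]) ->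
  forall f g : T * bool, lnkX L xl xh yl yh W f g <->
    lnkX L' xl' xh' yl' yh' W' (phi f.1, f.2) (phi g.1, g.2).
Proof.
move=> inj LE x0 xW ch.
have nx i : xl' (phi i) <> 0 <-> xl i <> 0.
  by split=> h /eqP e; apply: h; apply/eqP; rewrite ?x0 // -x0.
have nW i : xh' (phi i) <> W' <-> xh i <> W.
  by split=> h /eqP e; apply: h; apply/eqP; rewrite ?xW // -xW.
have omap_inj o j : omap phi o = Some (phi j) -> o = Some j.
  by case: o => //= a [/inj ->].
case=> i b [j c]; split=> -[p [q h]] /=.
- exists (phi p), (phi q).
  case: h => [[h n [-> ->] [-> ->]]|[h [-> ->] [-> ->]]|[h [-> ->] [-> ->]]|[h n [-> ->] [-> ->]]].
  + have [Lp _ _ _] := lcP h; have [-> _ _ _] := ch p Lp.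
    by constructor 1; rewrite h; split=> //; apply/nx.
  + have [Lp _ _ _] := rcP h; have [_ -> _ _] := ch p Lp.
    by constructor 2; rewrite h.
  + have [Lp _ _ _] := lcP h; have [_ _ -> _] := ch p Lp.
    by constructor 3; rewrite h.
  + have [Lp _ _ _] := rcP h; have [_ _ _ ->] := ch p Lp.
    by constructor 4; rewrite h; split=> //; apply/nW.
- case: h => [[h n [? ->] [? ->]]|[h [? ->] [? ->]]|[h [? ->] [? ->]]|[h n [? ->] [? ->]]];
    subst p q; [exists j, i|exists i, j|exists j, i|exists j, i].
  + have [] := lcP h; rewrite !LE => Lp _ _ _; have [e _ _ _] := ch _ Lp.
    by constructor 1; rewrite e in h; rewrite (omap_inj _ _ h); split=> //; apply/nx.
  + have [] := rcP h; rewrite !LE => Lp _ _ _; have [_ e _ _] := ch _ Lp.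
    by constructor 2; rewrite e in h; rewrite (omap_inj _ _ h).
  + have [] := lcP h; rewrite !LE => Lp _ _ _; have [_ _ e _] := ch _ Lp.
    by constructor 3; rewrite e in h; rewrite (omap_inj _ _ h).
  + have [] := rcP h; rewrite !LE => Lp _ _ _; have [_ _ _ e] := ch _ Lp.
    by constructor 4; rewrite e in h; rewrite (omap_inj _ _ h); split=> //; apply/nW.
Qed.

Section SameCode.
Variables (T T' : finType) (D : layers T) (D' : layers T') (M : nat).
Hypothesis cardT : #|T| = #|T'|.
Hypothesis rootsM : #|is_root D| <= M.
Variable c : code_type M.
Hypotheses (cD : coded D c) (cD' : coded D' c).

Local Notation child_iso L L' phi i :=
  [/\ lc L' (xl D') (yl D') (yh D') (phi i) = omap phi (lc L (xl D) (yl D) (yh D) i),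
      rc L' (xl D') (xh D') (yh D') (phi i) = omap phi (rc L (xl D) (xh D) (yh D) i),
      lc L' (yl D') (xl D') (xh D') (phi i) = omap phi (lc L (yl D) (xl D) (xh D) i) &
      rc L' (yl D') (yh D') (xh D') (phi i) = omap phi (rc L (yl D) (yh D) (xh D) i)].

(** The trees match each layer separately; the recorded indices make the two maps agree on the
    component roots. *)
Lemma layer_maps : exists p1 p2 : T -> T',
  [/\ forall i, L1 D i -> [/\ L1 D' (p1 i), block_info D' (p1 i) = block_info D i &
        child_iso (L1 D) (L1 D') p1 i],
      forall i, L2 D i -> [/\ L2 D' (p2 i), block_info D' (p2 i) = block_info D i &
        child_iso (L2 D) (L2 D') p2 i],
      {in L1 D &, injective p1}, {in L2 D &, injective p2} &
      forall i, is_root D i -> p1 i = p2 i].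
Proof.
have [r1 [r2 [r3 [r4 [h1 h2 h3 h4 ec]]]]] := cD.
have [r1' [r2' [r3' [r4' [h1' h2' h3' h4' ec']]]]] := cD'.
have eq := etrans (esym ec) ec'; have e1 := congr1 (fun c => c.1.1.1) eq.
have e2 := congr1 (fun c => c.1.1.2) eq; have e3 := congr1 (fun c => c.1.2.1) eq.
have e4 := congr1 (fun c => c.1.2.2) eq; have ef := congr1 (fun c => c.2) eq.
have [A1 A2 A3] := h1; have [B1 B2 B3] := h2; have [C1 C2 C3] := h3; have [E1 E2 E3] := h4.
have [A1' A2' A3'] := h1'; have [B1' B2' B3'] := h2'.
have [C1' C2' C3'] := h3'; have [E1' E2' E3'] := h4'.
pose p1 := plan_map (L1 D) (L1 D') (xl D) (xh D) (yl D) (yh D) (xl D') (xh D') (yl D') (yh D')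
  (Wd D) (Ht D) (Wd D') (Ht D') r1 r1' r1'.
pose p2 := plan_map (L2 D) (L2 D') (xl D) (xh D) (yl D) (yh D) (xl D') (xh D') (yl D') (yh D')
  (Wd D) (Ht D) (Wd D') (Ht D') r3 r3' r1'.
have p1info i : L1 D i -> block_info D' (p1 i) = block_info D i.
  exact: (plan_map_info (plan1 D) A1 A2 A3 e1).
have p2info i : L2 D i -> block_info D' (p2 i) = block_info D i.
  exact: (plan_map_info (plan2 D) C1 C2 C3 e3).
exists p1, p2; split.
- move=> i Li; split; first exact: (plan_mapL (plan1 D) (plan1 D') A1 A2 A3 A1' A2' A3' e1).
  + exact: p1info.
  + exact: (plan_map_child (plan1 D) (plan1 D') A1 A2 A3 B1 B2 B3 A1' A2' A3' B1' B2' B3' e1 e2).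
- move=> i Li; split; first exact: (plan_mapL (plan2 D) (plan2 D') C1 C2 C3 C1' C2' C3' e3).
  + exact: p2info.
  + exact: (plan_map_child (plan2 D) (plan2 D') C1 C2 C3 E1 E2 E3 C1' C2' C3' E1' E2' E3' e3 e4).
- by move=> i j Li Lj; apply: (plan_map_inj (plan1 D) (plan1 D') A1 A2 A3 e1).
- by move=> i j Li Lj; apply: (plan_map_inj (plan2 D) (plan2 D') C1 C2 C3 e3).
move=> i ri.
set rl1 := seq.filter (is_root D) (order1 D r1) in ef; set rl2 := seq.filter _ (order2 D _) in ef.
set rl1' := seq.filter _ (order1 _ r1') in ef; set rl2' := seq.filter _ (order2 _ r3') in ef.
have m1 : map p1 rl1 = rl1'.
  rewrite /rl1' -[order1 D' r1'](plan_map_seq (plan1 D) e1 r1') filter_map -/p1 //.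
  congr map; apply: eq_in_filter => j; rewrite (mem_order1 j h1) => Lj /=.
  by have := p1info j Lj => -[_ ->].
have m2 : map p2 rl2 = rl2'.
  rewrite /rl2' -[order2 D' r3'](plan_map_seq (plan2 D) e3 r1') filter_map -/p2 //.
  congr map; apply: eq_in_filter => j; rewrite (mem_order2 j h3) => Lj /=.
  by have := p2info j Lj => -[_ ->].
have sz1 := size_roots1 h1; have sz2 := size_roots2 h3.
rewrite -/rl1 in sz1; rewrite -/rl2 in sz2.
have sz1' : size rl1' = #|is_root D| by rewrite -m1 size_map.
have sz2' : size rl2' = #|is_root D| by rewrite -m2 size_map.
have /andP[/andP[Li1 Li2] _] := ri.
have i1 : i \in rl1 by rewrite mem_filter ri (mem_order1 i h1).
have i2 : i \in rl2 by rewrite mem_filter ri (mem_order2 i h3).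
have kM : index i rl1 < M.+1 by rewrite ltnS (leq_trans _ rootsM) // -sz1 ltnW // index_mem.
have := congr1 (fun h : {ffun 'I_M.+1 -> 'I_M.+1} => nat_of_ord (h (Ordinal kM))) ef.
rewrite !ffunE /= nth_index // -m1 (nth_map r1) ?index_mem // nth_index //.
have mem_p1 : p1 i \in rl2'.
  have : p1 i \in rl1' by rewrite -m1 map_f.
  rewrite !mem_filter (mem_order1 _ h1') (mem_order2 _ h3') => /andP[rp _].
  by rewrite rp; case/andP: rp => /andP[].
rewrite !inordK; last 2 first.
- by rewrite ltnS (leq_trans _ rootsM) // -sz2' ltnW // index_mem.
- by rewrite ltnS (leq_trans _ rootsM) // -sz2 ltnW // index_mem.
move=> e; have := nth_index r1' mem_p1; rewrite -e -m2 (nth_map r1) ?index_mem //.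
by rewrite nth_index.
Qed.

Lemma same_code_iso : exists phi : T -> T',
  [/\ bijective phi,
      forall f g : T * bool, rst (attx D) f g <-> rst (attx D') (phi f.1, f.2) (phi g.1, g.2) &
      forall f g : T * bool, rst (atty D) f g <-> rst (atty D') (phi f.1, f.2) (phi g.1, g.2)].
Proof.
have [p1 [p2 [h1 h2 inj1 inj2 hr]]] := layer_maps.
have P1 := plan1 D'; have P2 := plan2 D'.
have fullE i : L1 D i -> full D' (p1 i) = full D i.
  by move=> Li; have [_ [-> _] _] := h1 i Li.
have fullE2 i : L2 D i -> full D' (p2 i) = full D i.
  by move=> Li; have [_ [-> _] _] := h2 i Li.
(* Walk from the root of the component. Consecutive blocks share a vertex, so in both layers one is
   a child of the other in the same way, and both maps preserve this; the position of the corner in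
   [D'] then determines the next block. *)
have agree i : full D i -> p1 i = p2 i.
  move=> Fi; pose r := fingraph.root (share_vertex (xl D) (xh D) (yl D) (yh D) (full D)) i.
  have sv_sym := share_vertex_sym (xl D) (xh D) (yl D) (yh D) (full D).
  have ri : connect (share_vertex (xl D) (xh D) (yl D) (yh D) (full D)) r i.
    by rewrite sv_sym; apply: connect_root.
  have Fr : full D r.
    have /connectP[[|j s] /=] : connect (share_vertex (xl D) (xh D) (yl D) (yh D) (full D)) r i
      by [].
      by move=> _ <-.
    by move=> /andP[/and3P[]].
  have er : p1 r = p2 r.
    by apply: hr; rewrite /is_root /comp_root Fr (root_root sv_sym) eqxx.
  have /connectP[s ps ei] := ri; elim: s r Fr er ps ei {ri} => [|j s IH] r Fr er /=.
    by move=> _ ->.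
  move=> /andP[/and3P[_ Fj sv] ps] ei; apply: (IH j) => // {IH ps ei s i Fi}.
  have /andP[r1 r2] := Fr; have /andP[j1 j2] := Fj.
  have [Lr1 _ [a1 b1 c1 d1]] := h1 r r1; have [Lr2 _ [a2 b2 c2 d2]] := h2 r r2.
  have [Lj1 _ [a1' b1' c1' d1']] := h1 j j1; have [Lj2 _ [a2' b2' c2' d2']] := h2 j j2.
  have Lj1' : L2 D' (p1 j) by have := fullE j j1; rewrite Fj => /andP[].
  have Q1 := plan1 D; have Q2 := plan2 D.
  have Q1t := isplan_tr Q1; have Q2t := isplan_tr Q2; have P2t := isplan_tr P2.
  case/orP: sv => /or4P[] /andP[/eqP ex /eqP ey].
  - have e1 := lcE Q1 r1 j1 ex ey; have e2 := lcE Q2 r2 j2 ex ey.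
    move: a1 a2; rewrite e1 e2 /= => /lcP[_ _ ? ?] /lcP[_ _ ? ?].
    by apply: (eq_TL P2) => //; congruence.
  - have e1 := rcE Q1 r1 j1 ex ey; have e2 := rcE Q2 r2 j2 ex ey.
    move: b1 b2; rewrite e1 e2 /= => /rcP[_ _ ? ?] /rcP[_ _ ? ?].
    by apply: (eq_TL P2) => //; congruence.
  - have e1 := lcE Q1t r1 j1 ey ex; have e2 := lcE Q2t r2 j2 ey ex.
    move: c1 c2; rewrite e1 e2 /= => /lcP[_ _ ? ?] /lcP[_ _ ? ?].
    by apply: (eq_TL P2t) => //; congruence.
  - have e1 := rcE Q1t r1 j1 ey ex; have e2 := rcE Q2t r2 j2 ey ex.
    move: d1 d2; rewrite e1 e2 /= => /rcP[_ _ ? ?] /rcP[_ _ ? ?].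
    by apply: (eq_TL P2t) => //; congruence.
  - have e1 := lcE Q1 j1 r1 ex ey; have e2 := lcE Q2 j2 r2 ex ey.
    move: a1' a2'; rewrite e1 e2 /= => /lcP[_ _ ? ?] /lcP[_ _ ? ?].
    by apply: (eq_BL P2) => //; congruence.
  - have e1 := rcE Q1 j1 r1 ex ey; have e2 := rcE Q2 j2 r2 ex ey.
    move: b1' b2'; rewrite e1 e2 /= => /rcP[_ _ ? ?] /rcP[_ _ ? ?].
    by apply: (eq_TR P2) => //; congruence.
  - have e1 := lcE Q1t j1 r1 ey ex; have e2 := lcE Q2t j2 r2 ey ex.
    move: c1' c2'; rewrite e1 e2 /= => /lcP[_ _ ? ?] /lcP[_ _ ? ?].
    by apply: (eq_BL P2) => //; congruence.
  - have e1 := rcE Q1t j1 r1 ey ex; have e2 := rcE Q2t j2 r2 ey ex.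
    move: d1' d2'; rewrite e1 e2 /= => /rcP[_ _ ? ?] /rcP[_ _ ? ?].
    by apply: (eq_TR P2) => //; congruence.
pose phi i := if L1 D i then p1 i else p2 i.
have phi1 i : L1 D i -> phi i = p1 i by rewrite /phi => ->.
have phi2 i : L2 D i -> phi i = p2 i.
  by move=> L2i; rewrite /phi; case: ifP => // L1i; apply: agree; rewrite /full L1i.
have infoE i : block_info D' (phi i) = block_info D i.
  case/orP: (L12 D i) => Li; [rewrite phi1 //|rewrite phi2 //].
    by have [] := h1 i Li.
  by have [] := h2 i Li.
have fullphi i : full D' (phi i) = full D i by have [-> _] := infoE i.
have L1E i : L1 D' (phi i) = L1 D i.
  case L1i: (L1 D i); first by rewrite phi1 //; have [-> _ _] := h1 i L1i.
  have L2i : L2 D i by have := L12 D i; rewrite L1i.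
  have := fullphi i; rewrite /full L1i /= phi2 //; have [-> _ _] := h2 i L2i.
  by rewrite andbT.
have L2E i : L2 D' (phi i) = L2 D i.
  case L2i: (L2 D i); first by rewrite phi2 //; have [-> _ _] := h2 i L2i.
  have L1i : L1 D i by have := L12 D i; rewrite L2i orbF.
  by have := fullphi i; rewrite /full L2i L1E L1i /=.
have inj : injective phi.
  move=> i j e.
  case: (boolP (L1 D i)) => Li.
    have Lj : L1 D j by rewrite -L1E -e L1E.
    by apply: inj1 => //; rewrite -!phi1.
  have Li2 : L2 D i by have := L12 D i; rewrite (negbTE Li).
  have Lj2 : L2 D j by rewrite -L2E -e L2E.
  by apply: inj2 => //; rewrite -!phi2.
have bij : bijective phi by apply: inj_card_bij => //; rewrite cardT.
have ch1 i : L1 D i -> child_iso (L1 D) (L1 D') phi i.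
  move=> Li; have [_ _ [a b d e]] := h1 i Li; rewrite phi1 // a b d e.
  have om o : (forall j, o = Some j -> L1 D j) -> omap p1 o = omap phi o.
    by case: o => //= j h; rewrite phi1 //; apply: h.
  by split; apply: om => j; [case/lcP|case/rcP|case/lcP|case/rcP].
have ch2 i : L2 D i -> child_iso (L2 D) (L2 D') phi i.
  move=> Li; have [_ _ [a b d e]] := h2 i Li; rewrite phi2 // a b d e.
  have om o : (forall j, o = Some j -> L2 D j) -> omap p2 o = omap phi o.
    by case: o => //= j h; rewrite phi2 //; apply: h.
  by split; apply: om => j; [case/lcP|case/rcP|case/lcP|case/rcP].
have [psi phiK psiK] := bij.
exists phi; split=> // f g.
- rewrite !attx_lnkx.
  apply: (@rst_iff _ _ _ _ (fun f => (phi f.1, f.2)) (fun f => (psi f.1, f.2))).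
  + by case=> ? ? /=; rewrite phiK.
  + by case=> ? ? /=; rewrite psiK.
  + move=> {}f {}g; rewrite /lnkx.
    have b1 i : (xl D' (phi i) == 0) = (xl D i == 0) by have [_ _ ->] := infoE i.
    have b2 i : (xh D' (phi i) == Wd D') = (xh D i == Wd D) by have [_ _ _ ->] := infoE i.
    have -> := lnkX_iff inj L1E b1 b2 ch1 f g.
    by have -> := lnkX_iff inj L2E b1 b2 ch2 f g.
- rewrite !atty_lnky.
  apply: (@rst_iff _ _ _ _ (fun f => (phi f.1, f.2)) (fun f => (psi f.1, f.2))).
  + by case=> ? ? /=; rewrite phiK.
  + by case=> ? ? /=; rewrite psiK.
  + move=> {}f {}g; rewrite /lnky.
    have b1 i : (yl D' (phi i) == 0) = (yl D i == 0) by have [_ _ _ _ ->] := infoE i.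
    have b2 i : (yh D' (phi i) == Ht D') = (yh D i == Ht D) by have [_ _ _ _ _ ->] := infoE i.
    by split=> -[h|h]; [left|right|left|right]; move: h; apply lnkX_iff => // i Li;
      [have [] := ch1 i Li|have [] := ch2 i Li|have [] := ch1 i Li|have [] := ch2 i Li].
Qed.

End SameCode.

(** * Encoding a labelled partition by a word *)

Section Word.
Variables (T : finType) (A : eqType) (lab : T -> A) (key : T -> nat).

(** Along a sequence sorted by [key], the flag tells whether the class of the preceding element
    continues. The word thus describes a labelled partition up to bijection with boundedly many bits
    per element; it serves for the direction z. *)
Definition word (s : seq T) : seq (A * bool) :=
  if s is a :: s' then
    (lab a, false) :: pairmap (fun x y => (lab y, key x == key y)) a s'
  else [::].

Definition key_seq (s : seq T) : Prop :=
  [/\ uniq s, forall i, i \in s & sorted (relpre key leq) s].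

Lemma key_seq_ex : exists s, key_seq s.
Proof.
exists (sort (relpre key leq) (enum T)); split.
- by rewrite sort_uniq enum_uniq.
- by move=> i; rewrite mem_sort mem_enum.
- by apply: sort_sorted => i j; exact: leq_total.
Qed.

Lemma size_word s : size (word s) = size s.
Proof. by case: s => //= a s; rewrite size_pairmap. Qed.

Lemma size_key_seq s : key_seq s -> size s = #|T|.
Proof. by case=> us ms _; rewrite -(card_uniqP us); apply: eq_card => i; rewrite ms. Qed.

Lemma nth_word_lab d d' s k : k < size s -> (nth d' (word s) k).1 = lab (nth d s k).
Proof.
case: s => // a s; case: k => //= k ks; rewrite (nth_pairmap d) //.
Qed.

Lemma nth_word_key d d' s k : k.+1 < size s ->
  (nth d' (word s) k.+1).2 = (key (nth d s k) == key (nth d s k.+1)).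
Proof. by case: s => // a s /= ks; rewrite (nth_pairmap d). Qed.

Lemma word_key d d' s p q : key_seq s -> p <= q < size s ->
  key (nth d s p) = key (nth d s q) <->
  (forall k, p <= k < q -> (nth d' (word s) k.+1).2).
Proof.
move=> [us ms ss] /andP[pq qs].
have mono k l : k <= l < size s -> key (nth d s k) <= key (nth d s l).
  move=> /andP[kl ls]; apply: (sorted_leq_nth (leT := relpre key leq)) => //.
  - by move=> ? ? ?; apply: leq_trans.
  - by move=> ?; apply: leqnn.
  - by rewrite inE; lia.
split=> [e k kpq|h].
  rewrite (nth_word_key d); last by lia.
  have := mono p k; have := mono k k.+1; have := mono k.+1 q; lia.
elim: q pq qs h => [|q IH] pq qs h; first by have -> : p = 0 by lia.
case: (eqVneq p q.+1) => [->//|npq].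
rewrite IH; [|lia|lia|by move=> k hk; apply: h; lia].
by apply/eqP; rewrite -(nth_word_key d d') //; apply: h; lia.
Qed.

End Word.

Lemma word_iso (T T' : finType) (A : eqType) (lab : T -> A) (key : T -> nat)
    (lab' : T' -> A) (key' : T' -> nat) s s' (a : T) :
  key_seq key s -> key_seq key' s' -> word lab key s = word lab' key' s' ->
  exists phi : T -> T', [/\ bijective phi, forall i, lab' (phi i) = lab i &
    forall i j, key i = key j <-> key' (phi i) = key' (phi j)].
Proof.
move=> ks ks' ew; have sz : size s = size s' by rewrite -(size_word lab key) ew size_word.
have [us ms ss] := ks; have [us' ms' ss'] := ks'.
have [a' _] : exists a' : T', true.
  by case: (s') sz => [/size0nil e|b _ _]; [have := ms a; rewrite e|exists b].
pose phi i := nth a' s' (index i s).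
have lt i : index i s < size s by rewrite index_mem.
have phi_inj : injective phi.
  move=> i j /eqP; rewrite nth_uniq -?sz // => /eqP e.
  by rewrite -(nth_index a (ms i)) e nth_index.
exists phi; split.
- by apply: inj_card_bij => //; rewrite -(size_key_seq ks) -(size_key_seq ks') sz.
- move=> i; pose d0 := (lab i, false).
  by rewrite -(nth_word_lab lab' key' a' d0) -?sz // -ew (nth_word_lab _ _ a) // nth_index.
suff key_le i j : index i s <= index j s -> (key i = key j <-> key' (phi i) = key' (phi j)).
  move=> i j; case: (leqP (index i s) (index j s)) => [/key_le//|/ltnW/key_le h].
  by split=> e; apply: esym; apply/h.
move=> le; pose d0 := (lab i, false).
have h : index i s <= index j s < size s by rewrite le lt.
have h' : index i s <= index j s < size s' by rewrite -sz.
have := word_key lab a d0 ks h; have := word_key lab' a' d0 ks' h'.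
by rewrite ew !nth_index // -/(phi i) -/(phi j) => -> ->.
Qed.

(** * Tuples encoding trees *)

Definition btuple (A : Type) n (t : btree A) : (2 * n).+1.-tuple (option A) :=
  [tuple nth None (bcode t) k | k < (2 * n).+1].

(** A tree with m nodes has a code of length 2m + 1, and a prefix-free code stays decodable when
    padded by [None]. *)
Lemma btuple_inj A n (t t' : btree A) :
  size (inorder t) <= n -> size (inorder t') <= n -> btuple n t = btuple n t' -> t = t'.
Proof.
move=> st st' e.
have pad (u : btree A) : size (inorder u) <= n ->
    map (fun k : 'I_(2 * n).+1 => nth None (bcode u) k) (enum 'I_(2 * n).+1) =
    bcode u ++ nseq ((2 * n).+1 - size (bcode u)) None.
  move=> su; have szu : size (bcode u) <= (2 * n).+1 by rewrite size_bcode; lia.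
  rewrite (map_comp (nth None (bcode u)) val) val_enum_ord.
  apply: (@eq_from_nth _ None) => [|k]; rewrite size_map size_iota.
    by rewrite size_cat size_nseq; lia.
  move=> kn; rewrite (nth_map 0) ?size_iota // nth_iota // add0n nth_cat.
  by case: ltnP => // ku; rewrite nth_nseq if_same nth_default.
have := congr1 (fun x : (2 * n).+1.-tuple (option A) => tval x) e.
by rewrite /= !pad // => /bcode_inj [].
Qed.

(** * Rigid vertices of integer plans *)

Definition flip (k : 'I_3) (s : 'I_3 -> bool) : 'I_3 -> bool :=
  fun l => if l == k then ~~ s l else s l.

Section Rigid.
Variables (T : finType) (D : 'I_3 -> nat) (clo chi : T -> 'I_3 -> nat) (P : 'I_3 -> nat).

(* As in [fills_octant], [s k = true] stands for the negative direction. *)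
Definition fills m (s : 'I_3 -> bool) : Prop :=
  forall k, if s k then clo m k < P k <= chi m k else clo m k <= P k < chi m k.

(* [val] stands for the coordinates of the faces of slightly moved blocks: those
   of two blocks that fill neighbouring octants stay equal, and the faces on the
   boundary of the host cannot move. *)
Definition rigid (A : Type) (bd : 'I_3 -> A) : Prop := forall val : T -> 'I_3 -> bool -> A,
  (forall k (s : 'I_3 -> bool) m m', s k -> fills m s -> fills m' (flip k s) -> m <> m' ->
     val m k true = val m' k false) ->
  (forall k (s : 'I_3 -> bool) m, s k -> fills m s -> P k = D k -> val m k true = bd k) ->
  (forall k (s : 'I_3 -> bool) m, ~~ s k -> fills m s -> P k = 0 -> val m k false = bd k) ->
  forall k, exists v, forall m, (forall l, clo m l <= P l <= chi m l) ->
    (clo m k = P k -> val m k false = v) /\ (chi m k = P k -> val m k true = v).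

End Rigid.

(** * The floor plan of a set of cells *)

Section Next.
Variables (s : pred nat) (N : nat).

Definition nxt (i0 : nat) : nat := i0 + find s (iota i0 (N - i0)).

Lemma nxt_le i0 : i0 <= N -> i0 <= nxt i0 <= N.
Proof.
move=> h; rewrite /nxt leq_addr /=.
by have := find_size s (iota i0 (N - i0)); rewrite size_iota; lia.
Qed.

Lemma nxt_s i0 : i0 <= N -> nxt i0 < N -> s (nxt i0).
Proof.
move=> h lt; have hs : has s (iota i0 (N - i0)).
  by rewrite has_find size_iota; move: lt; rewrite /nxt; lia.
have := nth_find 0 hs; rewrite nth_iota //.
by move: hs; rewrite has_find size_iota.
Qed.

Lemma nxt_min i0 i : i0 <= i < nxt i0 -> ~~ s i.
Proof.
move=> /andP[h lt]; have fi : i - i0 < find s (iota i0 (N - i0)) by move: lt; rewrite /nxt; lia.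
have := before_find 0 fi; have := find_size s (iota i0 (N - i0)); rewrite size_iota => sz.
rewrite nth_iota; last by lia.
by rewrite subnKC // => ->.
Qed.

(** A maximal run of missing cells begins at 0 or just after a cell. It will become the interval
    from 2 i0 to 2 nxt i0 + 1, which has positive length even if the run is empty. *)
Definition start (i0 : nat) : bool := (i0 == 0) || s i0.-1.

Hypothesis sN : forall i, s i -> i < N.

Lemma start_le i0 : start i0 -> i0 <= N.
Proof. by move=> /orP[/eqP->//|/sN]; lia. Qed.

Lemma piece_ex y : y < (2 * N).+1 ->
  (exists i, s i /\ y = (2 * i).+1) \/
  (exists i0, start i0 /\ 2 * i0 <= y < (2 * nxt i0).+1).
Proof.
elim: y => [|y IH] yN; first by right; exists 0; split.
have [|[i [si e]]|[i0 [st /andP[h1 h2]]]] := IH; first by lia.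
  right; exists i.+1; have st : start i.+1 by [].
  by split=> //; have := nxt_le (start_le st); lia.
case: (leqP (2 * nxt i0).+1 y.+1) => h3; last by right; exists i0; split=> //; lia.
left; exists (nxt i0); have := start_le st => le; split; last by lia.
by apply: nxt_s => //; lia.
Qed.

Lemma piece_disj i i0 y : s i -> y = (2 * i).+1 -> 2 * i0 <= y < (2 * nxt i0).+1 -> False.
Proof.
move=> si -> h; have : i0 <= i < nxt i0 by lia.
by move=> /nxt_min; rewrite si.
Qed.

Lemma piece_uni i0 i1 y : start i0 -> start i1 ->
  2 * i0 <= y < (2 * nxt i0).+1 -> 2 * i1 <= y < (2 * nxt i1).+1 -> i0 = i1.
Proof.
have key a b : start b -> a < b -> 2 * a <= y < (2 * nxt a).+1 ->
    2 * b <= y < (2 * nxt b).+1 -> False.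
  move=> /orP[/eqP->//|sb] ab ha hb.
  have : a <= b.-1 < nxt a by lia.
  by move=> /nxt_min; rewrite sb.
move=> s0 s1 h0 h1; case: (ltngtP i0 i1) => // lt.
  by case: (key _ _ s1 lt h0 h1).
by case: (key _ _ s0 lt h1 h0).
Qed.

End Next.

(** Column [x] and row [i] of the grid occupy the intervals [2x+1, 2x+2] and [2i+1, 2i+2]; what
    remains are the strips [2j, 2j+1]. [Fb] is a cell, running through both layers. In the lower
    layer [N1] is a piece of a column left free by the cells and [Ab] a strip beside the columns; in
    the upper layer [N2] is a piece of a row and [Bb] a strip beside the rows. *)
Inductive shape := Fb of nat & nat | N1 of nat & nat | N2 of nat & nat | Ab of nat | Bb of nat.

Section Plan.
Variables (p r : nat) (S : nat -> nat -> bool).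
Hypothesis Sp : forall x i, S x i -> x < p.
Hypothesis Sr : forall x i, S x i -> i < r.

Definition nxtY x := nxt (S x) r.
Definition nxtX i := nxt (S^~ i) p.

Definition valid (b : shape) : bool :=
  match b with
  | Fb x i => S x i
  | N1 x i0 => (x < p) && start (S x) i0
  | N2 i x0 => (i < r) && start (S^~ i) x0
  | Ab j => j <= p
  | Bb j => j <= r
  end.

Definition tri (a b c : nat) (k : 'I_3) : nat :=
  match val k with 0 => a | 1 => b | _ => c end.

Definition slo (b : shape) : 'I_3 -> nat :=
  match b with
  | Fb x i => tri (2 * x).+1 (2 * i).+1 0
  | N1 x i0 => tri (2 * x).+1 (2 * i0) 0
  | N2 i x0 => tri (2 * x0) (2 * i).+1 1
  | Ab j => tri (2 * j) 0 0
  | Bb j => tri 0 (2 * j) 1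
  end.

Definition shi (b : shape) : 'I_3 -> nat :=
  match b with
  | Fb x i => tri (2 * x).+2 (2 * i).+2 2
  | N1 x i0 => tri (2 * x).+2 (2 * nxtY x i0).+1 1
  | N2 i x0 => tri (2 * nxtX i x0).+1 (2 * i).+2 2
  | Ab j => tri (2 * j).+1 (2 * r).+1 1
  | Bb j => tri (2 * p).+1 (2 * j).+1 2
  end.

Definition dims : 'I_3 -> nat := tri (2 * p).+1 (2 * r).+1 2.

Lemma nxtY_le x i0 : start (S x) i0 -> i0 <= nxtY x i0 <= r.
Proof. by move=> st; apply: nxt_le; apply: (start_le (s := S x)) st; apply: Sr. Qed.

Lemma nxtX_le i x0 : start (S^~ i) x0 -> x0 <= nxtX i x0 <= p.
Proof. by move=> st; apply: nxt_le; apply: (start_le (s := S^~ i)) st => x /Sp. Qed.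

Lemma shape_wf b : valid b -> forall k, slo b k < shi b k <= dims k.
Proof.
case: b => [x i|x i0|i x0|j|j] /= v.
- by have := Sp v; have := Sr v => ? ?; apply: ord3_ind; rewrite /= /dims /tri /=; lia.
- by case/andP: v => ? /nxtY_le ?; apply: ord3_ind; rewrite /= /dims /tri /=; lia.
- by case/andP: v => ? /nxtX_le ?; apply: ord3_ind; rewrite /= /dims /tri /=; lia.
- by apply: ord3_ind; rewrite /= /dims /tri /=; lia.
- by apply: ord3_ind; rewrite /= /dims /tri /=; lia.
Qed.

Lemma shape_cov v : (forall k, v k < dims k) ->
  exists2 b, valid b & forall k, slo b k <= v k < shi b k.
Proof.
move=> vD; have := vD kX; have := vD kY; have := vD kZ; rewrite /= /dims /tri /= => vz vy vx.
case: (posnP (v kZ)) => z0.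
  case: (boolP (odd (v kX))) => ox.
    have ex : v kX = (2 * (v kX)./2).+1 by lia.
    have hp : (v kX)./2 < p by lia.
    case: (piece_ex (s := S (v kX)./2) (@Sr _) vy) => [[i [si e]]|[i0 [st h]]].
      by exists (Fb (v kX)./2 i) => //=; apply: ord3_ind; rewrite /= /tri /=; lia.
    exists (N1 (v kX)./2 i0); first by rewrite /= hp.
    by apply: ord3_ind; rewrite /= /tri /=; [lia|exact: h|lia].
  by exists (Ab (v kX)./2) => /=; [lia|apply: ord3_ind; rewrite /= /tri /=; lia].
case: (boolP (odd (v kY))) => oy.
  have ey : v kY = (2 * (v kY)./2).+1 by lia.
  have hr : (v kY)./2 < r by lia.
  have sp x : S^~ (v kY)./2 x -> x < p by apply: Sp.
  case: (piece_ex sp vx) => [[x [sx e]]|[x0 [st h]]].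
    by exists (Fb x (v kY)./2) => //=; apply: ord3_ind; rewrite /= /tri /=; lia.
  exists (N2 (v kY)./2 x0); first by rewrite /= hr.
  by apply: ord3_ind; rewrite /= /tri /=; [exact: h|lia|lia].
by exists (Bb (v kY)./2) => /=; [lia|apply: ord3_ind; rewrite /= /tri /=; lia].
Qed.

Lemma shape_uni v b b' : valid b -> valid b' -> (forall k, slo b k <= v k < shi b k) ->
  (forall k, slo b' k <= v k < shi b' k) -> b = b'.
Proof.
have FN1 x i x' i0 : S x i -> (2 * x).+1 <= v kX < (2 * x).+2 -> (2 * i).+1 <= v kY < (2 * i).+2 ->
   (2 * x').+1 <= v kX < (2 * x').+2 -> 2 * i0 <= v kY < (2 * nxtY x' i0).+1 -> False.
  move=> sx h1 h2 h3 h4; have e : x' = x by lia.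
  by rewrite e in h4; apply: (piece_disj sx _ h4); lia.
have FN2 x i i' x0 : S x i -> (2 * x).+1 <= v kX < (2 * x).+2 -> (2 * i).+1 <= v kY < (2 * i).+2 ->
   (2 * i').+1 <= v kY < (2 * i').+2 -> 2 * x0 <= v kX < (2 * nxtX i' x0).+1 -> False.
  move=> sx h1 h2 h3 h4; have e : i' = i by lia.
  by rewrite e in h4; apply: (piece_disj (s := S^~ i) sx _ h4); lia.
move=> vb vb' hb hb'; move: (hb kX) (hb kY) (hb kZ) (hb' kX) (hb' kY) (hb' kZ).
case: b vb hb => [x i|x i0|i x0|j|j] /= vb _; case: b' vb' hb' => [x' i'|x' i0'|i' x0'|j'|j'] /= vb' _;
  rewrite /= /tri /= => h1 h2 h3 h4 h5 h6; try (exfalso; lia).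
- by congr Fb; lia.
- by case: (FN1 x i x' i0').
- by case: (FN2 x i i' x0').
- by case: (FN1 x' i' x i0).
- case/andP: vb => hx st; case/andP: vb' => hx' st'.
  have e : x = x' by lia.
  by rewrite e in st h2 *; congr N1; apply: (piece_uni st st' h2).
- by case: (FN2 x' i' i x0).
- case/andP: vb => hx st; case/andP: vb' => hx' st'.
  have e : i = i' by lia.
  by rewrite e in st h1 *; congr N2; apply: (piece_uni st st' h1).
- by congr Ab; lia.
- by congr Bb; lia.
Qed.

Definition cellT := {c : 'I_p * 'I_r | S c.1 c.2}.
(** Each cell accounts for three blocks: itself and the pieces after it in its column and in its
    row. The other blocks are the first piece of every column and row, and the strips. *)
Definition blockT : finType := (((cellT + cellT) + cellT) + (('I_p + 'I_r) + ('I_p.+1 + 'I_r.+1)))%type.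

Definition sh (t : blockT) : shape :=
  match t with
  | inl (inl (inl c)) => Fb (val c).1 (val c).2
  | inl (inl (inr c)) => N1 (val c).1 (val c).2.+1
  | inl (inr c) => N2 (val c).2 (val c).1.+1
  | inr (inl (inl x)) => N1 x 0
  | inr (inl (inr i)) => N2 i 0
  | inr (inr (inl j)) => Ab j
  | inr (inr (inr j)) => Bb j
  end.

Lemma sh_valid t : valid (sh t).
Proof.
case: t => [[[[[x i] s]|[[x i] s]]|[[x i] s]]|[[x|i]|[j|j]]] /=.
- exact: s.
- by rewrite ltn_ord.
- by rewrite ltn_ord.
- by rewrite ltn_ord.
- by rewrite ltn_ord.
- by rewrite -ltnS ltn_ord.
- by rewrite -ltnS ltn_ord.
Qed.

Lemma sh_inj : injective sh.
Proof.
case=> [[[[[x i] s]|[[x i] s]]|[[x i] s]]|[[x|i]|[j|j]]]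
  [[[[[x' i'] s']|[[x' i'] s']]|[[x' i'] s']]|[[x'|i']|[j'|j']]] //=; case=> //;
  by first [move=> /val_inj e1 /val_inj e2; subst; rewrite (bool_irrelevance s s')|move=> /val_inj ->].
Qed.

Lemma sh_surj b : valid b -> exists t, sh t = b.
Proof.
case: b => [x i|x i0|i x0|j|j] /= v.
- by exists (inl (inl (inl (exist _ (Ordinal (Sp v), Ordinal (Sr v)) v)))).
- case/andP: v => hx; case: i0 => [|i] /= v; first by exists (inr (inl (inl (Ordinal hx)))).
  by exists (inl (inl (inr (exist _ (Ordinal (Sp v), Ordinal (Sr v)) v)))).
- case/andP: v => hi; case: x0 => [|x] /= v; first by exists (inr (inl (inr (Ordinal hi)))).
  by exists (inl (inr (exist _ (Ordinal (Sp v), Ordinal (Sr v)) v))).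
- by exists (inr (inr (inl (Ordinal (v : j < p.+1))))).
- by exists (inr (inr (inr (Ordinal (v : j < r.+1))))).
Qed.

Definition bclo t := slo (sh t).
Definition bchi t := shi (sh t).

Lemma card_blockT : #|blockT| = 3 * #|[pred c : 'I_p * 'I_r | S c.1 c.2]| + 2 * p + 2 * r + 2.
Proof.
rewrite !card_sum !card_ord card_sig.
have -> : #|fun c : 'I_p * 'I_r => S c.1 c.2| = #|[pred c : 'I_p * 'I_r | S c.1 c.2]|.
  exact: eq_card.
lia.
Qed.

End Plan.

(** * Rigidity of the vertices of a cell plan *)

Definition sgn (a b c : bool) (k : 'I_3) : bool :=
  match val k with 0 => a | 1 => b | _ => c end.

Definition sideb (l h x : nat) (s : bool) : bool := if s then l < x <= h else l <= x < h.

Section RigidPlan.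
Variables (p r : nat) (S : nat -> nat -> bool).
Hypothesis Sp : forall x i, S x i -> x < p.
Hypothesis Sr : forall x i, S x i -> i < r.
Variables (P : 'I_3 -> nat) (A : Type) (bd : 'I_3 -> A).
Hypothesis PD : forall k, P k <= dims p r k.

Local Notation T := (blockT p r S).
Local Notation clo := (@bclo p r S).
Local Notation chi := (@bchi p r S).
Local Notation fills := (fills clo chi P).

Variable val : T -> 'I_3 -> bool -> A.
Hypothesis h1 : forall k (s : 'I_3 -> bool) m m', s k -> fills m s -> fills m' (flip k s) ->
  m <> m' -> val m k true = val m' k false.
Hypothesis h2 : forall k (s : 'I_3 -> bool) m, s k -> fills m s -> P k = dims p r k ->
  val m k true = bd k.
Hypothesis h3 : forall k (s : 'I_3 -> bool) m, ~~ s k -> fills m s -> P k = 0 ->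
  val m k false = bd k.

Local Notation adj m := (forall l, clo m l <= P l <= chi m l).

Lemma fills3 m a b c : sideb (clo m kX) (chi m kX) (P kX) a ->
  sideb (clo m kY) (chi m kY) (P kY) b -> sideb (clo m kZ) (chi m kZ) (P kZ) c ->
  fills m (sgn a b c).
Proof. by move=> ha hb hc; apply: ord3_ind. Qed.

Lemma fills_ext m s s' : s =1 s' -> fills m s -> fills m s'.
Proof. by move=> e h k; have := h k; rewrite e. Qed.

Lemma tieX b c m m' : fills m (sgn true b c) -> fills m' (sgn false b c) -> m <> m' ->
  val m kX true = val m' kX false.
Proof.
by move=> hm hm'; apply: (h1 (s := sgn true b c)) => //; apply: fills_ext hm'; apply: ord3_ind.
Qed.

Lemma tieY a c m m' : fills m (sgn a true c) -> fills m' (sgn a false c) -> m <> m' ->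
  val m kY true = val m' kY false.
Proof.
by move=> hm hm'; apply: (h1 (s := sgn a true c)) => //; apply: fills_ext hm'; apply: ord3_ind.
Qed.

Lemma tieZ a b m m' : fills m (sgn a b true) -> fills m' (sgn a b false) -> m <> m' ->
  val m kZ true = val m' kZ false.
Proof.
by move=> hm hm'; apply: (h1 (s := sgn a b true)) => //; apply: fills_ext hm'; apply: ord3_ind.
Qed.

Lemma tieXb b c m m' (o : bool) : fills m (sgn o b c) -> fills m' (sgn (~~ o) b c) -> m <> m' ->
  val m kX o = val m' kX (~~ o).
Proof.
case: o => /= hm hm' ne; first exact: tieX hm hm' ne.
by apply/esym; apply: tieX hm' hm _ => e; apply: ne.
Qed.

Lemma tieYb a c m m' (o : bool) : fills m (sgn a o c) -> fills m' (sgn a (~~ o) c) -> m <> m' ->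
  val m kY o = val m' kY (~~ o).
Proof.
case: o => /= hm hm' ne; first exact: tieY hm hm' ne.
by apply/esym; apply: tieY hm' hm _ => e; apply: ne.
Qed.

Lemma block_wf (m : T) k : clo m k < chi m k <= dims p r k.
Proof. by rewrite /bclo /bchi; apply: shape_wf => //; exact: sh_valid. Qed.

Lemma rigid_boundary k : P k = 0 \/ P k = dims p r k ->
  exists v, forall m, adj m -> (clo m k = P k -> val m k false = v) /\ (chi m k = P k -> val m k true = v).
Proof.
move=> hk; exists (bd k) => m am.
(* An octant at the point that [m] fills, chosen so that the hypotheses on boundary faces apply to
   it. *)
have fm : fills m (fun l => P l == chi m l).
  by move=> l; have := am l; have := block_wf m l; case: eqP; lia.
have := block_wf m k => wk.
split=> e.
  by apply: h3 fm _; [rewrite -e; lia|lia].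
by apply: h2 fm _; [rewrite -e|lia].
Qed.

Let PX := PD kX. Let PY := PD kY. Let PZ := PD kZ.

(** The strip of the lower layer with a face in the plane x = [P kX]. It spans the host in the
    direction y, so the other faces in this plane can be tied to it. *)
Lemma hubA : exists t : T, sh t = Ab (P kX)./2.
Proof. by apply: sh_surj => //=; move: PX; rewrite /dims /tri /=; lia. Qed.

Lemma hubB : exists t : T, sh t = Bb (P kY)./2.
Proof. by apply: sh_surj => //=; move: PY; rewrite /dims /tri /=; lia. Qed.

Local Notation ox := (odd (P kX)).
Local Notation oy := (odd (P kY)).

Lemma fillsA t a b : sh t = Ab (P kX)./2 -> (if b then 0 < P kY else P kY < (2 * r).+1) ->
  sideb 0 1 (P kZ) a -> fills t (sgn ox b a).
Proof.
move=> e hb ha; move: PX PY; rewrite /dims /tri /= => ? ?.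
apply: fills3; rewrite /sideb /bclo /bchi e /= /tri /= //.
  by case: ifP; lia.
by move: hb; case: b; lia.
Qed.

Lemma fillsB t a b : sh t = Bb (P kY)./2 -> (if b then 0 < P kX else P kX < (2 * p).+1) ->
  sideb 1 2 (P kZ) a -> fills t (sgn b oy a).
Proof.
move=> e hb ha; move: PX PY; rewrite /dims /tri /= => ? ?.
apply: fills3; rewrite /sideb /bclo /bchi e /= /tri /= //.
  by move: hb; case: b; lia.
by case: ifP; lia.
Qed.

Lemma fillsN1 t x i0 a : sh t = N1 x i0 -> adj t -> sideb 0 1 (P kZ) a ->
  [/\ fills t (sgn (~~ ox) oy a), if ~~ ox then 0 < P kX else P kX < (2 * p).+1 &
      if oy then 0 < P kY else P kY < (2 * r).+1].
Proof.
move=> e at_ ha; have := sh_valid t; rewrite e /= => /andP[xp _].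
have := at_ kX; have := at_ kY; rewrite /bclo /bchi e /= /tri /= => aY aX.
move: PX PY; rewrite /dims /tri /= => ? ?.
split; last 2 first.
- by case: ifP; lia.
- by case: ifP; lia.
apply: fills3; rewrite /sideb /bclo /bchi e /= /tri /= //.
  by case: ifP; lia.
by case: ifP; lia.
Qed.

Lemma fillsN2 t i x0 a : sh t = N2 i x0 -> adj t -> sideb 1 2 (P kZ) a ->
  [/\ fills t (sgn ox (~~ oy) a), if ox then 0 < P kX else P kX < (2 * p).+1 &
      if ~~ oy then 0 < P kY else P kY < (2 * r).+1].
Proof.
move=> e at_ ha; have := sh_valid t; rewrite e /= => /andP[ir _].
have := at_ kX; have := at_ kY; rewrite /bclo /bchi e /= /tri /= => aY aX.
move: PX PY; rewrite /dims /tri /= => ? ?.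
split; last 2 first.
- by case: ifP; lia.
- by case: ifP; lia.
apply: fills3; rewrite /sideb /bclo /bchi e /= /tri /= //.
  by case: ifP; lia.
by case: ifP; lia.
Qed.

Lemma fillsF t x i a : sh t = Fb x i -> (2 * x).+1 <= P kX <= (2 * x).+2 ->
  (2 * i).+1 <= P kY <= (2 * i).+2 -> sideb 0 2 (P kZ) a ->
  [/\ fills t (sgn (~~ ox) (~~ oy) a), if ~~ ox then 0 < P kX else P kX < (2 * p).+1 &
      if ~~ oy then 0 < P kY else P kY < (2 * r).+1].
Proof.
move=> e aX aY ha; have := sh_valid t; rewrite e /= => v; have := Sp v; have := Sr v => ? ?.
move: PX PY; rewrite /dims /tri /= => ? ?.
split; last 2 first.
- by case: ifP; lia.
- by case: ifP; lia.
apply: fills3; rewrite /sideb /bclo /bchi e /= /tri /= //.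
  by case: ifP; lia.
by case: ifP; lia.
Qed.

(** The strips of the two layers overlap at the point and are tied to each other; a column piece
    there lies under the strip [tB], and a row piece over the strip [tA]. *)
Lemma rigidZ : P kZ = 1 -> exists v, forall m, adj m ->
  (clo m kZ = P kZ -> val m kZ false = v) /\ (chi m kZ = P kZ -> val m kZ true = v).
Proof.
move=> z1; have [tA eA] := hubA; have [tB eB] := hubB.
move: (PX) (PY); rewrite /dims /tri /= => ? ?.
have AB : val tA kZ true = val tB kZ false.
  apply: (tieZ (a := ox) (b := oy)); last by move=> e; rewrite -e eA in eB.
    by apply: fillsA => //; rewrite ?z1 //; case: ifP; lia.
  by apply: fillsB => //; rewrite ?z1 //; case: ifP; lia.
exists (val tA kZ true) => m am; rewrite /bclo /bchi z1.
case E: (sh m) => [x i|x i0|i x0|j|j] /=; rewrite /tri /=; split=> // _.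
- have [|f1 f2 f3] := @fillsN1 m x i0 true E am; first by rewrite z1.
  rewrite AB; apply: (tieZ f1); last by move=> e; rewrite -e E in eB.
  by apply: fillsB => //; rewrite z1.
- have [|f1 f2 f3] := @fillsN2 m i x0 false E am; first by rewrite z1.
  apply/esym; apply: (tieZ _ f1); last by move=> e; rewrite -e eA in E.
  by apply: fillsA => //; rewrite z1.
- have := am kX; rewrite /bclo /bchi E /= /tri /= => aX.
  have ej : j = (P kX)./2 by lia.
  by rewrite (sh_inj (etrans E (etrans (congr1 Ab ej) (esym eA)))).
- have := am kY; rewrite /bclo /bchi E /= /tri /= => aY.
  have ej : j = (P kY)./2 by lia.
  by rewrite (sh_inj (etrans E (etrans (congr1 Bb ej) (esym eB)))).
Qed.

(* The cell of the grid in an odd column and an odd row next to [P]. *)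
Local Notation xx := ((P kX).-1)./2.
Local Notation ii := ((P kY).-1)./2.

(** Column pieces and cells are tied to the strip [tA] directly, row pieces through the cell at
    their end. On the top of the host the strip is not adjacent; there the cell in column [xx] and
    row [ii], if present, takes over as the reference. *)
Lemma rigidX : 0 < P kX < (2 * p).+1 -> exists v, forall m, adj m ->
  (clo m kX = P kX -> val m kX false = v) /\ (chi m kX = P kX -> val m kX true = v).
Proof.
move=> xin; have [tA eA] := hubA.
move: (PX) (PY) (PZ); rewrite /dims /tri /= => ? ? ?.
have N2F m i x0 : sh m = N2 i x0 -> adj m ->
    (slo (N2 i x0) kX = P kX \/ shi p r S (N2 i x0) kX = P kX) ->
    exists2 f : T, sh f = Fb xx i & S xx i /\ val m kX ox = val f kX (~~ ox).
  move=> E am hx.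
  have := am kX; have := am kY; have := am kZ; rewrite /bclo /bchi E /= /tri /= => aZ aY aX.
  have /andP[ir st] : (i < r) && start (S^~ i) x0 by have := sh_valid m; rewrite E.
  have s : S xx i.
    case: hx => /=; rewrite /tri /= => e.
      have -> : xx = x0.-1 by lia.
      by case/orP: st => // /eqP; lia.
    have -> : xx = nxtX p S i x0 by lia.
    apply: (nxt_s (s := S^~ i)); last by rewrite -/(nxtX p S i x0); lia.
    by apply: (start_le (s := S^~ i)) st => y; apply: Sp.
  have [f ef] := sh_surj Sp Sr (s : valid p r S (Fb xx i)).
  exists f => //; split=> //.
  have xb : (2 * xx).+1 <= P kX <= (2 * xx).+2.
    by case: hx => /=; rewrite /tri /=; lia.
  have sz : sideb 1 2 (P kZ) (P kZ == 2) by rewrite /sideb; case: eqP; lia.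
  have sz' : sideb 0 2 (P kZ) (P kZ == 2) by rewrite /sideb; case: eqP; lia.
  have [f1 _ _] := fillsN2 E am sz; have [f2 _ _] := fillsF ef xb aY sz'.
  by apply: tieXb f1 f2 _ => e; rewrite e ef in E.
have FA f i : sh f = Fb xx i -> (2 * xx).+1 <= P kX <= (2 * xx).+2 ->
    (2 * i).+1 <= P kY <= (2 * i).+2 -> P kZ <= 1 -> val tA kX ox = val f kX (~~ ox).
  move=> ef xb yb z1.
  have sz : sideb 0 2 (P kZ) (P kZ == 1) by rewrite /sideb; case: eqP; lia.
  have sz' : sideb 0 1 (P kZ) (P kZ == 1) by rewrite /sideb; case: eqP; lia.
  have [f1 _ hy] := fillsF ef xb yb sz.
  by apply: tieXb (fillsA eA hy sz') f1 _ => e; rewrite -e eA in ef.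
have [v [vA vF]] : exists v, (P kZ <= 1 -> v = val tA kX ox) /\
    (1 < P kZ -> forall f, sh f = Fb xx ii -> v = val f kX (~~ ox)).
  case: (leqP (P kZ) 1) => z1; first by exists (val tA kX ox).
  case: (boolP (S xx ii)) => s.
    have [f ef] := sh_surj Sp Sr (s : valid p r S (Fb xx ii)).
    exists (val f kX (~~ ox)); split=> // _ f' ef'.
    by rewrite (sh_inj (etrans ef' (esym ef))).
  by exists (val tA kX ox); split=> // _ f ef; have := sh_valid f; rewrite ef /= (negbTE s).
have vF' f i : sh f = Fb xx i -> (2 * xx).+1 <= P kX <= (2 * xx).+2 ->
    (2 * i).+1 <= P kY <= (2 * i).+2 -> v = val f kX (~~ ox).
  move=> ef xb yb; case: (leqP (P kZ) 1) => z1; first by rewrite vA // (FA f i).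
  by apply: vF => //; have -> : ii = i by lia.
exists v => m am.
have := am kX; have := am kY; have := am kZ.
rewrite /bclo /bchi; case E: (sh m) => [x i|x i0|i x0|j|j] /=; rewrite /tri /= => aZ aY aX.
- have ex : x = xx by lia.
  have := @vF' m i; rewrite -ex => /(_ E aX aY) ->.
  by split=> e; [have -> : ox = true by lia|have -> : ox = false by lia].
- have sz : sideb 0 1 (P kZ) (P kZ == 1) by rewrite /sideb; case: eqP; lia.
  have [f1 hx hy] := fillsN1 E am sz.
  have t : val tA kX ox = val m kX (~~ ox).
    by apply: tieXb (fillsA eA hy sz) f1 _ => e; rewrite -e eA in E.
  rewrite vA; last by lia.
  by rewrite t; split=> e; [have -> : ox = true by lia|have -> : ox = false by lia].
- split=> e.
    have [f ef [_ t]] := N2F m i x0 E am (or_introl e).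
    have eo : ox = false by lia.
    by move: t; rewrite eo => ->; rewrite (vF' f i) // ?eo //; lia.
  have [f ef [_ t]] := N2F m i x0 E am (or_intror e).
  have eo : ox = true by lia.
  by move: t; rewrite eo => ->; rewrite (vF' f i) // ?eo //; lia.
- have ej : j = (P kX)./2 by lia.
  have -> : m = tA by apply: sh_inj; rewrite E eA ej.
  rewrite vA; last by lia.
  by split=> e; [have -> : ox = false by lia|have -> : ox = true by lia].
- by split; lia.
Qed.

(** The mirror image of [rigidX] with the layers exchanged: the strip [tB] is the reference, except
    on the bottom of the host. *)
Lemma rigidY : 0 < P kY < (2 * r).+1 -> exists v, forall m, adj m ->
  (clo m kY = P kY -> val m kY false = v) /\ (chi m kY = P kY -> val m kY true = v).
Proof.
move=> yin; have [tB eB] := hubB.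
move: (PX) (PY) (PZ); rewrite /dims /tri /= => ? ? ?.
have N1F m x i0 : sh m = N1 x i0 -> adj m ->
    (slo (N1 x i0) kY = P kY \/ shi p r S (N1 x i0) kY = P kY) ->
    exists2 f : T, sh f = Fb x ii & S x ii /\ val m kY oy = val f kY (~~ oy).
  move=> E am hy.
  have := am kX; have := am kY; have := am kZ; rewrite /bclo /bchi E /= /tri /= => aZ aY aX.
  have /andP[xp st] : (x < p) && start (S x) i0 by have := sh_valid m; rewrite E.
  have s : S x ii.
    case: hy => /=; rewrite /tri /= => e.
      have -> : ii = i0.-1 by lia.
      by case/orP: st => // /eqP; lia.
    have -> : ii = nxtY r S x i0 by lia.
    apply: (nxt_s (s := S x)); last by rewrite -/(nxtY r S x i0); lia.
    by apply: (start_le (s := S x)) st => y; apply: Sr.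
  have [f ef] := sh_surj Sp Sr (s : valid p r S (Fb x ii)).
  exists f => //; split=> //.
  have yb : (2 * ii).+1 <= P kY <= (2 * ii).+2.
    by case: hy => /=; rewrite /tri /=; lia.
  have sz : sideb 0 1 (P kZ) (P kZ == 1) by rewrite /sideb; case: eqP; lia.
  have sz' : sideb 0 2 (P kZ) (P kZ == 1) by rewrite /sideb; case: eqP; lia.
  have [f1 _ _] := fillsN1 E am sz; have [f2 _ _] := fillsF ef aX yb sz'.
  by apply: tieYb f1 f2 _ => e; rewrite e ef in E.
have FB f x : sh f = Fb x ii -> (2 * x).+1 <= P kX <= (2 * x).+2 ->
    (2 * ii).+1 <= P kY <= (2 * ii).+2 -> 0 < P kZ -> val tB kY oy = val f kY (~~ oy).
  move=> ef xb yb z1.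
  have sz : sideb 0 2 (P kZ) (P kZ == 2) by rewrite /sideb; case: eqP; lia.
  have sz' : sideb 1 2 (P kZ) (P kZ == 2) by rewrite /sideb; case: eqP; lia.
  have [f1 hx _] := fillsF ef xb yb sz.
  by apply: tieYb (fillsB eB hx sz') f1 _ => e; rewrite -e eB in ef.
have [v [vB vF]] : exists v, (0 < P kZ -> v = val tB kY oy) /\
    (P kZ = 0 -> forall f, sh f = Fb xx ii -> v = val f kY (~~ oy)).
  case: (posnP (P kZ)) => z1; last by exists (val tB kY oy); split=> // e; lia.
  case: (boolP (S xx ii)) => s.
    have [f ef] := sh_surj Sp Sr (s : valid p r S (Fb xx ii)).
    exists (val f kY (~~ oy)); split=> [|_ f' ef']; first by lia.
    by rewrite (sh_inj (etrans ef' (esym ef))).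
  exists (val tB kY oy); split=> // _ f ef.
  by have := sh_valid f; rewrite ef /= (negbTE s).
have vF' f x : sh f = Fb x ii -> (2 * x).+1 <= P kX <= (2 * x).+2 ->
    (2 * ii).+1 <= P kY <= (2 * ii).+2 -> v = val f kY (~~ oy).
  move=> ef xb yb; case: (posnP (P kZ)) => z1; last by rewrite vB // (FB f x).
  by apply: vF => //; have -> : xx = x by lia.
exists v => m am.
have := am kX; have := am kY; have := am kZ.
rewrite /bclo /bchi; case E: (sh m) => [x i|x i0|i x0|j|j] /=; rewrite /tri /= => aZ aY aX.
- have ei : i = ii by lia.
  have := @vF' m x; rewrite -ei => /(_ E aX aY) ->.
  by split=> e; [have -> : oy = true by lia|have -> : oy = false by lia].
- split=> e.
    have [f ef [_ t]] := N1F m x i0 E am (or_introl e).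
    have eo : oy = false by lia.
    by move: t; rewrite eo => ->; rewrite (vF' f x) // ?eo //; lia.
  have [f ef [_ t]] := N1F m x i0 E am (or_intror e).
  have eo : oy = true by lia.
  by move: t; rewrite eo => ->; rewrite (vF' f x) // ?eo //; lia.
- have sz : sideb 1 2 (P kZ) (P kZ == 2) by rewrite /sideb; case: eqP; lia.
  have [f1 hx hy] := fillsN2 E am sz.
  have t : val tB kY oy = val m kY (~~ oy).
    by apply: tieYb (fillsB eB hx sz) f1 _ => e; rewrite -e eB in E.
  rewrite vB; last by lia.
  by rewrite t; split=> e; [have -> : oy = true by lia|have -> : oy = false by lia].
- by split; lia.
- have ej : j = (P kY)./2 by lia.
  have -> : m = tB by apply: sh_inj; rewrite E eB ej.
  rewrite vB; last by lia.
  by split=> e; [have -> : oy = false by lia|have -> : oy = true by lia].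
Qed.

End RigidPlan.

Lemma plan_rigid p r (S : nat -> nat -> bool) (P : 'I_3 -> nat) (A : Type) (bd : 'I_3 -> A) :
  (forall x i, S x i -> x < p) -> (forall x i, S x i -> i < r) ->
  (exists m, forall k, P k = @bclo p r S m k \/ P k = @bchi p r S m k) ->
  rigid (dims p r) (@bclo p r S) (@bchi p r S) P bd.
Proof.
move=> Sp Sr [m0 hm0] val h1 h2 h3.
have PD k : P k <= dims p r k by have := block_wf Sp Sr m0 k; case: (hm0 k) => ->; lia.
have bnd := rigid_boundary Sp Sr h2 h3.
apply: ord3_ind.
- case: (posnP (P kX)) => [z|z]; first by apply: bnd; left.
  case: (ltnP (P kX) (2 * p).+1) => z'; first by apply: (rigidX Sp Sr PD h1); rewrite z.
  by apply: bnd; right; have := PD kX; rewrite /dims /tri /=; lia.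
- case: (posnP (P kY)) => [z|z]; first by apply: bnd; left.
  case: (ltnP (P kY) (2 * r).+1) => z'; first by apply: (rigidY Sp Sr PD h1); rewrite z.
  by apply: bnd; right; have := PD kY; rewrite /dims /tri /=; lia.
- case: (posnP (P kZ)) => [z|z]; first by apply: bnd; left.
  case: (eqVneq (P kZ) 1) => z'; first exact: (rigidZ Sp Sr PD h1 z').
  by apply: bnd; right; have := PD kZ; rewrite /dims /tri /=; lia.
Qed.

(** * Reading the columns off the dissection graph *)

Section Walls.
Variables (p r : nat) (S : nat -> nat -> bool).
Hypothesis Sp : forall x i, S x i -> x < p.
Hypothesis Sr : forall x i, S x i -> i < r.

Local Notation T := (blockT p r S).
Local Notation clo := (@bclo p r S).
Local Notation chi := (@bchi p r S).

Definition fcoord (f : T * bool) (k : 'I_3) : nat := if f.2 then chi f.1 k else clo f.1 k.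

Definition natt (f g : T * bool) : Prop :=
  [/\ fcoord f kX = fcoord g kX, clo f.1 kY < chi g.1 kY /\ clo g.1 kY < chi f.1 kY &
      clo f.1 kZ < chi g.1 kZ /\ clo g.1 kZ < chi f.1 kZ].

(** Column pieces and cells are attached to the strip [tA]; a row piece is linked to it through the
    cell at its end. Hence each interior coordinate carries exactly one dissection plane. *)
Lemma wall_hub c (tA : T) (f : T * bool) : 0 < c < (2 * p).+1 -> sh tA = Ab c./2 ->
  fcoord f kX = c -> rst natt f (tA, odd c).
Proof.
move=> hc eA; case: f => m b; rewrite /fcoord /=.
have cA : fcoord (tA, odd c) kX = c.
  by rewrite /fcoord /bclo /bchi eA /= /tri /=; case: ifP; lia.
have hubF f x i (e : sh f = Fb x i) d : fcoord (f, d) kX = c -> natt (f, d) (tA, odd c).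
  move=> cf; split; first by rewrite cf cA.
    have := sh_valid f; rewrite e /= => /Sr; rewrite /bclo /bchi e eA /= /tri /=; lia.
  by rewrite /bclo /bchi e eA /= /tri /=.
rewrite /bclo /bchi; case E: (sh m) => [x i|x i0|i x0|j|j] /= ec.
- by apply: rst_step; apply: (hubF m x i E); rewrite /fcoord /bclo /bchi /= E /=; case: (b) ec.
- apply: rst_step; split.
  + by rewrite cA /fcoord /bclo /bchi /= E /=; case: (b) ec.
  + have := sh_valid m; rewrite E /= => /andP[_ /(nxtY_le Sr)].
    by rewrite /bclo /bchi E eA /= /tri /=; lia.
  + by rewrite /bclo /bchi E eA /= /tri /=.
- have /andP[ir st] : (i < r) && start (S^~ i) x0 by have := sh_valid m; rewrite E.
  have xle := nxtX_le Sp st.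
  have s : S (c.-1)./2 i.
    move: ec; rewrite /tri /=; case: (b) => e.
      have -> : (c.-1)./2 = nxtX p S i x0 by lia.
      apply: (nxt_s (s := S^~ i)); last by rewrite -/(nxtX p S i x0); lia.
      by apply: (start_le (s := S^~ i)) st => y; apply: Sp.
    have -> : (c.-1)./2 = x0.-1 by lia.
    by case/orP: st => // /eqP; lia.
  have [f ef] := sh_surj Sp Sr (s : valid p r S (Fb (c.-1)./2 i)).
  have cf : fcoord (f, ~~ odd c) kX = c.
    by rewrite /fcoord /bclo /bchi ef /= /tri /=; case: ifP; lia.
  apply: (rst_trans _ _ _ (f, ~~ odd c)); last by apply: rst_step; apply: (hubF f _ _ ef).
  apply: rst_step; split.
  + by rewrite cf /fcoord /bclo /bchi /= E /=; case: (b) ec.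
  + by rewrite /bclo /bchi E ef /= /tri /=; lia.
  + by rewrite /bclo /bchi E ef /= /tri /=.
- move: ec; rewrite /tri /= => ec.
  have ej : j = c./2 by case: (b) ec; lia.
  have em : m = tA by apply: sh_inj; rewrite E eA ej.
  have eb : b = odd c by case: (b) ec; lia.
  by rewrite em eb; apply: rst_refl.
- by move: ec; rewrite /tri /=; case: (b); lia.
Qed.

(** These blocks form a directed path through the interior planes, which fixes the order of the
    planes in the graph. *)
Lemma unit_block c : 0 < c < 2 * p -> exists t : T, clo t kX = c /\ chi t kX = c.+1.
Proof.
move=> hc; case: (boolP (odd c)) => oc.
  have [|t e] := sh_surj Sp Sr (b := N1 c./2 0); first by rewrite /= andbT; lia.
  by exists t; rewrite /bclo /bchi e /= /tri /=; lia.
have [|t e] := sh_surj Sp Sr (b := Ab c./2); first by rewrite /=; lia.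
by exists t; rewrite /bclo /bchi e /= /tri /=; lia.
Qed.

Lemma block_from c : 0 < c < (2 * p).+1 -> exists t : T, clo t kX = c.
Proof.
move=> hc; case: (boolP (odd c)) => oc.
  have [|t e] := sh_surj Sp Sr (b := N1 c./2 0); first by rewrite /= andbT; lia.
  by exists t; rewrite /bclo /bchi e /= /tri /=; lia.
have [|t e] := sh_surj Sp Sr (b := Ab c./2); first by rewrite /=; lia.
by exists t; rewrite /bclo /bchi e /= /tri /=; lia.
Qed.

Lemma block_to c : 0 < c < (2 * p).+1 -> exists t : T, chi t kX = c.
Proof.
move=> hc; case: (boolP (odd c)) => oc.
  have [|t e] := sh_surj Sp Sr (b := Ab c./2); first by rewrite /=; lia.
  by exists t; rewrite /bclo /bchi e /= /tri /=; lia.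
have [|t e] := sh_surj Sp Sr (b := N1 (c./2).-1 0); first by rewrite /= andbT; lia.
by exists t; rewrite /bclo /bchi e /= /tri /=; lia.
Qed.

Lemma hub_ex c : c <= (2 * p).+1 -> exists t : T, sh t = Ab c./2.
Proof. by move=> hc; apply: sh_surj => //=; lia. Qed.

Definition joined (a b : nat) : Prop := exists t : T, clo t kX = a /\ chi t kX = b.

Definition follows (x x' : nat) : Prop := exists2 i, S x i & nxtX p S i x.+1 = x'.

Lemma follows_joined x x' : x' < p -> follows x x' -> joined (2 * x).+2 (2 * x').+1.
Proof.
move=> hx' [i si e].
have [|t et] := sh_surj Sp Sr (b := N2 i x.+1); first by rewrite /= (Sr si) /start /= si.
by exists t; rewrite /bclo /bchi et /= /tri /= e; lia.
Qed.

(** The strip between columns [x] and [x.+1] always joins them, whence the first alternative. *)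
Lemma joined_follows x x' : x' < p -> joined (2 * x).+2 (2 * x').+1 -> x' = x.+1 \/ follows x x'.
Proof.
move=> hx' [t []]; have := sh_valid t; rewrite /bclo /bchi.
case: (sh t) => [y i|y i0|i x0|j|j] /=; rewrite /tri /= => v e1 e2; try lia.
have ex : x0 = x.+1 by lia.
right; exists i; last by rewrite -ex; lia.
by case/andP: v => _; rewrite /start ex.
Qed.

End Walls.

(** Counting from either end leaves no slack: [tau j] is at least [j] and at most [j]. *)
Lemma increasing_id (N : nat) (tau : nat -> nat) :
  (forall j, 0 < j <= N -> 0 < tau j <= N) ->
  (forall j, 0 < j < N -> tau j < tau j.+1) ->
  forall j, 0 < j <= N -> tau j = j.
Proof.
move=> bd inc.
have ge j : 0 < j <= N -> j <= tau j.
  elim: j => // j IH hj; case: (posnP j) => [->|j0]; first by have := bd 1; lia.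
  by have := IH; have := inc j; lia.
have le m j : m + j = N -> 0 < j -> tau j + m <= N.
  elim: m j => [|m IH] j e j0; first by have := bd j; lia.
  by have := IH j.+1; have := inc j; lia.
by move=> j hj; have := ge j hj; have := le (N - j) j; lia.
Qed.

(** * A large family of cell sets *)

Lemma mixed_inj w g g' x x' : x < w -> x' < w -> g * w + x = g' * w + x' -> g = g' /\ x = x'.
Proof.
move=> hx hx' e; have key a b y y' : y < w -> a * w + y = b * w + y' -> b <= a.
  by move=> hy e'; rewrite leqNgt; apply/negP => lt; have := leq_mul2r w a.+1 b; rewrite lt; nia.
have le1 := key _ _ _ _ hx e; have le2 := key _ _ _ _ hx' (esym e).
have eg : g = g' by lia.
by subst g'; split=> //; lia.
Qed.

Lemma nxt_eq (s : pred nat) N i0 j : i0 <= j < N -> s j -> (forall i, i0 <= i < j -> ~~ s i) ->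
  nxt s N i0 = j.
Proof.
move=> hj sj mn; have le := nxt_le s (N := N) (i0 := i0).
have lej : nxt s N i0 <= j.
  rewrite leqNgt; apply/negP => lt.
  by have := @nxt_min s N i0 j; rewrite sj => /(_ _)/negP; apply; lia.
case: (ltngtP (nxt s N i0) j) => // lt; last by lia.
have := nxt_s (s := s) (N := N) (i0 := i0) => /(_ _ _) h.
by have := mn (nxt s N i0); rewrite h; lia.
Qed.

Section Family.
Variables (w1 q2 a : nat) (bb : bool).
Local Notation w := w1.+1.
Local Notation q := q2.+2.

Definition famT : finType := {ffun 'I_q2.+1 * 'I_q2.+2 -> 'S_w1.+1}.

(** The [a] empty columns and, if [bb] holds, one column with a single cell contribute 2a + 5bb
    blocks, so that every large number of blocks is attained. *)
Definition pcols : nat := w * q + a + bb.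
Definition prows : nat := w * q.

Section One.
Variable F : famT.

(** [F] holds the permutations of the groups from 1 on. Group 0 gets the identity, from which the
    other groups are recovered one after the other. *)
Definition cperm (g : nat) (b : nat) : 'S_w1.+1 :=
  if g is g'.+1 then F (inord g', inord b) else 1%g.

Definition cval (g b x : nat) : nat := cperm g b (inord x).

Lemma cval_lt g b x : cval g b x < w. Proof. exact: ltn_ord. Qed.

(* The row [b * w + x] meets the group [g] of [w] columns in the column
   [g * w + cval g b x]; the column [w * q + a] is used for padding only. *)
Definition famS (x i : nat) : bool :=
  [exists u : 'I_q * 'I_q * 'I_w,
     (x == u.1.1 * w + cval u.1.1 u.1.2 u.2) && (i == u.1.2 * w + u.2)]
  || [&& bb, x == w * q + a & i == 0].

Lemma famSP x i : famS x i <->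
  (exists g b y, [/\ g < q, b < q, y < w, x = g * w + cval g b y & i = b * w + y]) \/
  [/\ bb, x = w * q + a & i = 0].
Proof.
split.
  case/orP => [/existsP[[[g b] y] /= /andP[/eqP ex /eqP ei]]|/and3P[? /eqP ? /eqP ?]].
    by left; exists g, b, y; split.
  by right.
case=> [[g [b [y [hg hb hy ex ei]]]]|[h1 -> ->]]; apply/orP; last by right; rewrite h1 !eqxx.
left; apply/existsP; exists (Ordinal hg, Ordinal hb, Ordinal hy) => /=.
by rewrite -ex -ei !eqxx.
Qed.

Lemma group_lt g x : g < q -> x < w -> g * w + x < w * q.
Proof. by move=> hg hx; have := leq_mul2r w g.+1 q; rewrite hg; nia. Qed.

Lemma famS_p x i : famS x i -> x < pcols.
Proof.
rewrite /pcols => /famSP [[g [b [y [hg hb hy -> _]]]]|[-> -> _]]; last by lia.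
by have := group_lt hg (cval_lt g b y); lia.
Qed.

Lemma famS_r x i : famS x i -> i < prows.
Proof.
rewrite /prows => /famSP [[g [b [y [hg hb hy _ ->]]]]|[_ _ ->]]; last by lia.
exact: group_lt.
Qed.

Lemma famS_row g b y : g < q -> b < q -> y < w -> famS (g * w + cval g b y) (b * w + y).
Proof. by move=> hg hb hy; apply/famSP; left; exists g, b, y. Qed.

Lemma famS_row_inv x b y : x < w * q -> b < q -> y < w -> famS x (b * w + y) ->
  exists2 g, g < q & x = g * w + cval g b y.
Proof.
move=> hx hb hy /famSP [[g [b' [y' [hg hb' hy' ex ei]]]]|[_ ex _]]; last by lia.
by have [eb ey] := mixed_inj hy hy' ei; subst; exists g.
Qed.

Lemma card_famS : #|[pred c : 'I_pcols * 'I_prows | famS c.1 c.2]| = w * q * q + bb.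
Proof.
have hp g b y : g < q -> g * w + cval g b y < pcols.
  by move=> hg; have := group_lt hg (cval_lt g b y); rewrite /pcols; lia.
have hpad (k : 'I_bb) : w * q + a < pcols.
  by have := ltn_ord k; rewrite /pcols; lia.
pose f (u : 'I_q * 'I_q * 'I_w + 'I_bb) : 'I_pcols * 'I_prows :=
  match u with
  | inl (g, b, y) => (Ordinal (hp g b y (ltn_ord g)), Ordinal (group_lt (ltn_ord b) (ltn_ord y)))
  | inr k => (Ordinal (hpad k), Ordinal (isT : 0 < prows))
  end.
have finj : injective f.
  case=> [[[g b] y]|k] [[[g' b'] y']|k'] /=.
  - case=> ex ei; have [/val_inj eb /val_inj ey] := mixed_inj (ltn_ord y) (ltn_ord y') ei.
    by subst; have [/val_inj -> _] := mixed_inj (cval_lt _ _ _) (cval_lt _ _ _) ex.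
  - by case=> ex _; have := group_lt (ltn_ord g) (cval_lt g b y); lia.
  - by case=> ex _; have := group_lt (ltn_ord g') (cval_lt g' b' y'); lia.
  - move=> _; congr inr; apply/val_inj => /=.
    by have := ltn_ord k; have := ltn_ord k'; have := leq_b1 bb; lia.
rewrite -[LHS](_ : #|codom f| = _); last first.
  apply: eq_card => -[x i]; rewrite inE /=; apply/codomP/idP.
    move=> [[[[g b] y]|k] [-> ->]] /=; first exact: famS_row.
    have hb : 0 < bb by have := ltn_ord k; lia.
    by apply/famSP; right; split=> //; rewrite lt0b in hb.
  move=> /famSP [[g [b [y [hg hb hy ex ei]]]]|[hb ex ei]].
    exists (inl (Ordinal hg, Ordinal hb, Ordinal hy)) => /=.
    by congr pair; apply/val_inj.
  have h0 : 0 < bb by rewrite hb.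
  by exists (inr (Ordinal h0)); congr pair; apply/val_inj.
by rewrite card_codom // card_sum !card_prod !card_ord; lia.
Qed.

Lemma card_fam_blocks : #|blockT pcols prows famS| = 3 * (w * q * q + bb) + 2 * pcols + 2 * prows + 2.
Proof. by rewrite card_blockT card_famS. Qed.

(** Every row has exactly one cell in each group, so the cell after the one in group [g] is the one
    in group [g.+1]. *)
Lemma next_col g b y : g.+1 < q -> b < q -> y < w ->
  nxtX pcols famS (b * w + y) (g * w + cval g b y).+1 = g.+1 * w + cval g.+1 b y.
Proof.
move=> hg hb hy.
have l1 := cval_lt g b y; have l2 := cval_lt g.+1 b y.
have lt := group_lt hg l2.
apply: nxt_eq; first by rewrite /pcols; lia.
  exact: famS_row.
move=> x hx; apply/negP => sx.
have xq : x < w * q by lia.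
have [g' hg' ex] := famS_row_inv xq hb hy sx.
have l3 := cval_lt g' b y.
case: (ltngtP g' g) => cmp; last by subst g'; lia.
  by have := leq_mul2r w g'.+1 g; rewrite cmp; nia.
case: (eqVneq g' g.+1) => [e|ne]; first by rewrite e in ex; lia.
have h : g.+2 <= g' by lia.
by have := leq_mul2r w g.+2 g'; rewrite h; nia.
Qed.

Lemma fam_follows g b y : g.+1 < q -> b < q -> y < w ->
  follows pcols famS (g * w + cval g b y) (g.+1 * w + cval g.+1 b y).
Proof.
move=> hg hb hy; exists (b * w + y); last exact: next_col.
by apply: famS_row => //; lia.
Qed.

Definition joinedb (c d : nat) : bool :=
  [exists t : blockT pcols prows famS, (bclo t kX == c) && (bchi t kX == d)].

Lemma joinedP c d : reflect (joined pcols prows famS c d) (joinedb c d).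
Proof.
apply: (iffP existsP) => [[t /andP[/eqP ? /eqP ?]]|[t [? ?]]]; exists t => //.
by apply/andP; split; apply/eqP.
Qed.

(* Besides the at most [q] successors of [x] in the [q] bands of rows, this contains
   the column adjacent to [x] in the grid, hence the bound [q.+1] below. *)
Definition out_cols (g x : nat) : pred 'I_w :=
  fun x' => joinedb (2 * (g * w + x)).+2 (2 * (g.+1 * w + x')).+1.

Lemma out_cols_mem g b y : g.+1 < q -> b < q -> y < w ->
  out_cols g (cval g b y) (inord (cval g.+1 b y)).
Proof.
move=> hg hb hy; apply/joinedP; rewrite inordK ?cval_lt //.
apply: follows_joined; [exact: famS_p|exact: famS_r| |exact: fam_follows].
by have := group_lt hg (cval_lt g.+1 b y); rewrite /pcols; lia.
Qed.

Lemma card_out_cols g x : g.+1 < q -> x < w -> #|out_cols g x| <= q.+1.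
Proof.
move=> hg hx.
(* [Some b] stands for the successor in the row of band [b] that has a cell in column [x], found by
   inverting the permutation; [None] stands for the adjacent column of the grid, in case it belongs
   to the next group. *)
pose f (o : option 'I_q) : 'I_w := if o is Some b then
  inord (cval g.+1 b ((cperm g b)^-1%g (inord x))) else inord ((g * w + x).+1 - g.+1 * w).
apply: (@leq_trans #|codom f|); last first.
  by apply: leq_trans (leq_image_card f _) _; rewrite -[#|_|]/#|{: option 'I_q}| card_option card_ord.
apply: subset_leq_card; apply/fintype.subsetP => x'; rewrite unfold_in => /joinedP j.
have l' : g.+1 * w + x' < w * q by apply: group_lt.
have := joined_follows (p := pcols) (r := prows) (S := famS) _ j.
case; first by rewrite /pcols; lia.
  move=> e; apply/codomP; exists None; apply/val_inj => /=; rewrite inordK; lia.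
move=> [i si en]; have ir := famS_r si.
have /famSP [[g' [b [y [hg' hb hy ex ei]]]]|[_ ex _]] := si; last first.
  by have := @group_lt g x; lia.
have [eg exx] := mixed_inj hx (cval_lt _ _ _) ex; subst g' i.
move: en; rewrite exx next_col // => en.
have [_ e'] := mixed_inj (cval_lt _ _ _) (ltn_ord x') en.
apply/codomP; exists (Some (Ordinal hb)); apply/val_inj => /=.
rewrite inordK ?cval_lt // -e'.
have -> : (inord x : 'I_w) = cperm g b (inord y) by apply/val_inj; rewrite /= inordK.
by rewrite permK inordK.
Qed.

(** The graph shows the set of successors of a column but not which row leads to which. The position
    of the right successor in this set, one of at most [q.+1], is the missing information. *)
Definition famE : {ffun 'I_q2.+1 * 'I_q2.+2 * 'I_w1.+1 -> 'I_q2.+4} :=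
  [ffun u : 'I_q2.+1 * 'I_q2.+2 * 'I_w1.+1 => inord (index (inord (cval u.1.1.+1 u.1.2 u.2) : 'I_w)
                          (enum (out_cols u.1.1 (cval u.1.1 u.1.2 u.2))))].

End One.

(** Induction on the group: once the column of a row in group [g] is known, the joined coordinates
    give its possible successors and [famE] selects the right one. *)
Lemma fam_inj (F F' : famT) :
  (forall c d, 0 < c < (2 * pcols).+1 -> 0 < d < (2 * pcols).+1 ->
     joined pcols prows (famS F) c d <-> joined pcols prows (famS F') c d) ->
  famE F = famE F' -> F = F'.
Proof.
move=> ej ee.
have key g b y : g < q -> b < q -> y < w -> cval F g b y = cval F' g b y.
  elim: g b y => [//|g IH] b y hg hb hy.
  have hg' : g < q2.+1 by [].
  have e := IH b y (ltnW hg) hb hy.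
  have outE : out_cols F g (cval F g b y) =i out_cols F' g (cval F' g b y).
    move=> x'; rewrite /in_mem /= /out_cols -e.
    have l1 : g.+1 * w + x' < w * q by apply: group_lt.
    have l2 := group_lt (ltnW hg) (cval_lt F g b y).
    apply/joinedP/joinedP => j; apply/ej => //; rewrite /pcols; lia.
  have := congr1 (fun h : {ffun 'I_q2.+1 * 'I_q2.+2 * 'I_w1.+1 -> 'I_q2.+4} =>
    nat_of_ord (h (Ordinal hg', Ordinal hb, Ordinal hy))) ee.
  rewrite /famE !ffunE /= (eq_enum outE).
  set en := enum _ => ei.
  have m1 : (inord (cval F g.+1 b y) : 'I_w) \in en.
    by rewrite mem_enum -outE; apply: out_cols_mem.
  have m2 : (inord (cval F' g.+1 b y) : 'I_w) \in en by rewrite mem_enum; apply: out_cols_mem.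
  have sz : size en < q2.+4.
    by rewrite /en -cardE; apply: (@leq_ltn_trans q.+1) => //; apply: card_out_cols => //; apply: cval_lt.
  move: ei; rewrite !inordK; first last.
  - by apply: leq_trans sz; rewrite ltnS ltnW // index_mem.
  - by apply: leq_trans sz; rewrite ltnS ltnW // index_mem.
  move=> ei; have : (inord (cval F g.+1 b y) : 'I_w) = inord (cval F' g.+1 b y).
    by rewrite -(nth_index ord0 m1) ei nth_index.
  by move=> /(congr1 val) /=; rewrite !inordK ?cval_lt.
apply/ffunP => -[g b]; apply/permP => y; apply/val_inj.
have := key g.+1 b y (ltn_ord g) (ltn_ord b) (ltn_ord y).
by rewrite /cval /= !inord_val.
Qed.

Lemma card_famT : #|famT| = (w`! ^ (q2.+1 * q))%N.
Proof. by rewrite card_ffun card_prod !card_ord card_Sn. Qed.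

End Family.

Local Open Scope classical_set_scope.
Local Open Scope ring_scope.

(** * Boxes *)

Section Boxes.
Variable R : realType.
Local Notation point := 'rV[R]_3.

Lemma ball_row (p q : point) (e : R) : ball p e q <-> forall k, `|p 0 k - q 0 k| < e.
Proof.
split=> [[_ h] k|h]; first exact: (h 0 k).
split=> [|i j]; first exact: le_lt_trans (normr_ge0 _) (h 0).
by rewrite (ord1 i); exact: (h j).
Qed.

Lemma finite_lower_bound (I : finType) (d : I -> R) : (forall k, 0 < d k) ->
  exists2 e : R, 0 < e & forall k, e <= d k.
Proof.
move=> d0; suff [e e0 h] : exists2 e : R, 0 < e & forall k, k \in enum I -> e <= d k.
  by exists e => // k; apply: h; rewrite mem_enum.
elim: (enum I) => [|a s [e e0 h]]; first by exists 1.
exists (Num.min e (d a)); first by rewrite lt_min e0 d0.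
move=> k; rewrite inE ge_min => /orP[/eqP->|/h ->//]; by rewrite lexx orbT.
Qed.

Lemma interior_boxP (B : box R) (p : point) :
  (box_set B)° p <-> forall k, lo B 0 k < p 0 k < hi B 0 k.
Proof.
split=> [|h].
  rewrite /interior => /nbhs_ballP [e /= e0 h] k.
  have h1 : box_set B (\row_j (p 0 j + e / 2)).
    apply: h; apply/ball_row => j; rewrite !mxE; rewrite ltr_norml; lra.
  have h2 : box_set B (\row_j (p 0 j - e / 2)).
    apply: h; apply/ball_row => j; rewrite !mxE; rewrite ltr_norml; lra.
  have := h1 k; have := h2 k; rewrite !mxE; lra.
have [|e e0 he] := @finite_lower_bound _ (fun k => Num.min (p 0 k - lo B 0 k) (hi B 0 k - p 0 k)).
  by move=> k; rewrite lt_min; have := h k; lra.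
apply/nbhs_ballP; exists e => //= q /ball_row bq k.
have := bq k; have := he k; rewrite le_min ltr_norml; lra.
Qed.

Lemma fills_octantP (B : box R) (p : point) (s : 'I_3 -> bool) :
  fills_octant (box_set B) p s <->
  forall k, if s k then lo B 0 k < p 0 k <= hi B 0 k else lo B 0 k <= p 0 k < hi B 0 k.
Proof.
have sgn k (x : R) : (-1) ^+ s k * x = if s k then - x else x.
  by case: (s k); rewrite ?expr1 ?expr0 ?mulN1r ?mul1r.
split=> [[d d0 h] k|h].
  have inB t : 0 < t < d -> lo B 0 k <= p 0 k + (if s k then - t else t) <= hi B 0 k.
    move=> td; have : box_set B (\row_j (p 0 j + (if s j then - t else t))).
      by apply: h => j; rewrite mxE sgn; case: (s j); lra.
    by move=> /(_ k); rewrite mxE.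
  have h1 := inB (d / 2); case: (s k) inB h1 => inB h1; apply/andP; split; try lra.
  - rewrite leNgt; apply/negP => lt.
    have [le|le] := leP d (p 0 k - hi B 0 k); first by have := h1; lra.
    by have := inB ((p 0 k - hi B 0 k) / 2); lra.
  - rewrite leNgt; apply/negP => lt.
    have [le|le] := leP d (lo B 0 k - p 0 k); first by have := h1; lra.
    by have := inB ((lo B 0 k - p 0 k) / 2); lra.
have [|e e0 he] := @finite_lower_bound _
    (fun k => if s k then p 0 k - lo B 0 k else hi B 0 k - p 0 k).
  by move=> k; have := h k; case: (s k); lra.
exists e => // q hq k; have := hq k; have := he k; have := h k; rewrite sgn.
by case: (s k); lra.
Qed.

Lemma avoid_finite (a b : R) (s : seq R) : a < b -> exists2 x, a < x < b & x \notin s.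
Proof.
move=> ab; suff [a' [b' [? ? h]]] : exists a' b', [/\ a < a', a' < b' /\ b' < b &
    forall x, x \in s -> ~ (a' < x < b')].
  exists ((a' + b') / 2); first by lra.
  by apply/negP => /h; apply; lra.
elim: s => [|c s [a' [b' [h1 [h2 h3] h]]]].
  by exists (a + (b - a) / 3), (a + 2 * (b - a) / 3); split=> //; lra.
have [le|lt] := leP c ((a' + b') / 2).
  exists ((a' + b') / 2), b'; split; [lra|lra|].
  by move=> x; rewrite inE => /orP[/eqP->|/h]; lra.
exists a', ((a' + b') / 2); split; [lra|lra|].
by move=> x; rewrite inE => /orP[/eqP->|/h]; lra.
Qed.

End Boxes.

(** * Attachment and dissection planes *)

Section Attach.
Variables (R : realType) (n : nat) (F : floor_plan R n).
Local Notation point := 'rV[R]_3.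
Local Notation B i := (block F i).

Definition side (i : 'I_n) (k : 'I_3) (b : bool) : R := (if b then hi (B i) else lo (B i)) 0 k.

Lemma lift2P (k l : 'I_3) : l != k -> l = lift k (0 : 'I_2) \/ l = lift k (1 : 'I_2).
Proof.
case: (unliftP k l) => [m ->|->]; last by rewrite eqxx.
by case: m => [[|[|m]] Hm] // _; [left|right]; congr lift; apply/val_inj.
Qed.

Definition flat_rect (k : 'I_3) (c : R) (u v : 'I_3 -> R) : set point :=
  [set p | p 0 k = c /\ forall l, l != k -> u l <= p 0 l <= v l].

Lemma area_rect (k : 'I_3) (c : R) (u v : 'I_3 -> R) :
  (0 < area k (flat_rect k c u v))%E <-> (forall l, l != k -> u l < v l).
Proof.
set l0 := lift k (0 : 'I_2); set l1 := lift k (1 : 'I_2).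
have nk0 : l0 != k by rewrite eq_sym neq_lift.
have nk1 : l1 != k by rewrite eq_sym neq_lift.
have n10 : l1 != l0 by apply/eqP => /lift_inj.
rewrite /area -/l0 -/l1.
have -> : [set (p 0 l0, p 0 l1) | p in
    flat_rect k c u v] =
    `[u l0, v l0]%classic `*` `[u l1, v l1]%classic.
  apply/seteqP; split=> [_ [p [_ hp] <-]|[x y] /=].
    by split; rewrite /= in_itv /= hp.
  rewrite !in_itv /= => -[hx hy].
  exists (\row_j (if j == k then c else if j == l0 then x else y)).
    split=> [|l nl]; rewrite mxE ?eqxx // (negbTE nl).
    by case: (lift2P nl) => ->; rewrite -/l0 -/l1 ?eqxx // (negbTE n10).
  by rewrite !mxE (negbTE nk0) (negbTE nk1) eqxx (negbTE n10).
rewrite product_measure1E; try exact: measurable_itv.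
rewrite /= !lebesgue_measure_itv /= !lte_fin; split=> [|uv].
  move=> h l /lift2P; rewrite -/l0 -/l1; move: h.
  case: ifP => h0; last by rewrite mul0e ltxx.
  case: ifP => h1; last by rewrite mule0 ltxx.
  by move=> _ [] ->.
rewrite !uv // -!EFinD -EFinM lte_fin.
by rewrite mulr_gt0 // subr_gt0 uv.
Qed.

Lemma attachedP (k : 'I_3) (i j : 'I_n) (b c : bool) :
  attached F k (i, b) (j, c) <->
  side i k b = side j k c /\
  forall l, l != k -> side i l false < side j l true /\ side j l false < side i l true.
Proof.
have lh m l : side m l false < side m l true by exact: lo_lt_hi.
have sE m l d : side m l d = (if d then hi (B m) else lo (B m)) 0 l by [].
have rectE : side i k b = side j k c -> face_of F k (i, b) `&` face_of F k (j, c) =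
  flat_rect k (side i k b) (fun l => Num.max (side i l false) (side j l false))
    (fun l => Num.min (side i l true) (side j l true)).
  move=> e; apply/seteqP; split=> p.
    move=> [[h1 /= e1] [h2 /= e2]]; split=> [//|l nl].
    by rewrite ge_max le_min; have := h1 l; have := h2 l; rewrite !sE; lra.
  move=> [pk pl]; split; split; rewrite /= -?sE -?e //.
  + move=> l; case: (eqVneq l k) => [->|nl].
      by rewrite pk; have := lh i k; case: (b); rewrite !sE; lra.
    by have := pl l nl; rewrite ge_max le_min !sE; lra.
  + move=> l; case: (eqVneq l k) => [->|nl].
      by rewrite pk e; have := lh j k; case: (c); rewrite !sE; lra.
    by have := pl l nl; rewrite ge_max le_min !sE; lra.
rewrite /attached; split=> [h|[e ov]].
  have e : side i k b = side j k c.
    apply/eqP/negP => /negP/eqP ne; move: h.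
    suff -> : face_of F k (i, b) `&` face_of F k (j, c) = set0.
      by rewrite /area image_set0 measure0 ltxx.
    by apply/seteqP; split=> // p [[_ /= e1] [_ /= e2]]; apply: ne; rewrite !sE -e1 -e2.
  split=> //; move: h; rewrite rectE // => /area_rect h' l nl.
  by have := h' l nl; rewrite gt_max !lt_min; lra.
rewrite rectE //; apply/area_rect => l nl; have := ov l nl; have := lh i l; have := lh j l.
by rewrite gt_max !lt_min; lra.
Qed.

Lemma rst_plane k f g : rst (attached F k) f g -> dissection_plane F k f = dissection_plane F k g.
Proof.
move=> fg; apply/seteqP; split=> p [h hh hp]; exists h => //=.
  by apply: rst_trans hh; apply: rst_sym.
exact: rst_trans hh.
Qed.

(** Planes are compared as point sets. A point in the relative interior of the face of [i], off all
    coordinates of block faces, lies in the relative interior of every face containing it, so such a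
    face overlaps that of [i] in positive area. *)
Lemma plane_rst k f g : dissection_plane F k f = dissection_plane F k g -> rst (attached F k) f g.
Proof.
case: f => i b e.
pose cs l := flatten [seq [:: side m l false; side m l true] | m <- enum 'I_n].
have mem_cs l m d : side m l d \in cs l.
  apply/flattenP; exists [:: side m l false; side m l true].
    by apply/mapP; exists m => //; rewrite mem_enum.
  by rewrite !inE; case: d; rewrite eqxx ?orbT.
have /fin_all_exists [x hx] : forall l, exists x, side i l false < x < side i l true /\ x \notin cs l.
  move=> l; have [|x h1 h2] := @avoid_finite R (side i l false) (side i l true) (cs l).
    exact: lo_lt_hi.
  by exists x.
pose p : point := \row_l (if l == k then side i k b else x l).
have : dissection_plane F k (i, b) p.
  exists (i, b); first exact: rst_refl.
  split; last by rewrite /= mxE eqxx.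
  move=> l; rewrite mxE /=; case: (eqVneq l k) => [->|nl].
    by have := lo_lt_hi (B i) k; rewrite /side; case: (b); lra.
  by have [] := hx l; rewrite /side; lra.
rewrite e => -[[j c] gj [/= hp pk]].
apply: (rst_trans _ _ _ (j, c)); last exact: rst_sym.
apply: rst_step; apply/attachedP; split; first by rewrite mxE eqxx in pk.
move=> l nl; have [h1 h2] := hx l; have := hp l; rewrite mxE (negbTE nl).
have n1 : x l != side j l false by apply: contraNN h2 => /eqP ->.
have n2 : x l != side j l true by apply: contraNN h2 => /eqP ->.
move: n1 n2 h1; rewrite !neq_lt /side; lra.
Qed.

Lemma plane_coord k i b p : dissection_plane F k (i, b) p -> p 0 k = side i k b.
Proof.
suff h f g : rst (attached F k) f g -> side f.1 k f.2 = side g.1 k g.2.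
  by move=> [[j c] /h /= -> [_ /= ->]].
by elim=> [[i1 b1] [i2 b2] /attachedP[]//|//|f1 f2 _ ->//|f1 f2 f3 _ -> _ ->].
Qed.

Lemma plane_coord_eq k i b j c :
  dissection_plane F k (i, b) = dissection_plane F k (j, c) -> side i k b = side j k c.
Proof.
have : dissection_plane F k (i, b) (if b then hi (B i) else lo (B i)).
  exists (i, b); first exact: rst_refl.
  by split=> //= l; have := lo_lt_hi (B i) l; case: (b); lra.
by move=> h e; rewrite -(plane_coord h); rewrite e in h; rewrite (plane_coord h).
Qed.

Lemma block_sub_host i k : lo (host F) 0 k <= lo (B i) 0 k /\ hi (B i) 0 k <= hi (host F) 0 k.
Proof.
have sub p : box_set (B i) p -> box_set (host F) p.
  by move=> h; rewrite -block_cover; exists i.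
have h1 : box_set (host F) (lo (B i)) by apply: sub => l; have := lo_lt_hi (B i) l; lra.
have h2 : box_set (host F) (hi (B i)) by apply: sub => l; have := lo_lt_hi (B i) l; lra.
by have := h1 k; have := h2 k; lra.
Qed.

Lemma block_cell i j (p : point) : (forall k, lo (B i) 0 k < p 0 k < hi (B i) 0 k) ->
  (forall k, lo (B j) 0 k < p 0 k < hi (B j) 0 k) -> i = j.
Proof.
move=> hi_ hj; apply/eqP/negP => /negP/(block_disj F) e.
have : set0 p by rewrite -e; split; apply/interior_boxP.
by [].
Qed.

End Attach.

Lemma isomorphic_of_rst (R : realType) n (F G : floor_plan R n) k (phi : 'I_n -> 'I_n) :
  bijective phi ->
  (forall f g : 'I_n * bool, rst (attached F k) f g <->
     rst (attached G k) (phi f.1, f.2) (phi g.1, g.2)) ->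
  isomorphic (dissection_graph F k) (dissection_graph G k).
Proof.
move=> [psi phiK psiK] h; pose ff (f : 'I_n * bool) := (phi f.1, f.2).
have /choice [v hv] : forall A : set 'rV[R]_3, exists A' : set 'rV[R]_3,
    forall f, A = dissection_plane F k f -> A' = dissection_plane G k (ff f).
  move=> A; have [[f ->]|nA] := pselect (exists f, A = dissection_plane F k f).
    exists (dissection_plane G k (ff f)) => g /plane_rst/h fg.
    by apply: rst_plane.
  by exists set0 => f e; case: nA; exists f.
exists v, phi; split.
- split.
  + by move=> _ [f _ <-]; exists (ff f) => //; rewrite (hv _ f).
  + move=> _ _ /set_mem [f _ <-] /set_mem [g _ <-].
    by rewrite !(hv _ _ erefl) => /plane_rst/h/rst_plane.
  + move=> _ [[i b] _ <-]; exists (dissection_plane F k (psi i, b)); first by exists (psi i, b).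
    by rewrite (hv _ _ erefl) /ff /= psiK.
- by exists psi.
- by move=> i /=; rewrite (hv _ _ erefl).
- by move=> i /=; rewrite (hv _ _ erefl).
Qed.

(** * Generic plans have no crossing *)

Section Crossing.
Variables (R : realType) (n : nat) (F : floor_plan R n) (zb : bool).
Local Notation B i := (block F i).
Variables (i k a b : 'I_n) (x y : R).

Variables (z : R) (p : 'rV[R]_3).
Hypothesis hostz : z = (if zb then hi (host F) else lo (host F)) 0 kZ.
Hypotheses (pX : p 0 kX = x) (pY : p 0 kY = y) (pZ : p 0 kZ = z).

Hypothesis ix : lo (B i) 0 kX = x /\ lo (B i) 0 kY = y.
Hypothesis kx : hi (B k) 0 kX = x /\ hi (B k) 0 kY = y.
Hypothesis ax : hi (B a) 0 kX = x /\ lo (B a) 0 kY = y.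
Hypothesis bx : lo (B b) 0 kX = x /\ hi (B b) 0 kY = y.

Hypothesis adj : forall m, Defs.adjacent F p m -> [\/ m = i, m = k, m = a | m = b].
Hypothesis hz : forall m, [\/ m = i, m = k, m = a | m = b] -> side F m kZ zb = z.

Local Notation four m := ([\/ m = i, m = k, m = a | m = b]).

Lemma inbox (C : box R) (q : 'rV[R]_3) : box_set C q <->
    [/\ lo C 0 kX <= q 0 kX <= hi C 0 kX, lo C 0 kY <= q 0 kY <= hi C 0 kY &
        lo C 0 kZ <= q 0 kZ <= hi C 0 kZ].
Proof. by split=> [h|[h0 h1 h2]]; [split; apply: h|apply: ord3_ind]. Qed.

(** At the edge through [p], the blocks [i], [k], [a], [b] occupy the upper right, lower left, upper
    left and lower right quadrant. The face between [k] and [a] is raised by [d], while the one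
    between [b] and [i] stays. *)
Section Shift.
Variables (w d : R) (B' : 'I_n -> box R).
Hypothesis w0 : 0 < w.
Hypothesis wd : forall m l, w <= hi (B m) 0 l - lo (B m) 0 l.
Hypotheses (d0 : 0 < d) (dw : d < w / 2).
Hypotheses (Bi' : B' i = B i) (Bb' : B' b = B b).
Hypothesis lk : forall l, lo (B' k) 0 l = lo (B k) 0 l.
Hypothesis hk : forall l, hi (B' k) 0 l = hi (B k) 0 l + (if l == kY then d else 0).
Hypothesis la : forall l, lo (B' a) 0 l = lo (B a) 0 l + (if l == kY then d else 0).
Hypothesis ha : forall l, hi (B' a) 0 l = hi (B a) 0 l.

Let hkX : hi (B' k) 0 kX = x. Proof. by rewrite hk addr0; case: kx. Qed.
Let hkY : hi (B' k) 0 kY = y + d. Proof. by rewrite hk; case: kx => _ ->. Qed.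
Let hkZ : hi (B' k) 0 kZ = hi (B k) 0 kZ. Proof. by rewrite hk addr0. Qed.
Let laX : lo (B' a) 0 kX = lo (B a) 0 kX. Proof. by rewrite la addr0. Qed.
Let laY : lo (B' a) 0 kY = y + d. Proof. by rewrite la; case: ax => _ ->. Qed.
Let laZ : lo (B' a) 0 kZ = lo (B a) 0 kZ. Proof. by rewrite la addr0. Qed.

Lemma four_adjacent m : four m -> Defs.adjacent F p m.
Proof.
move=> hm; apply/inbox; rewrite pX pY pZ -(hz hm).
move: (wd m kX) (wd m kY) (wd m kZ) (w0); rewrite /side.
by case: hm ix kx ax bx => -> [? ?] [? ?] [? ?] [? ?] ? ? ? ?; case: (zb); split; lra.
Qed.

Lemma four_z m (q : 'rV[R]_3) : four m ->
  `|z - q 0 kZ| < w / 2 -> lo (host F) 0 kZ <= q 0 kZ <= hi (host F) 0 kZ ->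
  lo (B m) 0 kZ <= q 0 kZ <= hi (B m) 0 kZ.
Proof.
move=> /hz; rewrite /side ltr_norml; move: (wd m kZ) hostz.
by case: (zb) => *; lra.
Qed.

Lemma shift_sub m (q : 'rV[R]_3) : four m -> ball p (w / 2) q -> box_set (B' m) q ->
  box_set (host F) q.
Proof.
move=> mm /ball_row/(_ kY); rewrite pY ltr_norml => qY /inbox Bq; apply/inbox; move: Bq.
move: (block_sub_host F m kX) (block_sub_host F m kY) (block_sub_host F m kZ).
move: (block_sub_host F a kY) (block_sub_host F k kY) (wd a kY) (wd k kY).
move: ax kx qY dw d0.
by case: mm => -> [? ?] [? ?]; rewrite ?Bi' ?Bb' ?lk ?ha ?hkX ?hkY ?hkZ ?laX ?laY ?laZ
  => ? ? ? ? ? ? ? ? ? ? [? ? ?]; split; lra.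
Qed.

Lemma shift_cover (q : 'rV[R]_3) : ball p (w / 2) q -> box_set (host F) q ->
  exists2 m, four m & box_set (B' m) q.
Proof.
move=> /ball_row bq /inbox [_ _ q3]; have bZ := bq kZ; rewrite pZ in bZ.
move: (bq kX) (bq kY); rewrite pX pY !ltr_norml => qX qY {bq}.
have nz m hm := @four_z m q hm bZ q3.
have [xq|xq] := leP x (q 0 kX).
  have [yq|yq] := leP y (q 0 kY).
    exists i; first by constructor 1.
    apply/inbox; rewrite Bi'; split; last by apply: nz; constructor 1.
      by case: ix (wd i kX) qX xq => -> _; lra.
    by case: ix (wd i kY) qY yq => _ ->; lra.
  exists b; first by constructor 4.
  apply/inbox; rewrite Bb'; split; last by apply: nz; constructor 4.
    by case: bx (wd b kX) qX xq => -> _; lra.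
  by case: bx (wd b kY) qY yq => _ ->; lra.
have [yq|yq] := leP (y + d) (q 0 kY).
  exists a; first by constructor 3.
  apply/inbox; rewrite !ha laX laY laZ; split; last by apply: nz; constructor 3.
    by case: ax (wd a kX) qX xq => -> _; lra.
  by case: ax (wd a kY) qY yq dw => _ ->; lra.
exists k; first by constructor 2.
apply/inbox; rewrite !lk hkX hkY hkZ; split; last by apply: nz; constructor 2.
  by case: kx (wd k kX) qX xq => -> _; lra.
by case: kx (wd k kY) qY yq => _ ->; lra.
Qed.

Lemma shift_disj m m' (q : 'rV[R]_3) : four m -> four m' -> m != m' ->
  (forall l, lo (B' m) 0 l < q 0 l < hi (B' m) 0 l) ->
  (forall l, lo (B' m') 0 l < q 0 l < hi (B' m') 0 l) -> False.
Proof.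
move=> hm hm' nm h h'; move: (h kX) (h kY) (h' kX) (h' kY) nm.
case: ix ax bx d0 => ix1 iy1 [ax1 ay1] [bx1 by1] d0'.
case: hm => ->; case: hm' => ->; rewrite ?eqxx // ?Bi' ?Bb' ?lk ?ha ?hkX ?hkY ?laX ?laY
  ?ix1 ?iy1 ?ax1 ?ay1 ?bx1 ?by1 => h1 h2 h3 h4 _.
all: move: h1 h2 h3 h4 d0'; lra.
Qed.

(** The octants filled by [i] and [b] force the second coordinate of [p'] to be [y], those filled by
    [a] and [k] force it to be [y + d]. *)
Lemma shift_shape (p' : 'rV[R]_3) : same_local_shape F p B' p' -> False.
Proof.
move=> shape.
pose oct (sx sy : bool) : 'I_3 -> bool := fun l => if l == kX then sx else if l == kY then sy else zb.
have fillm m sx sy : four m ->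
    (if sx then hi (B m) 0 kX = x else lo (B m) 0 kX = x) ->
    (if sy then hi (B m) 0 kY = y else lo (B m) 0 kY = y) ->
    if sy then lo (B' m) 0 kY < p' 0 kY <= hi (B' m) 0 kY else lo (B' m) 0 kY <= p' 0 kY < hi (B' m) 0 kY.
  move=> hm hX hY.
  have : fills_octant (box_set (B m)) p (oct sx sy).
    apply/fills_octantP; apply: ord3_ind; rewrite /oct ?pX ?pY ?pZ /=.
    - by move: (wd m kX) hX (w0); case: sx; lra.
    - by move: (wd m kY) hY (w0); case: sy; lra.
    - by move: (wd m kZ) (hz hm) (w0); rewrite /side; case: (zb); lra.
  by move=> /(shape _ _ (four_adjacent hm))/fills_octantP/(_ kY); rewrite /oct.
case: ix kx ax bx => ix1 iy1 [kx1 ky1] [ax1 ay1] [bx1 by1].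
have fi := fillm i false false (Or41 _ _ _ erefl) ix1 iy1.
have fk := fillm k true true (Or42 _ _ _ erefl) kx1 ky1.
have fa := fillm a true false (Or43 _ _ _ erefl) ax1 ay1.
have fb := fillm b false true (Or44 _ _ _ erefl) bx1 by1.
move: fi fk fa fb d0; rewrite Bi' Bb' !lk !ha hkY laY iy1 by1; lra.
Qed.

End Shift.

Lemma crossing_not_generic : generic_at F p -> False.
Proof.
(* [w] bounds all edge lengths from below; within distance [w / 2] of [p] the four blocks show only
   their faces through [p]. *)
have [|w w0 hw] := @finite_lower_bound R ('I_n * 'I_3)%type
  (fun q => hi (B q.1) 0 q.2 - lo (B q.1) 0 q.2); first by move=> q; rewrite subr_gt0 lo_lt_hi.
have wd m l : w <= hi (B m) 0 l - lo (B m) 0 l by exact: (hw (m, l)).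
have w20 : 0 < w / 2 by lra.
move=> /(_ (w / 2) w20) [e e0 gen].
have [d [d0 de dw]] : exists d, [/\ 0 < d, d < e & d < w / 2].
  exists (Num.min e w / 4); have : 0 < Num.min e w by rewrite lt_min e0 w0.
  have : Num.min e w <= e by rewrite ge_min lexx.
  have : Num.min e w <= w by rewrite ge_min lexx orbT.
  by split; lra.
case: (ix) (kx) (ax) (bx) => ix1 iy1 [kx1 ky1] [ax1 ay1] [bx1 by1].
have nik : i != k by apply/eqP => e1; have := lo_lt_hi (B i) kX; rewrite ix1 e1 kx1 ltxx.
have nia : i != a by apply/eqP => e1; have := lo_lt_hi (B i) kX; rewrite ix1 e1 ax1 ltxx.
have nbk : b != k by apply/eqP => e1; have := lo_lt_hi (B b) kX; rewrite bx1 e1 kx1 ltxx.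
have nba : b != a by apply/eqP => e1; have := lo_lt_hi (B b) kX; rewrite bx1 e1 ax1 ltxx.
have nak : a != k by apply/eqP => e1; have := lo_lt_hi (B a) kY; rewrite ay1 e1 ky1 ltxx.
have [B' [Bi' Bb' [lk hk] [la ha]]] : exists B' : 'I_n -> box R, [/\ B' i = B i, B' b = B b,
   (forall l, lo (B' k) 0 l = lo (B k) 0 l) /\
   (forall l, hi (B' k) 0 l = hi (B k) 0 l + (if l == kY then d else 0)) &
   (forall l, lo (B' a) 0 l = lo (B a) 0 l + (if l == kY then d else 0)) /\
   (forall l, hi (B' a) 0 l = hi (B a) 0 l)].
  have kbox l : lo (B k) 0 l < (\row_l (hi (B k) 0 l + (if l == kY then d else 0))) 0 l.
    by rewrite mxE; have := lo_lt_hi (B k) l; case: ifP; lra.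
  have abox l : (\row_l (lo (B a) 0 l + (if l == kY then d else 0))) 0 l < hi (B a) 0 l.
    by rewrite mxE; have := wd a l; case: ifP; lra.
  exists (fun m => if m == k then Box kbox else if m == a then Box abox else B m).
  rewrite (negbTE nik) (negbTE nia) (negbTE nbk) (negbTE nba) (negbTE nak) !eqxx.
  by split=> //; split=> // l; rewrite mxE.
have loc : local_perturbation F p (w / 2) e B'.
  split.
  - move=> m /adj [] ->; rewrite ?Bi' ?Bb'; split; apply/ball_row => l;
      rewrite ?lk ?hk ?la ?ha ?subrr ?normr0 //; rewrite opprD addrA subrr sub0r normrN;
      by case: ifP => _; rewrite ?normr0 // ger0_norm // ltW.
  - apply/seteqP; split=> q.
      move=> [[m /adj mm] Bq] bq; split=> //.
      exact: (shift_sub wd d0 dw Bi' Bb' lk hk la ha mm bq Bq).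
    move=> [hq bq]; split=> //.
    have [m mm Bm] := shift_cover wd dw Bi' Bb' lk hk la ha bq hq.
    by exists m => //; apply: (four_adjacent w0 wd).
  - move=> m m' /adj hm /adj hm' nm; apply/seteqP; split=> // q [[/interior_boxP h /interior_boxP h'] _].
    exact: (shift_disj d0 Bi' Bb' lk hk la ha hm hm' nm h h').
have [p' _ shape] := gen B' loc.
exact: (shift_shape w0 wd d0 Bi' Bb' lk hk la ha shape).
Qed.

End Crossing.

(** * The grid plans of the two layers *)

Section Rank.
Variables (R : realType) (s0 : seq R).

Definition coords : seq R := sort <=%O (undup s0).
Definition ncoords : nat := size coords.
Definition rk (v : R) : nat := index v coords.
(** A point inside the gap that becomes the unit cell [a] when coordinates are replaced by their
    ranks. *)
Definition gap_mid (a : nat) : R := (nth 0 coords a + nth 0 coords a.+1) / 2.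

Lemma mem_coords v : (v \in coords) = (v \in s0).
Proof. by rewrite mem_sort mem_undup. Qed.

Lemma nth_coords a b : (a < ncoords)%N -> (b < ncoords)%N ->
  (nth 0 coords a < nth 0 coords b) = (a < b)%N.
Proof.
by move=> ha hb; rewrite (lt_sorted_ltn_nth 0) ?inE // sort_lt_sorted undup_uniq.
Qed.

Lemma rk_size v : v \in s0 -> (rk v < ncoords)%N.
Proof. by rewrite -mem_coords index_mem. Qed.

Lemma nth_rk v : v \in s0 -> nth 0 coords (rk v) = v.
Proof. by rewrite -mem_coords => /nth_index. Qed.

Lemma rk_lt u v : u \in s0 -> v \in s0 -> (rk u < rk v)%N = (u < v).
Proof. by move=> hu hv; rewrite -nth_coords ?rk_size // !nth_rk. Qed.

Lemma rk_eq u v : u \in s0 -> v \in s0 -> rk u = rk v <-> u = v.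
Proof. by move=> hu hv; split=> [e|->//]; rewrite -(nth_rk hu) e nth_rk. Qed.

Lemma gap_mid_gt a v : v \in s0 -> (a.+1 < ncoords)%N -> (rk v <= a)%N -> v < gap_mid a.
Proof.
move=> hv ha le; rewrite /gap_mid.
have : nth 0 coords a < nth 0 coords a.+1 by rewrite nth_coords //; lia.
have : v <= nth 0 coords a.
  by rewrite leNgt -{1}(nth_rk hv) nth_coords ?rk_size //; lia.
by lra.
Qed.

Lemma gap_mid_lt a v : v \in s0 -> (a < rk v)%N -> gap_mid a < v.
Proof.
move=> hv lt; have := rk_size hv => sz; rewrite /gap_mid.
have : nth 0 coords a < nth 0 coords a.+1 by rewrite nth_coords //; lia.
have : nth 0 coords a.+1 <= v.
  by rewrite leNgt -{1}(nth_rk hv) nth_coords ?rk_size //; lia.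
by lra.
Qed.

End Rank.

Section ToLayers.
Variables (R : realType) (n : nat) (F : floor_plan R n) (h : R).
Local Notation B i := (block F i).
Local Notation c := (hi (host F) 0 kZ).
Hypothesis genF : generic F.
Hypothesis hc : 0 < h < c.
Hypothesis zext : forall i, [\/ (lo (B i) 0 kZ, hi (B i) 0 kZ) = (0, h),
   (lo (B i) 0 kZ, hi (B i) 0 kZ) = (h, c) | (lo (B i) 0 kZ, hi (B i) 0 kZ) = (0, c)].

Definition face_coords (k : 'I_3) : seq R :=
  lo (host F) 0 k :: hi (host F) 0 k ::
  flatten [seq [:: side F m k false; side F m k true] | m <- enum 'I_n].

Definition co (k : 'I_3) (b : bool) (i : 'I_n) : nat := rk (face_coords k) (side F i k b).
Definition hostco (k : 'I_3) : nat := rk (face_coords k) (hi (host F) 0 k).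

Lemma side_coords i k b : side F i k b \in face_coords k.
Proof.
rewrite !inE; apply/orP; right; apply/orP; right.
apply/flattenP; exists [:: side F i k false; side F i k true].
  by apply/mapP; exists i => //; rewrite mem_enum.
by rewrite !inE; case: b; rewrite eqxx ?orbT.
Qed.

Lemma hosthi_coords k : hi (host F) 0 k \in face_coords k.
Proof. by rewrite !inE eqxx orbT. Qed.

Lemma coords_host k v : v \in face_coords k -> lo (host F) 0 k <= v <= hi (host F) 0 k.
Proof.
have hlt := lo_lt_hi (host F) k.
rewrite !inE => /or3P[/eqP->|/eqP->|]; [lra|lra|].
move=> /flattenP [s /mapP[m _ ->]]; rewrite !inE.
have := block_sub_host F m k; have := lo_lt_hi (B m) k.
by move=> ? ? /orP[] /eqP ->; rewrite /side; lra.
Qed.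

Lemma co_lt k i j b d : (co k b i < co k d j)%N = (side F i k b < side F j k d).
Proof. by rewrite rk_lt ?side_coords. Qed.

Lemma co_le k i j b d : (co k b i <= co k d j)%N = (side F i k b <= side F j k d).
Proof. by rewrite leqNgt co_lt leNgt. Qed.

Lemma co_eq k i j b d : co k b i = co k d j <-> side F i k b = side F j k d.
Proof. by rewrite /co rk_eq ?side_coords. Qed.

Lemma co_wf k i : (co k false i < co k true i <= hostco k)%N.
Proof.
rewrite co_lt lo_lt_hi /= leqNgt rk_lt ?side_coords ?hosthi_coords // -leNgt.
by have [] := block_sub_host F i k.
Qed.

Lemma gap_host k a : (a < hostco k)%N ->
  lo (host F) 0 k <= gap_mid (face_coords k) a <= hi (host F) 0 k.
Proof.
move=> ha; have hh := hosthi_coords k; have := rk_size hh; rewrite -/(hostco k) => sz.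
have := gap_mid_lt hh ha.
have m1 : nth 0 (coords (face_coords k)) a \in face_coords k.
  by rewrite -mem_coords mem_nth // -/(ncoords _); lia.
have e : rk (face_coords k) (nth 0 (coords (face_coords k)) a) = a.
  by rewrite /rk index_uniq ?sort_uniq ?undup_uniq // -/(ncoords _); lia.
have := @gap_mid_gt R _ a _ m1; rewrite e => /(_ ltac:(lia) (leqnn _)).
by have := coords_host m1; lra.
Qed.

Lemma gap_in k a i : (a < hostco k)%N ->
  (co k false i <= a < co k true i)%N <->
  (side F i k false <= gap_mid (face_coords k) a <= side F i k true).
Proof.
move=> ha; have sz := rk_size (hosthi_coords k); rewrite -/(hostco k) in sz.
have l1 := @gap_mid_gt R (face_coords k) a _ (side_coords i k false).
have l2 := @gap_mid_lt R (face_coords k) a _ (side_coords i k false).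
have l3 := @gap_mid_gt R (face_coords k) a _ (side_coords i k true).
have l4 := @gap_mid_lt R (face_coords k) a _ (side_coords i k true).
rewrite -/(co k false i) -/(co k true i) in l1 l2 l3 l4.
have sz' : (a.+1 < ncoords (face_coords k))%N by lia.
split=> [/andP[h1 h2]|/andP[h1 h2]].
  by rewrite (ltW (l1 sz' h1)) (ltW (l4 h2)).
apply/andP; split.
  by rewrite leqNgt; apply/negP => /l2; rewrite ltNge h1.
by rewrite ltnNge; apply/negP => /(l3 sz'); rewrite ltNge h2.
Qed.

Lemma gap_in_strict k a i : (a < hostco k)%N -> (co k false i <= a < co k true i)%N ->
  side F i k false < gap_mid (face_coords k) a < side F i k true.
Proof.
move=> ha /andP[h1 h2]; have sz := rk_size (hosthi_coords k); rewrite -/(hostco k) in sz.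
by rewrite gap_mid_gt ?side_coords //= ?gap_mid_lt ?side_coords //; lia.
Qed.

Section Layer.
(** [zeta] is a height inside the layer, at which its blocks dissect a rectangle. [zb] selects the
    face of the host that bounds the layer: crossings are examined there, where only blocks of this
    layer are adjacent. *)
Variables (L : pred 'I_n) (zeta : R) (zb : bool).
Hypothesis zh : 0 < zeta < c.
Hypothesis LP : forall i, L i <-> lo (B i) 0 kZ < zeta < hi (B i) 0 kZ.
Hypothesis LP' : forall i, L i <-> lo (B i) 0 kZ <= zeta <= hi (B i) 0 kZ.
Hypothesis Lz : forall i, L i <-> side F i kZ zb = (if zb then hi (host F) else lo (host F)) 0 kZ.

Let cov a b : (a < hostco kX)%N -> (b < hostco kY)%N ->
  exists i, [/\ L i, (co kX false i <= a < co kX true i)%N & (co kY false i <= b < co kY true i)%N].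
Proof.
move=> ha hb.
pose p : 'rV[R]_3 := \row_l (if l == kX then gap_mid (face_coords kX) a
   else if l == kY then gap_mid (face_coords kY) b else zeta).
have pX : p 0 kX = gap_mid (face_coords kX) a by rewrite mxE.
have pY : p 0 kY = gap_mid (face_coords kY) b by rewrite mxE.
have pZ : p 0 kZ = zeta by rewrite mxE.
have hp : box_set (host F) p.
  apply: ord3_ind; rewrite ?pX ?pY ?pZ; [exact: gap_host|exact: gap_host|].
  by case/andP: zh => z1 z2; rewrite host_lo mxE !ltW.
have : (\bigcup_i box_set (B i)) p by rewrite block_cover.
move=> [i _ hi_]; exists i; split.
- by apply/LP'; rewrite -pZ.
- by apply/gap_in => //; rewrite -pX; apply: hi_.
- by apply/gap_in => //; rewrite -pY; apply: hi_.
Qed.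

Let uni a b i j : L i -> L j -> (co kX false i <= a < co kX true i)%N ->
  (co kY false i <= b < co kY true i)%N -> (co kX false j <= a < co kX true j)%N ->
  (co kY false j <= b < co kY true j)%N -> i = j.
Proof.
move=> /LP Li /LP Lj iX iY jX jY.
have ha : (a < hostco kX)%N by have := co_wf kX i; lia.
have hb : (b < hostco kY)%N by have := co_wf kY i; lia.
pose p : 'rV[R]_3 := \row_l (if l == kX then gap_mid (face_coords kX) a
   else if l == kY then gap_mid (face_coords kY) b else zeta).
have pX : p 0 kX = gap_mid (face_coords kX) a by rewrite mxE.
have pY : p 0 kY = gap_mid (face_coords kY) b by rewrite mxE.
have pZ : p 0 kZ = zeta by rewrite mxE.
apply: (@block_cell _ _ _ _ _ p); apply: ord3_ind.
- by rewrite pX; exact: (gap_in_strict ha iX).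
- by rewrite pY; exact: (gap_in_strict hb iY).
- by rewrite pZ.
- by rewrite pX; exact: (gap_in_strict ha jX).
- by rewrite pY; exact: (gap_in_strict hb jY).
- by rewrite pZ.
Qed.

Let nocross i k : L i -> L k -> co kX false i = co kX true k -> co kY false i = co kY true k -> False.
Proof.
move=> Li Lk ex ey.
have [a [b [La Lb [aX1 aY1] [bX1 bY1] only]]] :=
  crossing_blocks (co_wf kX) (co_wf kY) cov uni Li Lk ex ey.
have z1 m : [\/ m = i, m = k, m = a | m = b] ->
    side F m kZ zb = (if zb then hi (host F) else lo (host F)) 0 kZ.
  by case=> ->; apply/Lz.
pose p : 'rV[R]_3 := \row_l (if l == kX then lo (B i) 0 kX else if l == kY then lo (B i) 0 kY
   else (if zb then hi (host F) else lo (host F)) 0 kZ).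
have pX : p 0 kX = side F i kX false by rewrite mxE.
have pY : p 0 kY = side F i kY false by rewrite mxE.
have pZ : p 0 kZ = (if zb then hi (host F) else lo (host F)) 0 kZ by rewrite mxE.
apply: (@crossing_not_generic R n F zb i k a b (lo (B i) 0 kX) (lo (B i) 0 kY) _ p erefl pX pY pZ) => //.
- by split; apply/esym; [apply/(co_eq kX i k false true)|apply/(co_eq kY i k false true)].
- by split; [apply/(co_eq kX a i true false)|apply/(co_eq kY a i false false)].
- by split; [apply/(co_eq kX b i false false)|apply/(co_eq kY b i true false)].
- move=> m mp.
  have Lm : L m.
    apply/Lz; have := mp kZ; rewrite pZ.
    by have := block_sub_host F m kZ; rewrite /side; case: (zb); lra.
  have mX : (co kX false m <= co kX false i <= co kX true m)%N.
    have := mp kX; rewrite pX => /andP[m1 m2].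
    by rewrite !co_le m1 m2.
  have mY : (co kY false m <= co kY false i <= co kY true m)%N.
    have := mp kY; rewrite pY => /andP[m1 m2].
    by rewrite !co_le m1 m2.
  exact: only.
- apply: genF; exists i; apply: ord3_ind.
  + by left; rewrite mxE.
  + by left; rewrite mxE.
  + by rewrite mxE /= -(z1 i (Or41 _ _ _ erefl)) /side; case: (zb); [right|left].
Qed.

Lemma layer_plan : isplan L (co kX false) (co kX true) (co kY false) (co kY true) (hostco kX) (hostco kY).
Proof. by split=> // i _; apply: co_wf. Qed.

End Layer.

Let Lay1 : pred 'I_n := fun i => lo (B i) 0 kZ == 0.
Let Lay2 : pred 'I_n := fun i => hi (B i) 0 kZ == c.

Lemma zcases i : [\/ [/\ Lay1 i, ~~ Lay2 i, lo (B i) 0 kZ = 0 & hi (B i) 0 kZ = h],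
  [/\ ~~ Lay1 i, Lay2 i, lo (B i) 0 kZ = h & hi (B i) 0 kZ = c] |
  [/\ Lay1 i, Lay2 i, lo (B i) 0 kZ = 0 & hi (B i) 0 kZ = c]].
Proof.
rewrite /Lay1 /Lay2; case: (zext i) => -[-> ->]; rewrite ?eqxx.
- by constructor 1; split=> //; case/andP: hc => _ h1; rewrite (lt_eqF h1).
- by constructor 2; split=> //; case/andP: hc => h0 _; rewrite (gt_eqF h0).
- by constructor 3.
Qed.

Lemma layer1_plan :
  isplan Lay1 (co kX false) (co kX true) (co kY false) (co kY true) (hostco kX) (hostco kY).
Proof.
apply: (@layer_plan Lay1 (h / 2) false) => [|i|i|i]; first by move: hc; lra.
- by case: (zcases i) => -[h1 h2 e1 e2]; rewrite ?h1 ?(negbTE h1) e1 e2; split=> //; move: hc; lra.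
- by case: (zcases i) => -[h1 h2 e1 e2]; rewrite ?h1 ?(negbTE h1) e1 e2; split=> //; move: hc; lra.
- by rewrite /side host_lo mxE /Lay1; split=> /eqP.
Qed.

Lemma layer2_plan :
  isplan Lay2 (co kX false) (co kX true) (co kY false) (co kY true) (hostco kX) (hostco kY).
Proof.
apply: (@layer_plan Lay2 ((h + c) / 2) true) => [|i|i|i]; first by move: hc; lra.
- by case: (zcases i) => -[h1 h2 e1 e2]; rewrite ?h2 ?(negbTE h2) e1 e2; split=> //; move: hc; lra.
- by case: (zcases i) => -[h1 h2 e1 e2]; rewrite ?h2 ?(negbTE h2) e1 e2; split=> //; move: hc; lra.
- by rewrite /side /Lay2; split=> /eqP.
Qed.

Lemma hostco_gt0 k : (0 < hostco k)%N.
Proof.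
apply: (@leq_ltn_trans (rk (face_coords k) (lo (host F) 0 k))) => //.
by rewrite rk_lt ?hosthi_coords ?lo_lt_hi // inE eqxx.
Qed.

Lemma Lay12 i : Lay1 i || Lay2 i.
Proof. by case: (zcases i) => -[h1 h2 _ _]; rewrite ?h1 ?h2 ?orbT. Qed.

Definition plan_layers : layers 'I_n :=
  Layers (hostco_gt0 kX) (hostco_gt0 kY) Lay12 layer1_plan layer2_plan.

Lemma z_overlap i j : (side F i kZ false < side F j kZ true /\ side F j kZ false < side F i kZ true) <->
  (Lay1 i && Lay1 j) || (Lay2 i && Lay2 j).
Proof.
rewrite /side; case: (zcases i) => -[h1 h2 e1 e2]; case: (zcases j) => -[h3 h4 e3 e4];
  rewrite e1 e2 e3 e4 ?h1 ?h2 ?h3 ?h4 ?(negbTE h1) ?(negbTE h2) ?(negbTE h3) ?(negbTE h4) /=;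
  by split=> //; move: hc; lra.
Qed.

Lemma attached_x f g : attached F kX f g <-> attx plan_layers f g.
Proof.
case: f g => i b [j d]; rewrite /attx /attX /=.
have cE (m : 'I_n) e : (if e then co kX true m else co kX false m) = co kX e m by case: e.
rewrite !cE !co_lt; split=> [/attachedP[/co_eq e ov]|h'].
  have [? ?] := ov kY isT; have /z_overlap/orP[/andP[? ?]|/andP[? ?]] := ov kZ isT; by [left|right].
have [e o1 o2 o3] : [/\ side F i kX b = side F j kX d, side F i kY false < side F j kY true,
   side F j kY false < side F i kY true & (Lay1 i && Lay1 j) || (Lay2 i && Lay2 j)].
  by case: h' => -[h1 h2 /co_eq e h3 h4]; split=> //; rewrite h1 h2 ?orbT.
by apply/attachedP; split=> //; apply: ord3_ind => // _; apply/z_overlap.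
Qed.

Lemma attached_y f g : attached F kY f g <-> atty plan_layers f g.
Proof.
case: f g => i b [j d]; rewrite /atty /attX /=.
have cE (m : 'I_n) e : (if e then co kY true m else co kY false m) = co kY e m by case: e.
rewrite !cE !co_lt; split=> [/attachedP[/co_eq e ov]|h'].
  have [? ?] := ov kX isT; have /z_overlap/orP[/andP[? ?]|/andP[? ?]] := ov kZ isT; by [left|right].
have [e o1 o2 o3] : [/\ side F i kY b = side F j kY d, side F i kX false < side F j kX true,
   side F j kX false < side F i kX true & (Lay1 i && Lay1 j) || (Lay2 i && Lay2 j)].
  by case: h' => -[h1 h2 /co_eq e h3 h4]; split=> //; rewrite h1 h2 ?orbT.
by apply/attachedP; split=> //; apply: ord3_ind => // _; apply/z_overlap.
Qed.

Definition zlab (i : 'I_n) : bool * bool := (Lay1 i, Lay2 i).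

(* The horizontal face of [i] at the height [h], for a block of one layer only. *)
Definition mid_face (l : bool * bool) (f : 'I_n * bool) : bool :=
  (l.1 != l.2) && (f.2 == l.1).

(** Overlapping faces on the same side at the same height belong to the same block, because the
    midpoint of the overlap would be interior to both. On opposite sides, the common height can only
    be [h]. *)
Lemma attached_z f g : attached F kZ f g ->
  f = g \/ mid_face (zlab f.1) f /\ mid_face (zlab g.1) g.
Proof.
case: f g => i b [j d] /attachedP[e ov].
have [ovX1 ovX2] := ov kX isT; have [ovY1 ovY2] := ov kY isT.
have same : b = d -> i = j.
  move=> ebd; rewrite ebd in e.
  have lhi := lo_lt_hi (B i); have lhj := lo_lt_hi (B j).
  pose m l := (Num.max (side F i l false) (side F j l false) +
               Num.min (side F i l true) (side F j l true)) / 2.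
  have mP l : side F i l false < side F j l true -> side F j l false < side F i l true ->
      side F i l false < m l < side F i l true /\ side F j l false < m l < side F j l true.
    rewrite /m /side => ? ?; have := lhi l; have := lhj l.
    by rewrite minEle maxEle; do 2 case: ifP => ?; lra.
  have [mX mX'] := mP kX ovX1 ovX2; have [mY mY'] := mP kY ovY1 ovY2.
  have [mZ mZ'] : side F i kZ false < m kZ < side F i kZ true /\ side F j kZ false < m kZ < side F j kZ true.
    by apply: mP; have := lhi kZ; have := lhj kZ; move: e; rewrite /side; case: (d); lra.
  apply: (@block_cell _ _ _ _ _ (\row_l m l)); apply: ord3_ind; rewrite mxE.
  - exact: mX.
  - exact: mY.
  - exact: mZ.
  - exact: mX'.
  - exact: mY'.
  - exact: mZ'.
case: (eqVneq b d) => [ebd|nbd]; first by left; rewrite ebd same.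
right; move: nbd e; rewrite /mid_face /zlab /side /=.
case: (zcases i) => -[h1 h2 e1 e2]; case: (zcases j) => -[h3 h4 e3 e4];
  rewrite ?h1 ?h2 ?h3 ?h4 ?(negbTE h1) ?(negbTE h2) ?(negbTE h3) ?(negbTE h4) /=;
  by case: (b) (d) => [] [] //=; rewrite ?e1 ?e2 ?e3 ?e4; move: hc; lra.
Qed.

(** A class of faces at height [h] is numbered by the first block with a face in it;
    [Lay1 i && ~~ Lay2 i] is the side on which a block of one layer has its face at that height. *)
Definition zkey (i : 'I_n) : nat :=
  find (fun j => `[< rst (attached F kZ) (i, Lay1 i && ~~ Lay2 i) (j, Lay1 j && ~~ Lay2 j) >]) (enum 'I_n).

Lemma zkeyP i j : zkey i = zkey j <->
  rst (attached F kZ) (i, Lay1 i && ~~ Lay2 i) (j, Lay1 j && ~~ Lay2 j).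
Proof.
set m := fun i => (i, Lay1 i && ~~ Lay2 i).
have hs i0 : has (fun j => `[< rst (attached F kZ) (m i0) (m j) >]) (enum 'I_n).
  by apply/hasP; exists i0; rewrite ?mem_enum //; apply/asboolP; apply: rst_refl.
split=> [e|ij].
  have := nth_find i (hs i); have := nth_find i (hs j); rewrite -/(zkey i) -/(zkey j) -e.
  by move=> /asboolP h1 /asboolP h2; apply: rst_trans h2 _; apply: rst_sym.
apply: eq_find => k; apply/asboolP/asboolP => hk.
  by apply: rst_trans hk; apply: rst_sym.
exact: rst_trans hk.
Qed.

Lemma rst_attached_z f g : rst (attached F kZ) f g <->
  f = g \/ [/\ mid_face (zlab f.1) f, mid_face (zlab g.1) g & zkey f.1 = zkey g.1].
Proof.
have midE f' : mid_face (zlab f'.1) f' -> f' = (f'.1, Lay1 f'.1 && ~~ Lay2 f'.1).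
  case: f' => i b; rewrite /mid_face /zlab /= => /andP[ne /eqP ->].
  by case: (Lay1 i) (Lay2 i) ne => [] [].
split.
  move=> fg; suff h' : f = g \/ mid_face (zlab f.1) f /\ mid_face (zlab g.1) g.
    case: h' => [|[mf mg]]; [by left|right; split=> //].
    by apply/zkeyP; rewrite -(midE _ mf) -(midE _ mg).
  elim: fg => [f' g' /attached_z//|f'|f' g' _|f' g' k _ h1 _ h2].
  - by left.
  - by case=> [->|[]]; [left|right].
  - by case: h1 h2 => [->//|[h1 h1']] [<-|[h2 h2']]; right.
move=> [->|[mf mg /zkeyP]]; first exact: rst_refl.
by rewrite -(midE _ mf) -(midE _ mg).
Qed.

End ToLayers.

(** * Counting topological classes from above *)

(** An element may have several codes; choosing one is injective because a code belongs to a single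
    element. *)
Lemma card_by_code (U : choiceType) (C : finType) (A : set U) (rel : U -> C -> Prop) :
  (forall u, A u -> exists c, rel u c) ->
  (forall u v c, A u -> A v -> rel u c -> rel v c -> u = v) ->
  finite_set A /\ (#|` fset_set A| <= #|C|)%N.
Proof.
move=> ex inj.
have /choice [f hf] : forall u, exists m : nat,
    A u -> exists2 c, rel u c & m = enum_rank c.
  move=> u; have [/ex [c uc]|nA] := pselect (A u).
    by exists (enum_rank c) => _; exists c.
  by exists 0%N.
have le : (A #<= `I_#|C|)%card.
  have finj : {in A &, injective f}.
    move=> u v /set_mem Au /set_mem Av e.
    have [c uc ec] := hf u Au; have [c' vc ec'] := hf v Av.
    have cc : c = c' by apply/enum_rank_inj/val_inj; rewrite /= -ec -ec'.
    by subst c'; apply: inj uc vc.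
  have := inj_card_eq finj; rewrite card_eq_le => /andP[_ h].
  apply: card_le_trans h (subset_card_le _).
  by move=> _ [u Au <-] /=; have [c _ ->] := hf u Au.
by split; [exact: card_le_finite le (finite_II _)|exact: geq_card_fset_set].
Qed.

Lemma isomorphic_trans V1 E1 V2 E2 V3 E3 (G1 : multigraph V1 E1) (G2 : multigraph V2 E2)
    (G3 : multigraph V3 E3) :
  isomorphic G1 G2 -> isomorphic G2 G3 -> isomorphic G1 G3.
Proof.
move=> [f [g [bf bg s t]]] [f' [g' [bf' bg' s' t']]].
exists (f' \o f), (g' \o g); split.
- exact: set_bij_comp bf bf'.
- exact: bij_comp.
- by move=> e /=; rewrite s s'.
- by move=> e /=; rewrite t t'.
Qed.

Lemma isomorphic_sym (V1 : pointedType) E1 V2 E2 (G1 : multigraph V1 E1)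
    (G2 : multigraph V2 E2) :
  (forall e, vertices G1 (source G1 e)) -> (forall e, vertices G1 (target G1 e)) ->
  isomorphic G1 G2 -> isomorphic G2 G1.
Proof.
move=> vs vt [f [g [[ff fi fs] [g' gK gK'] s t]]].
have /choice [f' hf'] : forall y, exists x, vertices G2 y -> vertices G1 x /\ f x = y.
  move=> y; have [/fs [x Ax fx]|n] := pselect (vertices G2 y); first by exists x.
  by exists point.
have f'K x : vertices G1 x -> f' (f x) = x.
  move=> Ax; have [Ax' e] := hf' _ (ff _ Ax).
  by apply: fi => //; apply/mem_set.
exists f', g'; split.
- split.
  + by move=> y /hf' [].
  + move=> y y' /set_mem Ay /set_mem Ay' e.
    by have [_ <-] := hf' _ Ay; have [_ <-] := hf' _ Ay'; rewrite e.
  + by move=> x Ax; exists (f x); [exact: ff|exact: f'K].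
- by exists g.
- by move=> e; rewrite -{1}[e]gK' -s f'K.
- by move=> e; rewrite -{1}[e]gK' -t f'K.
Qed.

Section Equivalence.
Variables (R : realType) (n : nat).

Lemma teq_trans (F G H : floor_plan R n) :
  topologically_equivalent F G -> topologically_equivalent G H -> topologically_equivalent F H.
Proof. by move=> h1 h2 k; apply: isomorphic_trans (h1 k) (h2 k). Qed.

Lemma teq_sym (F G : floor_plan R n) :
  topologically_equivalent F G -> topologically_equivalent G F.
Proof.
move=> h k; apply: isomorphic_sym (h k) => e; first by exists (e, false).
by exists (e, true).
Qed.

Definition tclass (F : floor_plan R n) : set (floor_plan R n) :=
  [set G | generic_two_layer G /\ topologically_equivalent F G].

Lemma tclass_eq (F G : floor_plan R n) : topologically_equivalent F G -> tclass F = tclass G.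
Proof.
move=> FG; apply/seteqP; split=> H [gH h]; split=> //.
  exact: teq_trans (teq_sym FG) h.
exact: teq_trans FG h.
Qed.

Lemma tclass_teq (F G : floor_plan R n) : generic_two_layer G ->
  tclass F = tclass G -> topologically_equivalent F G.
Proof.
move=> gG e; suff : tclass F G by case.
rewrite e; split=> // k; exists id, id; split=> //; last by exists id.
by split=> // x Ax; exists x.
Qed.

End Equivalence.

Definition max_roots (n : nat) : nat := ((n + 2) %/ 3)%N.

Section Code.
Variables (R : realType) (n : nat).

Definition plan_code : finType :=
  (((2 * n).+1.-tuple (option info) * (2 * n).+1.-tuple (option unit)) *
   ((2 * n).+1.-tuple (option info) * (2 * n).+1.-tuple (option unit)) *
   {ffun 'I_(max_roots n).+1 -> 'I_(max_roots n).+1} *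
   n.-tuple (bool * bool * bool))%type.

Definition plan_coded (F : floor_plan R n) (c : plan_code) : Prop :=
  exists (D : layers 'I_n) (cc : code_type (max_roots n)) (lab : 'I_n -> bool * bool)
    (key : 'I_n -> nat) (s : seq 'I_n),
  [/\ (forall f g, attached F kX f g <-> attx D f g) /\
      (forall f g, attached F kY f g <-> atty D f g),
      forall f g, rst (attached F kZ) f g <->
        f = g \/ [/\ mid_face (lab f.1) f, mid_face (lab g.1) g & key f.1 = key g.1],
      coded D cc, key_seq key s &
      (c.1 = ((btuple n cc.1.1.1, btuple n cc.1.1.2),
              (btuple n cc.1.2.1, btuple n cc.1.2.2), cc.2)) /\
      tval c.2 = word lab key s].

Lemma plan_coded_ex (F : floor_plan R n) : generic_two_layer F -> exists c, plan_coded F c.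
Proof.
move=> [gF [h hc ze]].
pose D := plan_layers gF hc ze.
have [cc ccP] := coded_ex D (max_roots n).
have [s sP] := key_seq_ex (zkey F).
have sz : size (word (zlab F) (zkey F) s) == n by rewrite size_word (size_key_seq sP) card_ord.
exists (((btuple n cc.1.1.1, btuple n cc.1.1.2), (btuple n cc.1.2.1, btuple n cc.1.2.2), cc.2),
  Tuple sz).
exists D, cc, (zlab F), (zkey F), s; split=> //.
- by split=> f g; [exact: attached_x|exact: attached_y].
- by move=> f g; apply: (rst_attached_z hc ze).
Qed.

Lemma coded_sizes (D : layers 'I_n) M (cc : code_type M) : coded D cc ->
  [/\ (size (inorder cc.1.1.1) <= n)%N, (size (inorder cc.1.1.2) <= n)%N,
      (size (inorder cc.1.2.1) <= n)%N & (size (inorder cc.1.2.2) <= n)%N].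
Proof.
have le (s : seq 'I_n) : uniq s -> (size s <= n)%N.
  by move=> /card_uniqP <-; rewrite -[X in (_ <= X)%N](card_ord n); apply: max_card.
have hb A (f : 'I_n -> A) t : uniq (inorder t) -> (size (inorder (bmap f t)) <= n)%N.
  by move=> /le; rewrite inorder_bmap size_map.
move=> [r1 [r2 [r3 [r4 [_ _ _ _ ->]]]]]; split.
- exact: (hb _ (block_info D) _ (porder_uniq (plan1 D) r1)).
- exact: (hb _ (fun _ => tt) _ (porder_uniq (isplan_tr (plan1 D)) r2)).
- exact: (hb _ (block_info D) _ (porder_uniq (plan2 D) r3)).
- exact: (hb _ (fun _ => tt) _ (porder_uniq (isplan_tr (plan2 D)) r4)).
Qed.

Lemma rst_eq A (R1 R2 : relation A) x y :
  (forall x y, R1 x y <-> R2 x y) -> rst R1 x y <-> rst R2 x y.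
Proof.
move=> h; split; apply: (@rst_sub _ _ _ _ id) => a b /h ab; exact: rst_step.
Qed.

Lemma plan_coded_teq (F G : floor_plan R n) c :
  plan_coded F c -> plan_coded G c -> topologically_equivalent F G.
Proof.
move=> [D [cc [lab [key [s [[aX aY] aZ cD ks [e1 e2]]]]]]].
move=> [D' [cc' [lab' [key' [s' [[aX' aY'] aZ' cD' ks' [e1' e2']]]]]]].
have ecc : cc = cc'.
  have [q1 q2 q3 q4] := coded_sizes cD; have [q1' q2' q3' q4'] := coded_sizes cD'.
  have := etrans (esym e1) e1' => E.
  have i1 := btuple_inj q1 q1' (congr1 (fun x => x.1.1.1) E).
  have i2 := btuple_inj q2 q2' (congr1 (fun x => x.1.1.2) E).
  have i3 := btuple_inj q3 q3' (congr1 (fun x => x.1.2.1) E).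
  have i4 := btuple_inj q4 q4' (congr1 (fun x => x.1.2.2) E).
  have i5 := congr1 (fun x => x.2) E.
  by case: cc i1 i2 i3 i4 i5 {E e1 cD q1 q2 q3 q4} => [[[? ?] [? ?]] ?];
     case: cc' {e1' cD' q1' q2' q3' q4'} => [[[? ?] [? ?]] ?] /= -> -> -> -> ->.
subst cc'.
have [a _] : exists a : 'I_n, True by have [r1 _] := cD; exists r1.
have roots : (#|is_root D| <= max_roots n)%N.
  by rewrite /max_roots leq_divRL // mulnC -[X in (_ <= X + _)%N](card_ord n); apply: card_roots.
have [phi [bphi pX pY]] := same_code_iso erefl roots cD cD'.
(* The bijection for the direction z is unrelated to [phi], as equivalence asks for an isomorphism
   in each direction separately. *)
have [psi [bpsi plab pkey]] := word_iso a ks ks' (etrans (esym e2) e2').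
apply: ord3_ind.
- apply: (isomorphic_of_rst bphi) => f g.
  by rewrite (rst_eq _ _ aX) (rst_eq _ _ aX'); apply: pX.
- apply: (isomorphic_of_rst bphi) => f g.
  by rewrite (rst_eq _ _ aY) (rst_eq _ _ aY'); apply: pY.
- apply: (isomorphic_of_rst bpsi) => f g; rewrite aZ aZ' /= !plab.
  have inj := bij_inj bpsi.
  split=> [[->|[m1 m2 /pkey m3]]|[e|[m1 m2 /pkey m3]]]; [by left|by right| |by right].
  by left; case: f g e => f1 f2 [g1 g2] /= [/inj -> ->].
Qed.

Lemma topological_classes_bound :
  finite_set (topological_classes R n) /\
  (#|` fset_set (topological_classes R n)| <= #|plan_code|)%N.
Proof.
apply: (card_by_code (rel := fun A c => exists F, [/\ generic_two_layer F, A = tclass F & plan_coded F c])).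
- by move=> _ [F gF <-]; have [c Fc] := plan_coded_ex gF; exists c, F.
- move=> A A' c _ _ [F [gF -> Fc]] [G [gG -> Gc]].
  by apply: tclass_eq; apply: plan_coded_teq Fc Gc.
Qed.

(** 65 is the number of values of six booleans plus one for [None]; 8 counts the label and the flag
    of a letter of the word. *)
Lemma card_plan_code :
  #|plan_code| = ((65 ^ (2 * n).+1 * 2 ^ (2 * n).+1) * (65 ^ (2 * n).+1 * 2 ^ (2 * n).+1) *
    (max_roots n).+1 ^ (max_roots n).+1 * 8 ^ n)%N.
Proof.
rewrite /plan_code !card_prod !card_tuple card_ffun !card_ord !card_option !card_prod.
by rewrite !card_bool card_unit.
Qed.

End Code.

(** * Floor plans with integer coordinates *)

Section Cells.
Variable R : realType.

Lemma ltn_natr (a b : nat) : (a < b)%N -> a%:R + 1 <= b%:R :> R.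
Proof. by move=> h; rewrite natr1 ler_nat. Qed.

Lemma leq_natr (a b : nat) : (a <= b)%N -> a%:R <= b%:R :> R.
Proof. by move=> h; rewrite ler_nat. Qed.

Lemma closed_cell (x : R) (d : nat) : (0 < d)%N -> 0 <= x <= d%:R ->
  exists2 v, (v < d)%N & v%:R <= x <= v.+1%:R.
Proof.
elim: d => // d IH _ hx; have [le|lt] := leP d%:R x.
  by exists d => //; lra.
case: (posnP d) => [e|d0]; first by rewrite e in lt; lra.
by have [|v vd hv] := IH d0; [lra|exists v => //; apply: ltnW].
Qed.

Lemma open_cell (x : R) (d : nat) : 0 <= x < d%:R ->
  exists2 v, (v < d)%N & v%:R <= x < v.+1%:R.
Proof.
elim: d => [|d IH] hx; first by lra.
have [le|lt] := leP d%:R x; first by exists d => //; lra.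
by have [|v vd hv] := IH; [lra|exists v => //; apply: ltnW].
Qed.

(** Distinct integers are at least 1 apart and each moves by less than 1/8, so a comparison could
    change only if equal integers separated, which the last premise excludes. *)
Lemma near_nat_cmp (a b : nat) (x v w : R) : w <= 1 / 2 ->
  `|a%:R - x| < w / 4 -> `|b%:R - v| < w / 4 -> (a = b -> x = v) ->
  ((a < b)%N = (x < v)) /\ ((a <= b)%N = (x <= v)).
Proof.
rewrite !ltr_norml => w1 h1 h2 e; case: (ltngtP a b) => [/(ltn_natr)|/(ltn_natr)|/e ->].
- by move=> lt; split; apply/esym; lra.
- by move=> lt; split; apply/esym/negbTE; rewrite -?leNgt -?ltNge; lra.
- by rewrite ltxx lexx.
Qed.

End Cells.

Section Discrete.
Variables (R : realType) (T : finType) (n : nat) (tb : 'I_n -> T).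
Variables (D : 'I_3 -> nat) (clo chi : T -> 'I_3 -> nat).
Hypothesis tb_bij : bijective tb.
Hypothesis D_gt0 : forall k, (0 < D k)%N.
Hypothesis cwf : forall m k, (clo m k < chi m k <= D k)%N.
Hypothesis ccov : forall v : 'I_3 -> nat, (forall k, (v k < D k)%N) ->
  exists m, forall k, (clo m k <= v k < chi m k)%N.
Hypothesis cuni : forall (v : 'I_3 -> nat) m m',
  (forall k, (clo m k <= v k < chi m k)%N) -> (forall k, (clo m' k <= v k < chi m' k)%N) -> m = m'.

Local Notation point := 'rV[R]_3.

Lemma dhost_lt k : (0 : point) 0 k < (\row_k (D k)%:R : point) 0 k.
Proof. by rewrite !mxE ltr0n. Qed.

Definition dhost : box R := Box dhost_lt.

Lemma dblock_lt i k : (\row_k (clo (tb i) k)%:R : point) 0 k < (\row_k (chi (tb i) k)%:R : point) 0 k.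
Proof. by rewrite !mxE ltr_nat; case/andP: (cwf (tb i) k). Qed.

Definition dblock (i : 'I_n) : box R := Box (dblock_lt i).

Lemma loE i k : lo (dblock i) 0 k = (clo (tb i) k)%:R. Proof. by rewrite mxE. Qed.
Lemma hiE i k : hi (dblock i) 0 k = (chi (tb i) k)%:R. Proof. by rewrite mxE. Qed.

Lemma dblock_cover : \bigcup_i box_set (dblock i) = box_set dhost.
Proof.
apply/seteqP; split=> p.
  move=> [i _ h] k; have := h k; rewrite loE hiE !mxE.
  have /andP[_ /(leq_natr R)] := cwf (tb i) k; have := ler0n R (clo (tb i) k); lra.
move=> h.
have /fin_all_exists [v hv] : forall k, exists v : nat, (v < D k)%N /\ (v%:R <= p 0 k <= v.+1%:R).
  move=> k; have [|v v1 v2] := @closed_cell R (p 0 k) (D k) (D_gt0 k); last by exists v.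
  by have := h k; rewrite !mxE.
have [m hm] := ccov (fun k => (hv k).1).
case: tb_bij => g _ gK; exists (g m) => // k.
have [_] := hv k; have /andP[/(leq_natr R) h1 /(leq_natr R) h2] := hm k.
by rewrite loE hiE gK; lra.
Qed.

Lemma dblock_disj i j : i != j -> (box_set (dblock i))° `&` (box_set (dblock j))° = set0.
Proof.
move=> nij; apply/seteqP; split=> // p [/interior_boxP hi_ /interior_boxP hj].
case/eqP: nij; apply: (bij_inj tb_bij).
have /fin_all_exists [v hv] : forall k, exists v : nat, (v < D k)%N /\ (v%:R <= p 0 k < v.+1%:R).
  move=> k; have [|v v1 v2] := @open_cell R (p 0 k) (D k); last by exists v.
  have := hi_ k; rewrite loE hiE; have /andP[_ /(leq_natr R)] := cwf (tb i) k.
  by have := ler0n R (clo (tb i) k); lra.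
have aux m k : (clo m k)%:R < p 0 k < (chi m k)%:R -> (clo m k <= v k < chi m k)%N.
  move=> h; have [_ /andP[h1 h2]] := hv k; case/andP: h => h3 h4.
  by rewrite -ltnS -(ltr_nat R) (lt_trans h3 h2) -(ltr_nat R) (le_lt_trans h1 h4).
by apply: (cuni (v := v)) => k; apply: aux; [have := hi_ k|have := hj k]; rewrite loE hiE.
Qed.

Definition dplan : floor_plan R n := @FloorPlan R n dhost dblock erefl dblock_cover dblock_disj.

Section At.
Variable P : 'I_3 -> nat.

Local Notation fills := (fills clo chi P).
Local Notation rigid := (rigid D clo chi P (fun k => (P k)%:R : R)).

Lemma fills_uniq m m' s : fills m s -> fills m' s -> m = m'.
Proof.
move=> h h'; apply: (cuni (v := fun k => if s k then (P k).-1 else P k)) => k.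
  by have := h k; case: (s k); lia.
by have := h' k; case: (s k); lia.
Qed.

Let p : point := \row_k (P k)%:R.

Lemma pE k : p 0 k = (P k)%:R. Proof. by rewrite mxE. Qed.

Lemma adjacentP i : Defs.adjacent dplan p i <-> forall l, (clo (tb i) l <= P l <= chi (tb i) l)%N.
Proof.
by split=> h l; have := h l; rewrite pE /= loE hiE !ler_nat.
Qed.

(** * Ties between the faces of slightly moved blocks *)

Section Perturbed.
Variables (r w : R) (B : 'I_n -> box R).
Hypothesis loc : local_perturbation dplan p r (w / 4) B.
Hypotheses (w0 : 0 < w) (wr : w <= r) (w1 : w <= 1 / 2).

Lemma pert_near i l : Defs.adjacent dplan p i ->
  `|(clo (tb i) l)%:R - lo (B i) 0 l| < w / 4 /\ `|(chi (tb i) l)%:R - hi (B i) 0 l| < w / 4.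
Proof.
by case: loc => h _ _ /h [/ball_row h1 /ball_row h2]; rewrite -loE -hiE.
Qed.

(** A point in the octant [s] with free coordinate [t] in the direction [k]. Faces move by less than
    [w / 4] while the other coordinates are offset by [w / 2], so in these directions a moved block
    containing the point lies on the same side of [P] as before. *)
Definition probe (s : 'I_3 -> bool) (k : 'I_3) (t : R) : point :=
  \row_l (if l == k then t else (P l)%:R + (if s l then - (w / 2) else w / 2)).

Lemma probeK s k t : probe s k t 0 k = t. Proof. by rewrite mxE eqxx. Qed.

Lemma probeE s k t l : l != k ->
  probe s k t 0 l = (P l)%:R + (if s l then - (w / 2) else w / 2).
Proof. by move=> /negbTE nl; rewrite mxE nl. Qed.

Lemma probe_ball s k t : `|(P k)%:R - t| < w -> ball p r (probe s k t).
Proof.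
move=> ht; apply/ball_row => l; rewrite pE; case: (eqVneq l k) => [->|nl].
  by rewrite probeK; move: ht wr; lra.
by rewrite probeE // ltr_norml; move: w0 wr; case: (s l); lra.
Qed.

Lemma probe_host s k t m : fills m s -> 0 <= t <= (D k)%:R -> box_set dhost (probe s k t).
Proof.
move=> fm ht l; case: (eqVneq l k) => [->|nl]; first by rewrite probeK !mxE.
rewrite probeE // !mxE; have := fm l; have /andP[_] := cwf m l.
move: w0 w1; case: (s l) => h1 h2 h3 /andP[h4 h5].
  have := leq_natr R (leq_trans h5 h3); have := ltn_natr R h4.
  by have := ler0n R (clo m l); lra.
have := leq_natr R h4; have := ltn_natr R (leq_trans h5 h3).
by have := ler0n R (clo m l); lra.
Qed.

Lemma probe_in s k t i : Defs.adjacent dplan p i ->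
  (forall l, l != k -> if s l then (clo (tb i) l < P l <= chi (tb i) l)%N
                       else (clo (tb i) l <= P l < chi (tb i) l)%N) ->
  lo (B i) 0 k < t < hi (B i) 0 k ->
  forall l, lo (B i) 0 l < probe s k t 0 l < hi (B i) 0 l.
Proof.
move=> ai fi ht l; case: (eqVneq l k) => [->|nl]; first by rewrite probeK.
rewrite probeE //; have := fi l nl; have [] := pert_near l ai; rewrite !ltr_norml.
move: w0 w1; case: (s l) => h1 h2 h3 h4 /andP[h5 h6].
  by have := ltn_natr R h5; have := leq_natr R h6; lra.
by have := leq_natr R h5; have := ltn_natr R h6; lra.
Qed.

Lemma probe_fills s k t i : Defs.adjacent dplan p i -> box_set (B i) (probe s k t) ->
  forall l, l != k -> if s l then (clo (tb i) l < P l <= chi (tb i) l)%N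
                       else (clo (tb i) l <= P l < chi (tb i) l)%N.
Proof.
move=> ai Bi l nl; have := Bi l; rewrite probeE //.
have [] := pert_near l ai; rewrite !ltr_norml.
have /adjacentP/(_ l)/andP[a1 a2] := ai.
move: w0 w1; case: (s l) => h1 h2 h3 h4 h5; rewrite ?a1 ?a2 ?andbT //=.
  by rewrite -(ltr_nat R); lra.
by rewrite -(ltr_nat R); lra.
Qed.

(** Only the direction [k] is left free, so a block containing the probe fills the octant [s] or
    [flip k s]. *)
Lemma probe_block (s : 'I_3 -> bool) k t i m m' : s k -> Defs.adjacent dplan p i -> box_set (B i) (probe s k t) ->
  fills m s -> (forall m'', fills m'' (flip k s) -> m'' = m') -> tb i = m \/ tb i = m'.
Proof.
move=> sk ai Bi fm fm'; have h := probe_fills ai Bi.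
have /adjacentP/(_ k) ak := ai; have := cwf (tb i) k => wk.
case: (ltnP (clo (tb i) k) (P k)) => lt.
  left; apply: fills_uniq fm => l; case: (eqVneq l k) => [->|nl]; last exact: h.
  by rewrite sk; lia.
right; apply: fm' => l; rewrite /flip; case: (eqVneq l k) => [->|nl]; last exact: h.
by rewrite sk /=; lia.
Qed.

Lemma fills_adjacent i (s : 'I_3 -> bool) : fills (tb i) s -> Defs.adjacent dplan p i.
Proof. by move=> h; apply/adjacentP => l; have := h l; case: (s l); lia. Qed.

Lemma flip_side m (s : 'I_3 -> bool) k : fills m (flip k s) ->
  forall l, l != k -> if s l then (clo m l < P l <= chi m l)%N else (clo m l <= P l < chi m l)%N.
Proof. by move=> h l nl; have := h l; rewrite /flip (negbTE nl). Qed.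

Lemma probe_covered s k t m : fills m s -> 0 <= t <= (D k)%:R -> `|(P k)%:R - t| < w ->
  exists2 i, Defs.adjacent dplan p i & box_set (B i) (probe s k t).
Proof.
move=> fm tD tw; case: loc => _ cov _.
have : (box_set (host dplan) `&` ball p r) (probe s k t).
  by split; [exact: probe_host fm tD|exact: probe_ball].
by rewrite -cov => -[[i ai Bi] _]; exists i.
Qed.

Lemma tie_touch (s : 'I_3 -> bool) k i j : s k -> fills (tb i) s -> fills (tb j) (flip k s) ->
  i <> j -> [/\ chi (tb i) k = P k, clo (tb j) k = P k, (clo (tb i) k < P k)%N &
              (P k < chi (tb j) k)%N].
Proof.
move=> sk fi fj nij.
have ntb : tb i <> tb j by move/(bij_inj tb_bij).
have := fi k; have := fj k; rewrite /flip eqxx sk /= => fjk fik.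
split; last 2 first; try lia.
- apply/eqP/negP => /negP ne; apply: ntb; apply: fills_uniq fj => l.
  rewrite /flip; case: (eqVneq l k) => [->|nl]; first by rewrite sk /=; lia.
  exact: fi.
- apply/eqP/negP => /negP ne; apply: ntb; apply: (fills_uniq fi) => l.
  case: (eqVneq l k) => [->|nl]; first by rewrite sk; lia.
  by have := fj l; rewrite /flip (negbTE nl).
Qed.

(** A gap between the two faces would leave the probe in its middle uncovered, as only [i] and [j]
    could contain it. *)
Lemma tie_le (s : 'I_3 -> bool) k i j : s k -> fills (tb i) s -> fills (tb j) (flip k s) -> i <> j ->
  lo (B j) 0 k <= hi (B i) 0 k.
Proof.
move=> sk fi fj nij; rewrite leNgt; apply/negP => lt.
have ai := fills_adjacent fi; have aj := fills_adjacent fj.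
have [_ ni] := pert_near k ai; have [nj _] := pert_near k aj.
have [ei ej t1 t2] := tie_touch sk fi fj nij.
rewrite ei in ni; rewrite ej in nj.
have := cwf (tb j) k => wj.
have P0 : 1 <= (P k)%:R :> R by rewrite (ler_nat R 1); lia.
have PD : (P k)%:R + 1 <= (D k)%:R :> R by apply: ltn_natr; lia.
pose t := (hi (B i) 0 k + lo (B j) 0 k) / 2.
have tP : `|(P k)%:R - t| < w.
  by move: ni nj w0; rewrite !ltr_norml /t; lra.
have tD : 0 <= t <= (D k)%:R.
  by move: tP w1 P0 PD; rewrite ltr_norml; lra.
have [l al Bl] := probe_covered fi tD tP.
have := Bl k; rewrite probeK.
have [] := probe_block sk al Bl fi (fun m'' f => fills_uniq f fj) => /(bij_inj tb_bij) ->;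
  by move: lt; rewrite /t; lra.
Qed.

(** If the moved blocks overlapped, the probe in the middle of the overlap would be interior to
    both. *)
Lemma tie_ge (s : 'I_3 -> bool) k i j : s k -> fills (tb i) s -> fills (tb j) (flip k s) -> i <> j ->
  hi (B i) 0 k <= lo (B j) 0 k.
Proof.
move=> sk fi fj nij; rewrite leNgt; apply/negP => lt.
have ai := fills_adjacent fi; have aj := fills_adjacent fj.
have [n1 n2] := pert_near k ai; have [n3 n4] := pert_near k aj.
have [ei ej /(ltn_natr R) t1 /(ltn_natr R) t2] := tie_touch sk fi fj nij.
rewrite ei in n2; rewrite ej in n3.
pose t := (hi (B i) 0 k + lo (B j) 0 k) / 2.
have ti : lo (B i) 0 k < t < hi (B i) 0 k.
  by move: n1 n2 n3 w1 lt; rewrite !ltr_norml /t; lra.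
have tj : lo (B j) 0 k < t < hi (B j) 0 k.
  by move: n1 n2 n3 n4 w1 lt; rewrite !ltr_norml /t; lra.
have tP : `|(P k)%:R - t| < w.
  by move: n2 n3 w0; rewrite !ltr_norml /t; lra.
have hi_ := probe_in ai (fun l _ => fi l) ti.
have hj := probe_in aj (flip_side fj) tj.
case: loc => _ _ /(_ i j ai aj (introN eqP nij)) e.
have : set0 (probe s k t); last by [].
by rewrite -e; split; [split; apply/interior_boxP|exact: probe_ball].
Qed.

(** The host does not move: a face beyond its boundary would cover points outside, a face short of
    it would leave a hole. *)
Lemma tie_top (s : 'I_3 -> bool) k i : s k -> fills (tb i) s -> P k = D k -> hi (B i) 0 k = (P k)%:R.
Proof.
move=> sk fi PD.
have ai := fills_adjacent fi; have [n1 n2] := pert_near k ai.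
have ei : chi (tb i) k = P k by have := fi k; have := cwf (tb i) k; rewrite sk PD; lia.
have := fi k; rewrite sk => /andP[/(ltn_natr R) f1 _].
rewrite ei in n2; have c0 := ler0n R (clo (tb i) k).
have nofl m : ~ fills m (flip k s).
  by move=> /(_ k); rewrite /flip eqxx sk /= PD; have := cwf m k; lia.
pose t := (hi (B i) 0 k + (P k)%:R) / 2.
have tP : `|(P k)%:R - t| < w by move: n2 w0; rewrite !ltr_norml /t; lra.
apply/eqP; rewrite eq_le; apply/andP; split; rewrite leNgt; apply/negP => lt.
  have ti : lo (B i) 0 k < t < hi (B i) 0 k.
    by move: n1 n2 w1 lt f1; rewrite !ltr_norml /t; lra.
  have Bi : box_set (B i) (probe s k t).
    by move=> l; have := probe_in ai (fun l _ => fi l) ti l; lra.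
  case: loc => _ cov _.
  have : (\bigcup_(i in Defs.adjacent dplan p) box_set (B i) `&` ball p r) (probe s k t).
    by split; [exists i|exact: probe_ball].
  by rewrite cov => -[/(_ k) + _]; rewrite probeK /= !mxE -PD; move: lt; rewrite /t; lra.
have tD : 0 <= t <= (D k)%:R.
  by rewrite -PD; move: lt n2 w1 f1 c0; rewrite !ltr_norml /t; lra.
have [j aj Bj] := probe_covered fi tD tP.
have [] := probe_block sk aj Bj fi (fun m'' f => False_ind (m'' = tb i) (nofl m'' f)).
  by move=> /(bij_inj tb_bij) e; have := Bj k; rewrite probeK e; move: lt; rewrite /t; lra.
by move=> /(bij_inj tb_bij) e; have := Bj k; rewrite probeK e; move: lt; rewrite /t; lra.
Qed.

Lemma tie_bottom (s : 'I_3 -> bool) k i : ~~ s k -> fills (tb i) s -> P k = 0%N -> lo (B i) 0 k = (P k)%:R.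
Proof.
move=> sk fi P0.
have ai := fills_adjacent fi; have [n1 n2] := pert_near k ai.
have := fi k; rewrite (negbTE sk) => fik.
have ei : clo (tb i) k = P k by move: fik; rewrite P0; lia.
have /andP[_ /(ltn_natr R) f1] := fik.
have /andP[_ /(leq_natr R) f2] := cwf (tb i) k.
rewrite ei in n1.
have only j : Defs.adjacent dplan p j -> box_set (B j) (probe s k ((lo (B i) 0 k + (P k)%:R) / 2)) -> j = i.
  move=> aj Bj; apply: (bij_inj tb_bij); apply: fills_uniq fi => l.
  case: (eqVneq l k) => [->|nl]; last exact: (probe_fills aj Bj).
  have /adjacentP/(_ k) := aj; rewrite (negbTE sk) P0; have := cwf (tb j) k; lia.
pose t := (lo (B i) 0 k + (P k)%:R) / 2.
have tP : `|(P k)%:R - t| < w by move: n1 w0; rewrite !ltr_norml /t; lra.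
have P0r : (P k)%:R = 0 :> R by rewrite P0.
apply/eqP; rewrite eq_le; apply/andP; split; rewrite leNgt; apply/negP => lt.
  have tD : 0 <= t <= (D k)%:R.
    by move: lt n1 w1 f1 f2 P0r; rewrite !ltr_norml /t; lra.
  have [j aj Bj] := probe_covered fi tD tP.
  by have := Bj k; rewrite probeK (only j aj Bj); move: lt; rewrite /t; lra.
have ti : lo (B i) 0 k < t < hi (B i) 0 k.
  by move: n1 n2 w1 lt f1; rewrite !ltr_norml /t; lra.
have Bi : box_set (B i) (probe s k t).
  by move=> l; have := probe_in ai (fun l _ => fi l) ti l; lra.
case: loc => _ cov _.
have : (\bigcup_(i in Defs.adjacent dplan p) box_set (B i) `&` ball p r) (probe s k t).
  by split; [exists i|exact: probe_ball].
by rewrite cov => -[/(_ k) + _]; rewrite probeK /= !mxE; move: lt P0r; rewrite /t; lra.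
Qed.

(** [rigid] gathers the moved faces through [p] at a single coordinate [v k] in each direction, and
    these are the coordinates of [p']. All comparisons of faces with the point are then preserved by
    [near_nat_cmp]. *)
Lemma rigid_shape : rigid -> (exists i, is_vertex (dblock i) p) ->
  exists2 p', ball p r p' & same_local_shape dplan p B p'.
Proof.
move=> rg [i0 vi0].
case: (tb_bij) => g tbK gK.
pose val m k (b : bool) := (if b then hi (B (g m)) else lo (B (g m))) 0 k.
have t1 k (s : 'I_3 -> bool) m m' : s k -> fills m s -> fills m' (flip k s) -> m <> m' ->
    val m k true = val m' k false.
  move=> sk fm fm' nm; rewrite /val.
  have fm1 : fills (tb (g m)) s by rewrite gK.
  have fm2 : fills (tb (g m')) (flip k s) by rewrite gK.
  have ng : g m <> g m' by move/(can_inj gK).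
  by apply/eqP; rewrite eq_le (tie_ge sk fm1 fm2 ng) (tie_le sk fm1 fm2 ng).
have t2 k (s : 'I_3 -> bool) m : s k -> fills m s -> P k = D k -> val m k true = (P k)%:R.
  by move=> sk fm PD; apply: (tie_top sk) => //; rewrite gK.
have t3 k (s : 'I_3 -> bool) m : ~~ s k -> fills m s -> P k = 0%N -> val m k false = (P k)%:R.
  by move=> sk fm PD; apply: (tie_bottom sk) => //; rewrite gK.
have /fin_all_exists [v hv] := rg val t1 t2 t3.
have a0 : Defs.adjacent dplan p i0.
  move=> l; have /ltW lt := lo_lt_hi (dblock i0) l.
  by case: (vi0 l) => ->; apply/andP; split; first [exact: lexx|exact: lt].
have vnear k : `|(P k)%:R - v k| < w / 4.
  have /adjacentP a0' := a0; have [h1 h2] := hv k (tb i0) a0'; rewrite /val tbK in h1 h2.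
  have [n1 n2] := pert_near k a0.
  case: (vi0 k) => /eqP; rewrite pE ?loE ?hiE eqr_nat => /eqP e.
    by rewrite -h1 // e.
  by rewrite -h2 // e.
exists (\row_k v k).
  by apply/ball_row => k; rewrite pE mxE; have := vnear k; move: w0 wr; lra.
move=> i s ai.
suff key k : (if s k then lo (dblock i) 0 k < p 0 k <= hi (dblock i) 0 k
     else lo (dblock i) 0 k <= p 0 k < hi (dblock i) 0 k) =
   (if s k then lo (B i) 0 k < v k <= hi (B i) 0 k else lo (B i) 0 k <= v k < hi (B i) 0 k).
  split=> /fills_octantP h; apply/fills_octantP => k; have := h k.
    by rewrite key mxE.
  by rewrite mxE -key.
have /adjacentP ai' := ai; have [h1 h2] := hv k (tb i) ai'; rewrite /val tbK in h1 h2.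
have [n1 n2] := pert_near k ai; rewrite loE hiE pE !ltr_nat !ler_nat.
have h1' : clo (tb i) k = P k -> lo (B i) 0 k = v k by exact: h1.
have h2' : P k = chi (tb i) k -> v k = hi (B i) 0 k by move/esym/h2.
have [-> ->] := near_nat_cmp w1 n1 (vnear k) h1'.
by have [-> ->] := near_nat_cmp w1 (vnear k) n2 h2'.
Qed.

End Perturbed.

Lemma rigid_generic : rigid -> (exists i, is_vertex (dblock i) p) -> generic_at dplan p.
Proof.
move=> rg vx r r0.
have [w [w0 wr w1]] : exists w, [/\ 0 < w, w <= r & w <= 1 / 2].
  exists (Num.min r (1 / 2)); split; rewrite ?ge_min ?lexx ?orbT //.
  by rewrite lt_min r0; lra.
exists (w / 4); first by lra.
by move=> B loc; apply: (rigid_shape loc w0 wr w1).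
Qed.

End At.

Lemma dplan_generic : (forall P : 'I_3 -> nat,
  (exists m, forall k, P k = clo m k \/ P k = chi m k) ->
  rigid D clo chi P (fun k => (P k)%:R : R)) -> generic dplan.
Proof.
move=> h p [i vi].
pose P k := if p 0 k == lo (dblock i) 0 k then clo (tb i) k else chi (tb i) k.
have PE k : p 0 k = (P k)%:R.
  rewrite /P; case: eqP => [->|ne]; first by rewrite loE.
  by case: (vi k) => // ->; rewrite /= hiE.
have ep : p = \row_k (P k)%:R by apply/rowP => k; rewrite mxE PE.
rewrite ep; apply: rigid_generic.
  by apply: h; exists (tb i) => k; rewrite /P; case: ifP; [left|right].
by exists i => k; rewrite -ep.
Qed.

End Discrete.

(** * Cell plans as generic two-layer floor plans *)

Section CellPlan.
Variables (R : realType) (p r n : nat) (S : nat -> nat -> bool).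
Hypothesis Sp : forall x i, S x i -> (x < p)%N.
Hypothesis Sr : forall x i, S x i -> (i < r)%N.
Hypothesis cardn : #|blockT p r S| = n.

Local Notation T := (blockT p r S).

Definition tb (i : 'I_n) : T := enum_val (cast_ord (esym cardn) i).

Lemma tb_bij : bijective tb.
Proof.
exists (fun t => cast_ord cardn (enum_rank t)) => [i|t]; rewrite /tb.
  by rewrite enum_valK; apply/val_inj.
by rewrite -[RHS]enum_rankK; congr enum_val; apply/val_inj.
Qed.

Lemma dims_gt0 k : (0 < dims p r k)%N.
Proof. by move: k; apply: ord3_ind. Qed.

Lemma block_cov (v : 'I_3 -> nat) : (forall k, (v k < dims p r k)%N) ->
  exists m : T, forall k, (bclo m k <= v k < bchi m k)%N.
Proof.
move=> /(shape_cov Sp Sr) [b vb hb]; have [t et] := sh_surj Sp Sr vb.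
by exists t => k; rewrite /bclo /bchi et.
Qed.

Lemma block_uni (v : 'I_3 -> nat) (m m' : T) : (forall k, (bclo m k <= v k < bchi m k)%N) ->
  (forall k, (bclo m' k <= v k < bchi m' k)%N) -> m = m'.
Proof.
by move=> h h'; apply: sh_inj; apply: (shape_uni (sh_valid m) (sh_valid m') h h').
Qed.

Definition cell_plan : floor_plan R n :=
  dplan R tb_bij dims_gt0 (block_wf Sp Sr) block_cov block_uni.

Lemma cell_plan_generic : generic cell_plan.
Proof. by apply: dplan_generic => P hP; apply: plan_rigid. Qed.

Lemma cell_plan_two_layer : two_layer cell_plan.
Proof.
exists 1; first by rewrite mxE /dims /tri /= ltr01 ltr1n.
move=> i /=; rewrite !mxE /bclo /bchi.
case: (sh _) => [x j|x j|x j|j|j] /=; rewrite /dims /tri /=.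
- by constructor 3.
- by constructor 1.
- by constructor 2.
- by constructor 1.
- by constructor 2.
Qed.

Lemma cell_plan_gtl : generic_two_layer cell_plan.
Proof. by split; [exact: cell_plan_generic|exact: cell_plan_two_layer]. Qed.

Lemma side_coord i k b : side cell_plan i k b = (fcoord (tb i, b) k)%:R.
Proof. by rewrite /side /fcoord; case: b; rewrite /= mxE. Qed.

Lemma attached_natt (f g : 'I_n * bool) : natt (tb f.1, f.2) (tb g.1, g.2) ->
  attached cell_plan kX f g.
Proof.
case: f g => i b [j c] [/= e [y1 y2] [z1 z2]]; apply/attachedP.
split; first by rewrite !side_coord e.
by apply: ord3_ind => // _; rewrite !side_coord /fcoord /= !ltr_nat.
Qed.

Lemma wall_plane (f g : 'I_n * bool) c : (0 < c < (2 * p).+1)%N ->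
  fcoord (tb f.1, f.2) kX = c -> fcoord (tb g.1, g.2) kX = c ->
  dissection_plane cell_plan kX f = dissection_plane cell_plan kX g.
Proof.
move=> hc hf hg; have [|tA eA] := hub_ex Sp Sr (c := c); first by lia.
case: tb_bij => ti tbK tiK.
have back (h h' : T * bool) : rst (@natt p r S) h h' ->
    rst (attached cell_plan kX) (ti h.1, h.2) (ti h'.1, h'.2).
  apply: (@rst_sub _ _ _ _ (fun h : T * bool => (ti h.1, h.2))) => x y xy; apply: rst_step.
  by apply: attached_natt; rewrite /= !tiK; case: x y xy => ? ? [? ?].
have fE (h : 'I_n * bool) : h = (ti (tb h.1), h.2) by rewrite tbK; case: h.
apply: rst_plane; rewrite (fE f) (fE g).
have h1 := back _ _ (wall_hub Sp Sr hc eA hf).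
have h2 := back _ _ (wall_hub Sp Sr hc eA hg).
by apply: rst_trans h1 _; apply: rst_sym.
Qed.

End CellPlan.

Section Invariance.
Variables (R : realType) (p r n : nat) (S S' : nat -> nat -> bool).
Hypothesis Sp : forall x i, S x i -> (x < p)%N.
Hypothesis Sr : forall x i, S x i -> (i < r)%N.
Hypothesis Sp' : forall x i, S' x i -> (x < p)%N.
Hypothesis Sr' : forall x i, S' x i -> (i < r)%N.
Hypothesis cardn : #|blockT p r S| = n.
Hypothesis cardn' : #|blockT p r S'| = n.

(** The isomorphism induces a map [tau] of the interior coordinates, because each of them carries
    one plane. The unit blocks make [tau] strictly increasing up to [2 * p], hence the identity on
    its whole domain, and the edges keep their end planes. *)
Lemma teq_joined :
  topologically_equivalent (cell_plan R Sp Sr cardn) (cell_plan R Sp' Sr' cardn') ->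
  forall a b, (0 < a < (2 * p).+1)%N -> (0 < b < (2 * p).+1)%N -> joined p r S a b -> joined p r S' a b.
Proof.
set F := cell_plan _ _ _ _; set F' := cell_plan _ _ _ _.
move=> /(_ kX) [f [g [_ _ /= fs ft]]].
case: (tb_bij cardn) => ti tbK tiK.
pose t' e := tb cardn' (g e).
have coord' e b e' b' : dissection_plane F' kX (e, b) = dissection_plane F' kX (e', b') ->
    fcoord (tb cardn' e, b) kX = fcoord (tb cardn' e', b') kX.
  by move=> /plane_coord_eq; rewrite !side_coord => /eqP; rewrite eqr_nat => /eqP.
have fplane e b c : (0 < c < (2 * p).+1)%N -> fcoord (tb cardn e, b) kX = c -> forall e' b',
    fcoord (tb cardn e', b') kX = c -> dissection_plane F kX (e, b) = dissection_plane F kX (e', b').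
  by move=> hc h e' b' h'; exact: (@wall_plane R p r n S Sp Sr cardn (e, b) (e', b') c hc h h').
have /choice [tau tauP] : forall c, exists tau : nat, (0 < c < (2 * p).+1)%N ->
    (0 < tau < (2 * p).+1)%N /\ (forall e, (bclo (tb cardn e) kX = c -> bclo (t' e) kX = tau) /\
    (bchi (tb cardn e) kX = c -> bchi (t' e) kX = tau)).
  move=> c; have [hc|nc] := boolP (0 < c < (2 * p).+1)%N; last by exists 0%N.
  (* Some block starts at the plane and another one ends there, so the image of the plane lies
     inside the host. *)
  have [t0 e0] := block_from Sp Sr hc; have [t1 e1] := block_to Sp Sr hc.
  exists (bclo (t' (ti t0)) kX) => _.
  have all_e e : (bclo (tb cardn e) kX = c -> bclo (t' e) kX = bclo (t' (ti t0)) kX) /\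
    (bchi (tb cardn e) kX = c -> bchi (t' e) kX = bclo (t' (ti t0)) kX).
    have h0 : fcoord (tb cardn (ti t0), false) kX = c by rewrite /fcoord /= tiK.
    split=> h.
      have he : fcoord (tb cardn e, false) kX = c by [].
      by apply: (coord' (g e) false (g (ti t0)) false); rewrite -!fs (fplane _ _ _ hc he _ _ h0).
    have he : fcoord (tb cardn e, true) kX = c by [].
    by apply: (coord' (g e) true (g (ti t0)) false); rewrite -fs -ft (fplane _ _ _ hc he _ _ h0).
  split=> //.
  have := block_wf Sp' Sr' (t' (ti t0)) kX; have := block_wf Sp' Sr' (t' (ti t1)) kX.
  have [_] := all_e (ti t1); rewrite tiK => /(_ e1) ->.
  by rewrite /dims /tri /=; lia.
have tau_id : forall c, (0 < c <= 2 * p)%N -> tau c = c.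
  apply: increasing_id => c hc; first by have [] := tauP c hc.
  have [t [e1 e2]] := unit_block Sp Sr hc.
  have [|_ /(_ (ti t)) [h1 _]] := tauP c; first by lia.
  have [|_ /(_ (ti t)) [_ h2]] := tauP c.+1; first by lia.
  rewrite tiK in h1 h2; rewrite -(h1 e1) -(h2 e2).
  by have /andP[] := block_wf Sp' Sr' (t' (ti t)) kX.
move=> a b ha hb [t [e1 e2]]; exists (t' (ti t)).
have [_ /(_ (ti t)) [h1 _]] := tauP a ha; have [_ /(_ (ti t)) [_ h2]] := tauP b hb.
rewrite tiK in h1 h2; rewrite (h1 e1) (h2 e2) !tau_id //.
Qed.

End Invariance.

(** * Asymptotics *)

Lemma bin_le_exp2 n m : ('C(n, m) <= 2 ^ n)%N.
Proof.
elim: n m => [|n IH] [|m] //; first by rewrite bin0 expn_gt0.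
by rewrite binS expnS mul2n -addnn leq_add.
Qed.

Lemma expn_sub_ffact n m : ((n - m) ^ m <= n ^_ m)%N.
Proof.
elim: m n => [|m IH] n; first by rewrite ffactn0.
rewrite expnS ffactnS; apply: leq_mul; first exact: leq_subr.
by have := IH n.-1; rewrite -subn1 -subnDA add1n.
Qed.

(** The power w^w is at most the falling factorial of 2w of length w, which is w! times a binomial
    coefficient bounded by 4^w. *)
Lemma expnn_le_fact w : (w ^ w <= 4 ^ w * w`!)%N.
Proof.
have h := expn_sub_ffact (2 * w) w.
have -> : (w ^ w = (2 * w - w) ^ w)%N by congr expn; lia.
apply: leq_trans h _; rewrite -bin_ffact leq_mul2r.
by rewrite (_ : 4 = 2 ^ 2)%N // -expnM bin_le_exp2 orbT.
Qed.

Section Count.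
Variable R : realType.

Local Notation num n := #|` fset_set (topological_classes R n)|.

(** A member of the family is determined by its class together with [famE]. *)
Lemma family_bound w1 q2 a (bb : bool) n :
  n = (3 * (w1.+1 * q2.+2 * q2.+2 + bb) + 2 * pcols w1 q2 a bb + 2 * prows w1 q2 + 2)%N ->
  (w1.+1`! ^ (q2.+1 * q2.+2) <= num n * q2.+4 ^ (q2.+1 * q2.+2 * w1.+1))%N.
Proof.
move=> en; have [fin _] := topological_classes_bound R n.
have cn (F : famT w1 q2) : #|blockT (pcols w1 q2 a bb) (prows w1 q2) (famS a bb F)| = n.
  by rewrite en; exact: card_fam_blocks.
pose Fp (F : famT w1 q2) := cell_plan R (famS_p (F := F)) (famS_r (F := F)) (cn F).
pose X := fset_set (topological_classes R n).
have inX (F : famT w1 q2) : tclass (Fp F) \in X.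
  by rewrite in_fset_set // inE; exists (Fp F) => //; exact: cell_plan_gtl.
pose f (F : famT w1 q2) : X * {ffun 'I_q2.+1 * 'I_q2.+2 * 'I_w1.+1 -> 'I_q2.+4} :=
  ([` inX F]%fset, famE a bb F).
have finj : injective f.
  move=> F F' e; have ec : tclass (Fp F) = tclass (Fp F') := congr1 (fun x => fsval x.1) e.
  apply: (@fam_inj _ _ a bb) (congr1 snd e) => c d hc hd.
  have t : topologically_equivalent (Fp F) (Fp F').
    by apply: tclass_teq ec; exact: cell_plan_gtl.
  split; first exact: (teq_joined t).
  exact: (teq_joined (teq_sym t)).
have := leq_card f finj.
by rewrite card_famT card_prod -cardfE card_ffun !card_prod !card_ord.
Qed.

Lemma upper_nat : exists2 K : nat, (0 < K)%N & forall n, (0 < n)%N ->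
  (num n <= K ^ n * (max_roots n).+1 ^ (max_roots n).+1)%N.
Proof.
(* The trees contribute 65 times 2 to the power 2n + 1, once per layer, and 4n + 2 <= 6n; the word
   contributes 8^n. *)
exists (130 ^ 6 * 8)%N => [|n n0]; first by rewrite muln_gt0 expn_gt0.
have [_ bound] := topological_classes_bound R n.
apply: leq_trans bound _; rewrite card_plan_code -expnMn.
rewrite -expnD (_ : 65 * 2 = 130)%N // mulnAC leq_mul // expnMn leq_mul //.
by rewrite -expnM leq_pexp2l //; lia.
Qed.

Lemma max_roots_bounds n : (3 <= n)%N ->
  ((max_roots n).+1 <= n)%N /\ (3 * (max_roots n).+1 <= n + 5)%N.
Proof.
move=> n3; rewrite /max_roots; have := leq_divM (n + 2) 3.
by have := ltn_ceil (n + 2) (isT : (0 < 3)%N); lia.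
Qed.

Lemma upper_real : exists K : R, forall n, (3 <= n)%N ->
  ln ((num n)%:R : R) <= n%:R * K + (n%:R / 3 + 2) * ln (n%:R : R).
Proof.
have [K K0 hK] := upper_nat; exists (ln (K%:R : R)) => n n3.
have n1 : 1 <= n%:R :> R by rewrite ler1n; lia.
have l0 : 0 <= ln (n%:R : R) by exact: ln_ge0.
have lK : 0 <= ln (K%:R : R) by apply: ln_ge0; rewrite ler1n.
have [npos|] := ltnP 0 (num n); last first.
  rewrite leqn0 => /eqP ->; rewrite ln0 //; apply: addr_ge0; apply: mulr_ge0 => //.
have [Mn] := max_roots_bounds n3; have := hK n (ltnW (ltnW n3)).
set M := (max_roots n).+1 => le M3n.
have M0 : (0 < M)%N by [].
have {M3n}M3 : M%:R <= n%:R / 3 + 2 :> R.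
  by have := leq_natr R M3n; rewrite natrM natrD; lra.
have lnle : ln ((num n)%:R : R) <= ln ((K ^ n * M ^ M)%:R : R).
  by rewrite ler_ln ?posrE ?ltr0n // ?muln_gt0 ?expn_gt0 ?K0 ?ler_nat.
apply: le_trans lnle _.
rewrite natrM !natrX lnM ?posrE ?exprn_gt0 ?ltr0n //.
rewrite !lnXn ?ltr0n // -[_ *+ n]mulr_natl -[_ *+ M]mulr_natl lerD2l.
apply: ler_pM => //; first by apply: ln_ge0; rewrite ler1n.
by rewrite ler_ln ?posrE ?ltr0n // ?ler_nat //; lia.
Qed.

(** Each unit of [w] costs [D] blocks. Apart from the constant 2, the remaining [rho] blocks are
    written as 2a + 5bb, with [bb] the parity of [rho]; this is possible when [rho] is at least 5,
    whence the 7. *)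
Lemma lower_nat q2 n (D := (3 * q2.+2 ^ 2 + 4 * q2.+2)%N) (w := ((n - 7) %/ D)%N) :
  (D + 7 <= n)%N -> (w`! ^ (q2.+1 * q2.+2) <= num n * q2.+4 ^ (q2.+1 * q2.+2 * w))%N.
Proof.
move=> hn; have D0 : (0 < D)%N by rewrite /D; lia.
have w0 : (0 < w)%N by rewrite divn_gt0 //; lia.
have wD : (w * D <= n - 7)%N := leq_divM _ _.
pose rho := (n - 2 - w * D)%N; have rho5 : (5 <= rho)%N by rewrite /rho; lia.
have ew : w = w.-1.+1 by lia.
rewrite ew.
apply: (@family_bound w.-1 q2 (rho - 5 * odd rho)./2 (odd rho)).
rewrite /pcols /prows -ew.
have h : (2 * (rho - 5 * odd rho)./2 + 5 * odd rho = rho)%N.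
  by have := odd_double_half rho; case: (odd rho) => /= ?; lia.
have : (w * D = 3 * (w * q2.+2 * q2.+2) + 4 * (w * q2.+2))%N by rewrite /D; nia.
by rewrite /rho in h *; lia.
Qed.

Lemma ln_fact_ge (w : nat) : (0 < w)%N ->
  w%:R * (ln (w%:R : R) - ln 4) <= ln (w`!%:R : R).
Proof.
move=> w0; have w0r : 0 < w%:R :> R by rewrite ltr0n.
have f0 : 0 < w`!%:R :> R by rewrite ltr0n fact_gt0.
have : (w ^ w)%:R <= (4 ^ w * w`!)%:R :> R by rewrite ler_nat expnn_le_fact.
rewrite natrM !natrX -ler_ln ?posrE ?mulr_gt0 ?exprn_gt0 //.
rewrite lnM ?posrE ?exprn_gt0 // !lnXn // -![ln _ *+ w]mulr_natl mulrBr; lra.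
Qed.

Lemma lower_quot (n D w : nat) : (0 < D)%N -> (7 <= n)%N -> w = ((n - 7) %/ D)%N ->
  n%:R / D%:R - 8 <= w%:R :> R.
Proof.
move=> D0 n7 ->; have := ltn_ceil (n - 7) D0; set w' := ((n - 7) %/ D)%N => lt.
have h : (n <= w' * D + 8 * D)%N by nia.
have Dr : 0 < D%:R :> R by rewrite ltr0n.
rewrite lerBlDr ler_pdivrMr //.
have := leq_natr R h; rewrite natrD !natrM; lra.
Qed.

Lemma lower_real q2 (k := (q2.+1 * q2.+2)%N) (D := (3 * q2.+2 ^ 2 + 4 * q2.+2)%N) :
  exists2 C : R, 0 <= C & forall n, (16 * D + 7 <= n)%N -> C <= ln (n%:R : R) ->
    k%:R * ((n%:R / D%:R - 8) * (ln (n%:R : R) - C)) <= ln ((num n)%:R : R).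
Proof.
have D0 : (0 < D)%N by rewrite /D; lia.
exists (ln ((2 * D)%:R : R) + ln (4%:R : R) + ln (q2.+4%:R : R)) => [|n hn hC].
  by rewrite !addr_ge0 // ln_ge0 // ler1n; lia.
have hn' : (D + 7 <= n)%N by lia.
have := @lower_nat q2 n; rewrite -/D -/k => /(_ hn').
set w := ((n - 7) %/ D)%N => low.
have w0 : (0 < w)%N by rewrite divn_gt0 //; lia.
have n7 : (7 <= n)%N by lia.
have wq := lower_quot D0 n7 (erefl w).
have Dr : 0 < D%:R :> R by rewrite ltr0n.
have nr : 0 < n%:R :> R by rewrite ltr0n; lia.
have wr : 0 < w%:R :> R by rewrite ltr0n.
have E0 : 0 < q2.+4%:R :> R by rewrite ltr0n.
have f0 : 0 < w`!%:R :> R by rewrite ltr0n fact_gt0.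
have num0 : (0 < num n)%N.
  rewrite lt0n; apply/negP => /eqP e0; move: low; rewrite e0 mul0n leqn0 expn_eq0.
  by have := fact_gt0 w; rewrite lt0n => /negbTE ->.
have lnw : ln (n%:R : R) - ln ((2 * D)%:R : R) <= ln (w%:R : R).
  have D2 : 0 < (2 * D)%:R :> R by rewrite ltr0n; lia.
  rewrite -ln_div ?posrE // ler_ln ?posrE ?divr_gt0 //.
  (* Since n is at least 16 D, the 8 is at most half of n / D, so w is at least n / (2D). *)
  apply: le_trans wq; have h : (16 * D)%:R <= n%:R :> R by rewrite ler_nat; lia.
  rewrite natrM in h; rewrite natrM invfM mulrA [_ / 2 as X in X / _]mulrC.
  have : 16 <= n%:R / D%:R :> R by rewrite ler_pdivlMr.
  by rewrite -mulrA; lra.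
have lnlow : k%:R * ln (w`!%:R : R) <= ln ((num n)%:R : R) + (k * w)%:R * ln (q2.+4%:R : R).
  have num0r : 0 < (num n)%:R :> R by rewrite ltr0n.
  have p1 : 0 < (w`!%:R : R) ^+ k by exact: exprn_gt0.
  have p2 : 0 < (q2.+4%:R : R) ^+ (k * w) by exact: exprn_gt0.
  have : (w`!%:R : R) ^+ k <= (num n)%:R * (q2.+4%:R : R) ^+ (k * w).
    by rewrite -!natrX -natrM ler_nat.
  rewrite -ler_ln ?posrE //; last exact: mulr_gt0.
  by rewrite lnM ?posrE // !lnXn // -[ln _ *+ k]mulr_natl -[ln _ *+ (k * w)]mulr_natl.
have fw := ln_fact_ge w0.
have k0 : 0 <= k%:R :> R by [].
apply: (@le_trans _ _ (k%:R * (w%:R * (ln (n%:R : R) -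
   (ln ((2 * D)%:R : R) + ln (4%:R : R) + ln (q2.+4%:R : R)))))).
  by apply: ler_wpM2l => //; apply: ler_wpM2r => //; rewrite subr_ge0.
have step : w%:R * (ln (n%:R : R) - (ln ((2 * D)%:R : R) + ln (4%:R : R) + ln (q2.+4%:R : R))) <=
    ln (w`!%:R : R) - w%:R * ln (q2.+4%:R : R).
  apply: le_trans (lerB fw (lexx _)); rewrite -mulrBr; apply: ler_wpM2l; first exact: ltW.
  by move: lnw; lra.
apply: le_trans (ler_wpM2l k0 step) _.
by rewrite mulrBr mulrA -natrM; move: lnlow; lra.
Qed.

End Count.

(** In the upper bound the errors K / L and 2 / N are each below e / 2. In the lower bound k / D
    loses at most e / 2, and C / L and 8k / N are each below e / 4. *)
Lemma ratio_close (R : realType) (N L T K C k D e : R) :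
  0 < e -> 0 < N -> 0 < L -> 0 < D -> 0 <= k -> 0 <= C ->
  T <= N * K + (N / 3 + 2) * L -> k * ((N / D - 8) * (L - C)) <= T ->
  1 / 3 - e / 2 <= k / D -> k / D <= 1 ->
  2 * K < e * L -> 4 < e * N -> 4 * C < e * L -> 32 * k < e * N ->
  `|1 / 3 - T / (N * L)| < e.
Proof.
move=> e0 N0 L0 D0 k0 C0 up low b1 b2 hK h4 hC hk.
have NL0 : 0 < N * L by exact: mulr_gt0.
have f1 : N * (2 * K) < N * (e * L) by rewrite ltr_pM2l.
have f2 : L * 4 < L * (e * N) by rewrite ltr_pM2l.
have f3 : N * (4 * C) < N * (e * L) by rewrite ltr_pM2l.
have f4 : L * (32 * k) < L * (e * N) by rewrite ltr_pM2l.
have f5 : (N * L) * (1 / 3 - e / 2) <= (N * L) * (k / D) by rewrite ler_pM2l.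
have f6 : (N * C) * (k / D) <= (N * C) * 1 by apply: ler_wpM2l => //; apply: mulr_ge0 => //; exact: ltW.
have f7 : 0 <= k * C by exact: mulr_ge0.
have lowE : k * ((N / D - 8) * (L - C)) =
    (N * L) * (k / D) - (N * C) * (k / D) - 8 * (L * k) + 8 * (k * C) by ring.
rewrite lowE in low.
have u : T / (N * L) < 1 / 3 + e by rewrite ltr_pdivrMr //; lra.
have l : 1 / 3 - e < T / (N * L) by rewrite ltr_pdivlMr //; lra.
by rewrite ltr_norml; lra.
Qed.

(** With q = q2 + 2 the quotient is (q - 1) / (3q + 4), which differs from 1/3 by 7 / (9q + 12). *)
Lemma family_ratio (R : realType) (q2 : nat) (e : R) : 0 < e -> 2 / e < q2%:R ->
  let k := (q2.+1 * q2.+2)%N in let D := (3 * q2.+2 ^ 2 + 4 * q2.+2)%N in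
  1 / 3 - e / 2 <= k%:R / D%:R :> R /\ k%:R / D%:R <= 1 :> R.
Proof.
move=> e0; rewrite ltr_pdivrMr // => hq /=.
have D0 : 0 < (3 * q2.+2 ^ 2 + 4 * q2.+2)%:R :> R by rewrite ltr0n; lia.
split; last first.
  by rewrite ler_pdivrMr // mul1r ler_nat; nia.
have e1 : q2.+1%:R = q2%:R + 1 :> R by rewrite natr1.
have e2 : q2.+2%:R = q2%:R + 2 :> R by rewrite -natr1 e1; lra.
rewrite ler_pdivlMr // natrD !natrM e1 e2.
move: hq; move: (q2%:R : R) (ler0n R q2) => x x0 hq.
(* This product is the difference of the two sides after clearing the denominator. *)
have h : 0 <= (x + 2) * (e * x * (3 / 2) - 7 / 3 + 5 * e).
  by apply: mulr_ge0; lra.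
nra.
Qed.

Theorem theorem3 (R : realType) :
  (ln (#|` fset_set (topological_classes R n)|%:R : R) / (n%:R * ln n%:R) : R) @[n --> \oo]
    --> (1 / 3 : R).
Proof.
have [K hK] := upper_real R.
apply/cvgrPdist_lt => e e0.
have [q2 hq] : exists q2 : nat, 2 / e < q2%:R :> R.
  by exists (Num.truncn (2 / e)).+1; exact: truncnS_gt.
have [C C0 hC] := lower_real R q2; have [b1 b2] := family_ratio e0 hq.
move: hC b1 b2; set k := (q2.+1 * q2.+2)%N; set D := (3 * q2.+2 ^ 2 + 4 * q2.+2)%N => hC b1 b2.
have D0 : 0 < D%:R :> R by rewrite ltr0n /D; lia.
(* Once ln n exceeds [A], it exceeds [C], and e ln n exceeds both 2K and 4C. *)
pose A := (2 * `|K| + 4 * C) / e + C + 1.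
near=> n.
have n3 : (3 <= n)%N by near: n; exact: nbhs_infty_ge.
have nD : (16 * D + 7 <= n)%N by near: n; exact: nbhs_infty_ge.
have nA : expR A < n%:R by near: n; exact: nbhs_infty_gtr.
have nk : (4 + 32 * k%:R) / e < n%:R :> R by near: n; exact: nbhs_infty_gtr.
have N0 : 0 < n%:R :> R by rewrite ltr0n; lia.
have LA : A < ln (n%:R : R) by rewrite -[A]expRK ltr_ln ?posrE ?expR_gt0.
have K0 := normr_ge0 K; have KK := ler_norm K.
have q0 : 0 <= (2 * `|K| + 4 * C) / e by apply: divr_ge0; lra.
have eL : 2 * `|K| + 4 * C < e * ln (n%:R : R).
  have : (2 * `|K| + 4 * C) / e < ln (n%:R : R) by move: LA; rewrite /A; lra.
  by rewrite ltr_pdivrMr // [_ * e]mulrC.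
have eN : 4 + 32 * k%:R < e * n%:R :> R.
  by move: nk; rewrite ltr_pdivrMr // [_ * e]mulrC.
have k0 : 0 <= k%:R :> R by exact: ler0n.
apply: (@ratio_close R n%:R (ln n%:R) _ K C k%:R D%:R) => //.
- by move: LA; rewrite /A; lra.
- exact: hK.
- by apply: hC => //; move: LA; rewrite /A; lra.
- by lra.
- by lra.
- by lra.
- by lra.
Unshelve. all: by end_near.
Qed.
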